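(* Let $\sigma\in\mathcal M_+(X)$, let $K$ be a quasi-metric kernel on $X$, and let $1<q<\infty$, $\frac1p+\frac1q=1$. Let $f$ be a Borel function with $0\le f<\infty$ $\sigma$-a.e., and let $d\omega=f^q\,d\sigma$. Then the equation $u=Ku^q+\epsilon f$ ($\sigma$-a.e.) has a solution $u\in L^0_+(\sigma)$ for some $\epsilon>0$ if and only if any one of the following (hence equivalent) conditions holds: (2) both $$\sup_{x\in X,\ a>0}\left(\int_0^a\frac{|B_t(x)|_\sigma}{t^2}\,dt\right)\left(\int_a^\infty\frac{|B_t(x)|_\omega}{t^2}\,dt\right)^{q/p}<\infty$$ and, for some constant $C$, $\int_X (K g)^p\,d\omega\le C\int_X g^p\,d\sigma$ for all $0\le g\in L^p(\sigma)$; (3) both the inequality displayed in (2) and, for some constant $C$, $\int_B (K\omega_B)^q\,d\sigma\le C\,|B|_\omega$ for every ball $B=B_a(x)$, $x\in X$, $a>0$, where $d\omega_B=\chi_B\,d\omega$; (4) there is a constant $C$ such that $K(K\omega)^q\le C\,K\omega<\infty$ $\sigma$-a.e. (i.e. $K(Kf^q)^q\le C\,Kf^q<\infty$ $\sigma$-a.e.).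
   Context: $X$ is a metric space and $\mathcal M_+(X)$ is the set of positive $\sigma$-finite Borel measures on $X$; $\sigma$ is the underlying measure. $|E|_\mu=\mu(E)$. $L^0_+(\sigma)$ is the set of ($\sigma$-a.e. classes of) Borel functions $X\to[0,\infty)$. A quasi-metric kernel is a Borel function $K:X\times X\to(0,\infty]$ that is symmetric and for which there is a constant $\kappa\ge1$ with $$\frac1{K(x,y)}\le\kappa\left(\frac1{K(x,z)}+\frac1{K(z,y)}\right)\quad\text{for all }x,y,z\in X.$$ Put $\rho(x,y)=1/K(x,y)$ ($\rho(x,x)>0$ is allowed) and $B_a(x)=\{y\in X:\rho(x,y)\le a\}$ (possibly empty). For $\mu\in\mathcal M_+(X)$, $K\mu(x)=\int_X K(x,y)\,d\mu(y)$; for a nonnegative Borel function $f$, $Kf(x)=\int_X K(x,y)f(y)\,d\sigma(y)$. The usual convention $0\cdot\infty=0$ is used. *)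

(* Defs.v *)
From HB Require Import structures.
From mathcomp Require Import all_boot all_order all_algebra.
From mathcomp Require Import all_classical all_reals all_analysis.
From mathcomp Require Import measurable_realfun measurable_fun_approximation.

Set Implicit Arguments.
Unset Strict Implicit.
Unset Printing Implicit Defensive.

Import Order.TTheory GRing.Theory Num.Theory.
Import numFieldNormedType.Exports.

Local Open Scope classical_set_scope.
Local Open Scope ring_scope.

(* Measurable types carry a distinguished point, hence so do our metric
   spaces. *)
#[short(type="pmetricType")]
HB.structure Definition PointedMetric (R : numDomainType) :=
  {T of Metric R T & isPointed T}.

Notation borel T := (g_sigma_algebraType (@open T)).

Section kernels.
Context (R : realType) (X : pmetricType R).
Implicit Types (K : X -> X -> \bar R) (mu : {measure set (borel X) -> \bar R}).

Local Open Scope ereal_scope.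

(* Joint measurability is with respect to the Borel sets of the product
   topology on X * X; for non-separable X these may form a larger
   sigma-algebra than the product of the Borel sigma-algebras. *)
Record quasi_metric_kernel K : Prop := QuasiMetricKernel {
  qmk_borel : measurable_fun [set: borel (X * X)%type] 
    (fun z : X * X => K z.1 z.2) ;
  qmk_gt0 : forall x y, 0 < K x y ;
  qmk_sym : forall x y, K x y = K y x ;
  qmk_quasi_metric : exists2 kappa : R, (1 <= kappa)%R &
    forall x y z, (K x y)^-1 <= kappa%:E * ((K x z)^-1 + (K z y)^-1) }.

Definition rho K (x y : X) : \bar R := (K x y)^-1.

Definition qball K (x : X) (a : R) : set (borel X) :=
  [set y | rho K x y <= a%:E].

Definition potential K mu (x : X) : \bar R := \int[mu]_y K x y.

Definition kernel_op K mu (g : borel X -> \bar R) (x : X) : \bar R :=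
  \int[mu]_y (K x y * g y).

Definition cross_condition K mu (nu : {measure set (borel X) -> \bar R})
    (r : R) : Prop :=
  ereal_sup [set z | exists x : X, exists2 a : R, (0 < a)%R &
    z = (\int[lebesgue_measure]_(t in `]0%R, a])
           (mu (qball K x t) * (t ^- 2)%:E)) *
        (\int[lebesgue_measure]_(t in `[a, +oo[)
           (nu (qball K x t) * (t ^- 2)%:E)) `^ r] < +oo.

Lemma measurable_kernel_section K (x : X) : quasi_metric_kernel K ->
  measurable_fun [set: borel X] (K x).
Proof.
case=> mK _ _ _.
have mpair : measurable_fun [set: borel X]
    ((fun y => (x, y)) : borel X -> borel (X * X)%type).
  apply: (@measurability _ _ _ (borel (X * X)%type) setT _ (@open (X * X)%type)).
    by [].
  move=> _ [U oU <-]; rewrite setTI; apply: sub_sigma_algebra.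
  apply: open_comp => // y _.
  by apply: cvg_pair; [exact: cvg_cst | exact: cvg_id].
exact: (measurableT_comp mK mpair).
Qed.

Lemma measurable_qball K (hK : quasi_metric_kernel K) (x : X) (a : R) :
  measurable (qball K x a).
Proof.
have [a0|a0] := ltP 0%R a.
  rewrite (_ : qball K x a = setT `&` (K x @^-1` [set z | a^-1%:E <= z])).
    apply: (measurable_kernel_section x hK) => //.
    by rewrite -set_itvcy; exact: emeasurable_itv.
  rewrite setTI; apply/funext => y; apply/propext; rewrite /qball /rho /=.
  have := qmk_gt0 hK x y; case: (K x y) => [r| |] //; last first.
    by rewrite invey lee_fin ltW // leey.
  rewrite lte_fin => r0; rewrite inver gt_eqF // !lee_fin.
  by rewrite -(invrK a) lef_pV2 ?posrE ?invr_gt0// invrK.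
have [->|an0] := eqVneq a 0%R.
  rewrite (_ : qball K x 0%R = setT `&` (K x @^-1` [set +oo])).
    by apply: (measurable_kernel_section x hK) => //; exact: emeasurable_set1.
  rewrite setTI; apply/funext => y; apply/propext; rewrite /qball /rho /=.
  have := qmk_gt0 hK x y; case: (K x y) => [r| |] //.
  rewrite lte_fin => r0; rewrite inver gt_eqF // !lee_fin leNgt invr_gt0 r0.
  by split.
rewrite (_ : qball K x a = set0) //; apply/seteqP; split => // y.
rewrite /qball /rho /= => h; have : 0 <= a%:E.
  by apply: le_trans h; rewrite inve_ge0; exact/ltW/(qmk_gt0 hK).
by rewrite lee_fin => a0'; move: an0; rewrite eq_le a0 a0'.
Qed.

End kernels.

Section power_density.
Context d (T : measurableType d) (R : realType).
Variables (mu : {measure set T -> \bar R}) (f : T -> \bar R).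
Variables (mf : measurable_fun [set: T] f) (q : R).

Local Open Scope ereal_scope.

(* The measure f^q dmu. *)
Definition power_density (mf : measurable_fun [set: T] f) (A : set T) : \bar R :=
  \int[mu]_(x in A) (f x `^ q).

Let power_density0 : power_density mf set0 = 0.
Proof. by rewrite /power_density integral_set0. Qed.

Let power_density_ge0 A : 0 <= power_density mf A.
Proof. by apply: integral_ge0 => x _; exact: poweR_ge0. Qed.

Let measurable_fq : measurable_fun [set: T] (fun x => f x `^ q).
Proof.
exact: (measurableT_comp (measurable_poweR q) mf).
Qed.

Let power_density_semi_sigma_additive :
  semi_sigma_additive (power_density mf).
Proof.
by apply: semi_sigma_additive_nng_induced => // x; exact: poweR_ge0.
Qed.

HB.instance Definition _ := isMeasure.Build _ _ _ (power_density mf)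
  power_density0 power_density_ge0 power_density_semi_sigma_additive.

End power_density.

(* Main.v *)
Require Import Defs.
From mathcomp Require Import all_boot all_order all_algebra.
From mathcomp Require Import all_classical all_reals all_analysis.
From mathcomp Require Import measurable_realfun measurable_fun_approximation.
From mathcomp Require Import ring lra.

Set Implicit Arguments.
Unset Strict Implicit.
Unset Printing Implicit Defensive.

Import Order.TTheory GRing.Theory Num.Theory.
Import numFieldNormedType.Exports.
Import HBNNSimple.

Local Open Scope classical_set_scope.
Local Open Scope ring_scope.
Local Open Scope ereal_scope.

Set Bullet Behavior "Strict Subproofs".

(** Write Kg for the integral of K(x,y)g(y) against sigma, omega for the
    measure with density w = f^q, and B_r(x) for the balls of rho = 1/K.

    Everything rests on a dyadic model of K, whose quasi-metric inequality is
    used in the form min(K(x,z), K(z,y)) <= M K(x,y) ([quasi_metric_min]).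
    Since 1/rho(x,y) is comparable to the sum of 1/r_i over the scales r_i = r
    2^i with rho(x,y) <= r_i (as long as rho(x,y) >= r), Kg(x) is comparable,
    for r -> 0, to the sum of mass(B_{r_i}(x))/r_i, where mass(E) is the
    integral of g over E, and the quasi-metric inequality makes the part of
    this sum at scales >= r essentially constant on B_r(x)
    ([dyadic_potential_le_near], [kernel_op_le_far]). In this model the cross
    condition says that

       (sum_{i<n} sigma(B_{r_i}(x))/r_i)
         (sum_{i>=n} omega(B_{r_i}(x))/r_i)^(q-1) <= A,

    uniformly in x, r, n ([cross_dyadicP], using q/p = q-1).

    [solvable] implies [cond2]. Put v = u^q. Then Kv <= u and f^q <= eps^-q v
    almost everywhere, so both halves of [cond2] need only be proved with v in
    place of f^q. Let S_i be the dyadic potential of v at scales >= r_i. On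
    B_{r_i}(x) one has u >= Kv >= S_i/2M, hence v = u^q has there a mass of at
    least c S_i^q sigma(B_{r_i}(x)), that is, S_i - S_{i+1} >= c S_i^q d_i
    with d_i = sigma(B_{r_i}(x))/r_i. This is a discrete form of -S' >= c S^q,
    whose solutions satisfy S_n^(1-q) >= c(q-1) (d_0 + ... + d_{n-1}): the
    cross condition ([ode_step], [supersolution_cross]). For the norm
    inequality, telescoping gives (Kg)^p <= C K(g (Kg)^(p-1)) pointwise;
    integrating against v, moving K onto v, and applying Young's inequality
    together with ((Kg)^(p-1) Kv)^q <= (Kg)^p v, the last term is absorbed on
    the left ([truncated_power_le], [norm_inequality_of_supersolution]).

    [cond2] implies [cond3] by testing the norm inequality on g = 1_B (K
    omega_B)^(q-1) ([testing_of_norm_inequality]).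

    [cond3] implies [cond4]. On B_{r_i}(x), K omega splits into the potential
    of omega restricted to a ball, whose q-th power is integrated by the
    testing inequality, and a far part bounded by a multiple of S_i, now the
    dyadic potential of omega at scales >= r_i, for which the cross condition
    and summation by parts bound the sum of d_i S_i^q by C S_0
    ([dyadic_cross_sum], [pointwise_of_testing]).

    [cond4] implies [solvable]: for small eps and suitable delta, eps f +
    delta K(f^q) is a supersolution, and monotone iteration from 0 stays below
    it ([solution_of_pointwise]).

    Two analytic points need care. When X is not separable, K is measurable
    only for the Borel sets of X * X, which may be more than the product
    sigma-algebra, so the Fubini-Tonelli theorem is not at hand. Measurability
    of x |-> int H(x,y) dsigma(y) is obtained from open sets, where it follows
    from lower semicontinuity ([measurable_fun_section_integral]). The
    equality of int a Kb and int b Ka is replaced by an inequality up to a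
    constant, proved ball by ball and extended by an exhaustion argument
    ([kernel_op_exchange]). The absorption arguments require finite integrals,
    which is why they are run on truncated functions before passing to the
    limit. *)

(** * Limits, integrals and measures *)

(** Measurable induction: the simple approximations of a nonnegative function
    increase to it, so a property stable under the three operations passes from
    indicators to all such functions. *)
Lemma ge0_measurable_fun_ind d (T : measurableType d) (R : realType)
    (P : (T -> \bar R) -> Prop) :
  (forall A, measurable A -> P (fun x => (\1_A x)%:E)) ->
  (forall (c : R) f, (0 <= c)%R -> measurable_fun setT f ->
    (forall x, 0 <= f x) -> P f -> P (fun x => c%:E * f x)) ->
  (forall f g, measurable_fun setT f -> measurable_fun setT g ->
    (forall x, 0 <= f x) -> (forall x, 0 <= g x) ->
    P f -> P g -> P (fun x => f x + g x)) ->
  (forall f_ : (T -> \bar R)^nat, (forall n, measurable_fun setT (f_ n)) ->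
    (forall n x, 0 <= f_ n x) ->
    (forall x, nondecreasing_seq (f_ ^~ x)) ->
    (forall n, P (f_ n)) -> P (fun x => limn (f_ ^~ x))) ->
  forall f, measurable_fun setT f -> (forall x, 0 <= f x) -> P f.
Proof.
move=> Pind PZ PD Plim f mf f0.
pose g := nnsfun_approx measurableT mf.
have -> : f = (fun x => limn (fun n => (g n x)%:E)).
  apply/funext => x; apply/esym/cvg_lim => //.
  exact: (cvg_nnsfun_approx measurableT mf (fun x _ => f0 x)).
apply: Plim.
- by move=> n; exact/measurable_EFinP.
- by move=> n x; rewrite lee_fin.
- by move=> x m n mn; rewrite lee_fin; exact/lefP/nd_nnsfun_approx.
- move=> n.
  have -> : (fun x => (g n x)%:E) =
      (fun x => \sum_(r <- finmap.enum_fset (fset_set (range (g n))))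
         r%:E * (\1_(g n @^-1` [set r]) x)%:E).
    apply/funext => x; rewrite fimfunE fsbig_finite//= -sumEFin.
    by apply: eq_bigr => r _; rewrite EFinM.
  have : forall r, r \in finmap.enum_fset (fset_set (range (g n))) -> (0 <= r)%R.
    by move=> r; rewrite in_fset_set// inE => -[x _ <-].
  elim: (finmap.enum_fset _) => [_|r s IH rs].
    rewrite (_ : (fun _ => _) = (fun x => (\1_(set0 : set T) x)%:E)); first exact: Pind.
    by apply/funext => x; rewrite big_nil indic0.
  rewrite (_ : (fun _ => _) = (fun x => r%:E * (\1_(g n @^-1` [set r]) x)%:E +
     \sum_(j <- s) (j%:E * (\1_(g n @^-1` [set j]) x)%:E))); last first.
    by apply/funext => x; rewrite big_cons.
  have mi j : measurable_fun setT (fun x => (\1_(g n @^-1` [set j]) x)%:E : \bar R).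
    by apply/measurable_EFinP; exact: measurable_indic.
  have r0 : (0 <= r)%R by apply: rs; rewrite mem_head.
  have sge0 j : j \in s -> (0 <= j)%R by move=> js; apply: rs; rewrite inE js orbT.
  apply: PD => //.
  + exact: measurable_funeM.
  + by apply: emeasurable_sum => j _; exact: measurable_funeM.
  + by move=> x; rewrite mule_ge0// lee_fin.
  + move=> x; rewrite big_seq; apply: sume_ge0 => j js.
    by rewrite mule_ge0 ?lee_fin// sge0.
  + by apply: PZ => //; exact: Pind.
  + exact: IH.
Qed.

Lemma nondecreasing_le_limn (R : realType) (u : (\bar R)^nat) n :
  nondecreasing_seq u -> u n <= limn u.
Proof.
move=> /ereal_nondecreasing_cvgn/cvg_lim => ->//.
by apply: ereal_sup_ubound; exists n.
Qed.

(** w may be infinite: the convention 0 * oo = 0 is compatible with monotone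
    limits, because a nondecreasing sequence with limit 0 is identically 0. *)
Lemma limn_muler (R : realType) (u : (\bar R)^nat) (w : \bar R) :
  nondecreasing_seq u -> (forall n, 0 <= u n) -> 0 <= w ->
  limn (fun n => u n * w) = limn u * w.
Proof.
move=> ndu u0 w0; have cu : cvgn u by exact/ereal_nondecreasing_is_cvgn.
have [l0|l0] := eqVneq (limn u) 0.
  have un0 n : u n = 0.
    by apply/eqP; rewrite eq_le u0 andbT -l0; exact: nondecreasing_le_limn.
  by rewrite l0 mul0e; under eq_fun do rewrite un0 mul0e; rewrite lim_cst.
have [->|wx] := eqVneq w 0.
  by rewrite mule0; under eq_fun do rewrite mule0; rewrite lim_cst.
apply/cvg_lim => //; apply: cvgeM; [|exact: cu|exact: cvg_cst].
case: w w0 wx => [r| |]// _ wx; rewrite /mule_def ?fin_numE/= ?l0 ?orbT//=.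
by rewrite eqe in wx; rewrite wx; case: (limn _) l0.
by case: (limn _) l0.
Qed.

Lemma nneseriesZr_ge0 (R : realType) (u : (\bar R)^nat) (w : \bar R) :
  (forall i, 0 <= u i) -> 0 <= w ->
  \sum_(i <oo) (u i * w) = (\sum_(i <oo) u i) * w.
Proof.
move=> u0 w0; rewrite -limn_muler//.
- congr (limn _); apply/funext => n.
  by rewrite ge0_sume_distrl.
- exact: ereal_nondecreasing_series.
- by move=> n; exact: sume_ge0.
Qed.

Lemma ge0_integral_density d (T : measurableType d) (R : realType)
    (sigma mu : {measure set T -> \bar R}) (w : T -> \bar R) :
  measurable_fun setT w -> (forall x, 0 <= w x) ->
  (forall A, measurable A -> mu A = \int[sigma]_(x in A) w x) ->
  forall h, measurable_fun setT h -> (forall x, 0 <= h x) ->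
  \int[mu]_x h x = \int[sigma]_x (h x * w x).
Proof.
move=> mw w0 muE; apply: ge0_measurable_fun_ind.
- move=> A mA; rewrite integral_indic// setIT muE// integral_mkcond.
  by apply: eq_integral => x _; rewrite epatch_indic muleC.
- move=> c f c0 mf f0 IH; rewrite ge0_integralZl_EFin// IH -ge0_integralZl_EFin//.
  + by apply: eq_integral => x _; rewrite muleA.
  + by move=> x _; rewrite mule_ge0.
  + exact: emeasurable_funM.
- move=> f g mf mg f0 g0 IHf IHg; rewrite ge0_integralD// IHf IHg -ge0_integralD//.
  + by apply: eq_integral => x _; rewrite ge0_muleDl.
  + by move=> x _; rewrite mule_ge0.
  + exact: emeasurable_funM.
  + by move=> x _; rewrite mule_ge0.
  + exact: emeasurable_funM.
- move=> f_ mf f0 ndf IH; rewrite monotone_convergence//.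
  under eq_fun do rewrite IH.
  rewrite -monotone_convergence//.
  + apply: eq_integral => x _.
    by apply: limn_muler.
  + by move=> n; exact: emeasurable_funM.
  + by move=> n x _; rewrite mule_ge0.
  + by move=> x _ m n mn; rewrite lee_wpmul2r//; exact: ndf.
Qed.

(** Choose, inside each set of finite measure of an exhaustion of the space, a
    member of P that nearly attains the supremum of the measures of the members
    of P; the countable union of all choices cannot be enlarged by a non-null
    set. *)
Lemma exhaustion d (T : measurableType d) (R : realType)
    (mu : {sigma_finite_measure set T -> \bar R}) (P : set (set T)) :
  P set0 -> (forall A, P A -> measurable A) ->
  (forall F : (set T)^nat, (forall n, P (F n)) -> P (\bigcup_n F n)) ->
  exists2 U, P U & forall V, P V -> mu (V `\` U) = 0.
Proof.
move=> P0 Pm Pcup.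
have [E ET /all_and2[mE finE]] := sigma_finiteT mu.
have maxE k : exists2 U, P U & forall V, P V -> mu ((V `\` U) `&` E k) = 0.
  pose S := [set mu (V `&` E k) | V in P].
  have SE z : S z -> z <= mu (E k).
    move=> [V PV <-]; apply: le_measure; rewrite ?inE//.
    by apply: measurableI => //; exact: Pm.
  have s0 : 0 <= ereal_sup S.
    apply: ereal_sup_ubound; exists set0 => //.
    by rewrite set0I measure0.
  have sfin : ereal_sup S \is a fin_num.
    rewrite ge0_fin_numE//; apply: le_lt_trans (finE k).
    by apply: ge_ereal_sup => z /SE.
  have /choice[V /all_and2[PV sV]] n :
      exists V, P V /\ ereal_sup S - (n.+1%:R^-1)%:E < mu (V `&` E k).
    have /ereal_sup_gt[_ [V PV <-] ?] :
        ereal_sup S - (n.+1%:R^-1)%:E < ereal_sup S.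
      by rewrite lteBlDr// lteDl// lte_fin.
    by exists V.
  have PU := Pcup _ PV; exists (\bigcup_n V n) => // W PW.
  set U := \bigcup_n V n in PU *.
  have mU := Pm _ PU; have mW := Pm _ PW.
  have US : mu (U `&` E k) = ereal_sup S.
    apply/eqP; rewrite eq_le; apply/andP; split.
      by apply: ereal_sup_ubound; exists U.
    apply/lee_addgt0Pr => e e0.
    rewrite -leeBlDr//; apply: (@le_trans _ _ (mu (V (Num.truncn e^-1) `&` E k))).
      apply/ltW/le_lt_trans/sV; rewrite leeB// lee_fin.
      by rewrite -[leRHS]invrK lef_pV2 ?posrE ?invr_gt0// ltW// truncnS_gt.
    apply: le_measure; rewrite ?inE//; try exact: measurableI.
      by apply: measurableI => //; exact: Pm.
    by apply: setSI; exact: bigcup_sup.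
  have PUW : P (U `|` W).
    rewrite -bigcup2E; apply: Pcup => -[//|[//|//]].
  have : mu (U `&` E k) + mu ((W `\` U) `&` E k) <= mu (U `&` E k) + 0.
  {
    rewrite adde0 [leRHS]US -measureU//.
    - rewrite -setIUl setUDr setDv setD0; apply: ereal_sup_ubound.
      by exists (U `|` W).
    - exact: measurableI.
    - by apply: measurableI => //; exact: measurableD.
    - by apply/seteqP; split => // y [[Uy _] [[_ /(_ Uy)]]].
  }
  rewrite leeD2lE ?US// => h.
  by apply/eqP; rewrite eq_le h measure_ge0.
have /choice[U /all_and2[PU HU]] : forall k, exists U,
    P U /\ forall V, P V -> mu ((V `\` U) `&` E k) = 0.
  by move=> k; have [U PU HU] := maxE k; exists U.
exists (\bigcup_k U k); first exact: Pcup.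
move=> V PV; apply/eqP; rewrite eq_le measure_ge0 andbT.
have mUk k : measurable (U k) by exact: Pm.
have mV := Pm _ PV.
have -> : V `\` \bigcup_k U k = \bigcup_n ((V `\` \bigcup_k U k) `&` E n).
  by rewrite -setI_bigcupr -ET setIT.
have -> : 0 = \sum_(n <oo) mu ((V `\` \bigcup_k U k) `&` E n).
{
  rewrite eseries0// => n _ _; apply: subset_measure0 (HU n _ PV).
  - by apply: measurableI => //; apply: measurableD => //; exact: bigcup_measurable.
  - by apply: measurableI => //; exact: measurableD.
  - by apply: setSI; apply: setDS; exact: bigcup_sup.
}
apply: measure_sigma_subadditive => //.
- by move=> n; apply: measurableI => //; apply: measurableD => //; exact: bigcup_measurable.
- by apply: bigcup_measurable => n _; apply: measurableI => //; apply: measurableD => //; exact: bigcup_measurable.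
Qed.

Lemma ae_imp (R : realType) d (T : measurableType d) (mu : {measure set T -> \bar R}) (P Q : T -> Prop) :
  {ae mu, forall x, P x} -> (forall x, P x -> Q x) -> {ae mu, forall x, Q x}.
Proof. by move=> aeP PQ; apply: filterS aeP. Qed.

Lemma ae_conj (R : realType) d (T : measurableType d) (mu : {measure set T -> \bar R}) (P Q : T -> Prop) :
  {ae mu, forall x, P x} -> {ae mu, forall x, Q x} -> {ae mu, forall x, P x /\ Q x}.
Proof. by move=> aeP aeQ; apply: filterS2 aeP aeQ. Qed.

Lemma le_integral_limn (R : realType) d (T : measurableType d) (mu : {measure set T -> \bar R})
    (h : (T -> \bar R)^nat) (H : T -> \bar R) (C : \bar R) :
  (forall n, measurable_fun setT (h n)) -> (forall n x, 0 <= h n x) ->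
  (forall x, nondecreasing_seq (h^~ x)) ->
  measurable_fun setT H -> (forall x, 0 <= H x) ->
  (forall x, H x <= limn (h^~ x)) ->
  (forall n, \int[mu]_x h n x <= C) -> \int[mu]_x H x <= C.
Proof.
move=> mh h0 ndh mH H0 Hh hC.
have lim0 x : 0 <= limn (h^~ x).
  by apply: le_trans (h0 0%N x) _; exact: (@nondecreasing_le_limn _ (h^~ x)).
apply: (@le_trans _ _ (\int[mu]_x limn (h^~ x))).
  apply: ge0_le_integral => //.
  apply: (@emeasurable_fun_cvg _ _ _ _ h) => // x _.
  exact: ereal_nondecreasing_is_cvgn.
rewrite monotone_convergence//.
apply: lime_le; last exact: nearW.
apply: ereal_nondecreasing_is_cvgn => m n mn.
by apply: ge0_le_integral => // x _; exact: ndh.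
Qed.

(** * Measurability of integrals over sections *)

Section section_integral.
Context (R : realType) (X : pmetricType R).

Let measurable_pair (x : X) : measurable_fun [set: borel X]
  ((fun y => (x, y)) : borel X -> borel (X * X)%type).
Proof.
apply: (@measurability _ _ _ (borel (X * X)%type) setT _ (@open (X * X)%type)).
  by [].
move=> _ [U oU <-]; rewrite setTI; apply: sub_sigma_algebra.
apply: open_comp => // y _.
by apply: cvg_pair; [exact: cvg_cst | exact: cvg_id].
Qed.

Let fiber (E : set (X * X)) (x : X) : set (borel X) := [set y | E (x, y)].

Let measurable_fiber (E : set (borel (X * X)%type)) x :
  measurable E -> measurable (fiber E x).
Proof.
by move=> mE; rewrite -[fiber E x]setTI; exact: (measurable_pair x measurableT mE).
Qed.

Let open_superlevel (F : X -> \bar R) (r : \bar R) :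
  (forall x, r < F x -> exists2 e : R, (0 < e)%R &
    forall a, ball x e a -> r < F a) -> open [set x | r < F x].
Proof.
move=> FP; rewrite openE => x /= /FP[e e0 h].
by apply/nbhs_ballP; exists e => // a /h.
Qed.

(** The points y having a neighbourhood V with ball(x, 1/(n+1)) x V inside E
    form open sets that increase to the section at x; one of them already has
    measure > r, and it lies in the section at every point of that ball. *)
Let lower_semicontinuous_fiber (mu : {measure set (borel X) -> \bar R})
  (E : set (X * X)) : open E -> forall (r : \bar R) (x : X),
  r < mu (fiber E x) -> exists2 e : R, (0 < e)%R &
    forall a, ball x e a -> r < mu (fiber E a).
Proof.
move=> oE r x rx.
pose V n : set (borel X) :=
  [set y : X | \forall z \near y, ball x (n.+1%:R^-1 : R) `*` [set z] `<=` E].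
have oV n : @open X (V n).
  by rewrite openE => y; rewrite /interior/= /V/= => yV; exact: nbhs_interior.
have mV n : measurable (V n) by apply: sub_sigma_algebra; exact: oV.
have ndV : nondecreasing_seq V.
  move=> m n mn; apply/subsetPset => y; apply: filterS => z + [a b] [/= xa bz].
  apply; split => //=; apply: le_ball xa.
  by rewrite lef_pV2 ?posrE// ler_nat ltnS.
have VE : fiber E x = \bigcup_n V n.
  apply/seteqP; split => [y /= Exy|y [n _]]; last first.
    by move=> /nbhs_singleton; apply; split => //=; exact: ballxx.
  have [[A B]/= [/nbhs_ballP[e/= e0 eA] By] ABE] : nbhs (x, y) E.
    by move: oE; rewrite openE => /(_ _ Exy).
  exists (Num.truncn e^-1) => //; rewrite /V/=; apply: filterS By => z Bz [a b][/= xa ->].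
  apply: ABE; split => //=; apply: eA; apply: le_ball xa.
  by rewrite -[leRHS]invrK lef_pV2 ?posrE ?invr_gt0// ltW// truncnS_gt.
have cV : mu (V n) @[n --> \oo] --> mu (fiber E x).
  by rewrite VE; apply: nondecreasing_cvg_mu => //; exact: bigcup_measurable.
have [n rVn] : exists n, r < mu (V n).
  apply: contrapT => /forallNP h.
  move: rx; rewrite ltNge => /negP; apply.
  rewrite -(cvg_lim _ cV)//; apply: lime_le; first exact: cvgP cV.
  by apply: nearW => n; rewrite leNgt; apply/negP/h.
exists (n.+1%:R^-1)%R => // a xa.
apply: (lt_le_trans rVn); apply: le_measure; rewrite ?inE//.
- by apply: measurable_fiber; apply: sub_sigma_algebra.
- by move=> y /nbhs_singleton; apply.
Qed.

Let measurable_fun_fiber (mu : {finite_measure set (borel X) -> \bar R})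
  (E : set (borel (X * X)%type)) : measurable E ->
  measurable_fun [set: borel X] (fun x => mu (fiber E x)).
Proof.
apply: (@dynkin_induction _ (borel (X * X)%type) (@open (X * X)%type)
  [set E | measurable_fun [set: borel X] (fun x => mu (fiber E x))]); first by [].
- by move=> A B oA oB; exact: openI.
- exact: (measurable_cst (mu setT)).
- move=> A oA; apply: (measurability _ (ErealGenOInfty.measurableE R)).
  move=> _ [_ [r ->] <-]; rewrite setTI preimage_itvoy.
  apply: sub_sigma_algebra; apply: open_superlevel => x.
  exact: lower_semicontinuous_fiber.
- move=> A mA /= IH.
  rewrite (_ : (fun _ => _) = (fun x => mu [set: borel X] - mu (fiber A x))).
    exact: emeasurable_funB.
  apply/funext => x; rewrite (_ : fiber (~` A) x = setT `\` fiber A x) ?setTD// -setTD.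
  rewrite measureD//; last 2 first.
    exact: measurable_fiber.
    by rewrite ltey_eq fin_num_measure.
  by rewrite setTI.
- move=> F mF tF /= IH.
  rewrite (_ : (fun _ => _) = (fun x => \sum_(n <oo) mu (fiber (F n) x))).
    by apply: ge0_emeasurable_sum.
  apply/funext => x; rewrite -measure_semi_bigcup//.
  + by move=> n; exact: measurable_fiber.
  + apply/trivIsetP => i j _ _ ij.
    move/trivIsetP : tF => /(_ i j Logic.I Logic.I ij)/seteqP[FF _].
    by apply/seteqP; split => // y [Fi Fj]; exact: (FF (x, y)).
  + by apply: bigcup_measurable => n _; exact: measurable_fiber.
Qed.

(** H is measurable for the Borel sets of the product topology, and on a
    non-separable X these need not lie in the product sigma-algebra, hence the
    measurability part of the Tonelli theorem does not apply.  The substitute is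
    topological: for open E the measure of the section of E at x is lower
    semicontinuous in x, and the Borel sets follow by the pi-lambda theorem. *)
Lemma measurable_fun_section_integral
    (mu : {sigma_finite_measure set (borel X) -> \bar R}) (H : X * X -> \bar R) :
  measurable_fun [set: borel (X * X)%type] H -> (forall z, 0 <= H z) ->
  measurable_fun [set: borel X] (fun x => \int[mu]_y H (x, y)).
Proof.
move: H; apply: (@ge0_measurable_fun_ind _ (borel (X * X)%type) R
  (fun H => measurable_fun [set: borel X] (fun x => \int[mu]_y H (x, y)))).
- move=> A mA.
  have [E ET /all_and2[mE finE]] := sigma_finiteT mu.
  have mD n : measurable (seqDU E n).
    by apply: measurableD => //; exact: bigsetU_measurable.
  have finD n : mu (seqDU E n) < +oo.
    apply: le_lt_trans (finE n); apply: le_measure; rewrite ?inE//.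
    exact: subDsetl.
  rewrite (_ : (fun _ => _) = (fun x => \sum_(n <oo) mfrestr (mD n) (finD n) (fiber A x))).
    by apply: ge0_emeasurable_sum => // n _; exact: measurable_fun_fiber.
  apply/funext => x.
  rewrite (_ : \int[mu]_y _ = \int[mu]_y (\1_(fiber A x) y)%:E)//.
  rewrite integral_indic//; last exact: measurable_fiber.
  rewrite setIT -[in LHS](setIT (fiber A x)) ET seqDU_bigcup_eq setI_bigcupr.
  rewrite measure_semi_bigcup//.
  + by move=> n; apply: measurableI => //; exact: measurable_fiber.
  + apply/trivIsetP => i j _ _ ij.
    have /trivIsetP/(_ i j Logic.I Logic.I ij) := trivIset_seqDU E.
    by move=> h; rewrite setIACA h setI0.
  + by apply: bigcup_measurable => n _; apply: measurableI => //; exact: measurable_fiber.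
- move=> c f c0 mf f0 IH;
  have mfx x : measurable_fun [set: borel X] (fun y => f (x, y) : \bar R).
    exact: (measurableT_comp mf (measurable_pair x)).
  rewrite (_ : (fun _ => _) = (fun x => c%:E * \int[mu]_y f (x, y))).
    exact: measurable_funeM.
  by apply/funext => x; rewrite ge0_integralZl_EFin.
- move=> f g mf mg f0 g0 IHf IHg.
  have mfx h x : measurable_fun [set: borel (X * X)%type] h ->
     measurable_fun [set: borel X] (fun y => h (x, y) : \bar R).
    by move=> mh; exact: (measurableT_comp mh (measurable_pair x)).
  rewrite (_ : (fun _ => _) = (fun x => \int[mu]_y f (x, y) + \int[mu]_y g (x, y))).
    exact: emeasurable_funD.
  by apply/funext => x; rewrite ge0_integralD//; exact: mfx.
- move=> f_ mf f0 ndf IH.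
  have mfx h x : measurable_fun [set: borel (X * X)%type] h ->
     measurable_fun [set: borel X] (fun y => h (x, y) : \bar R).
    by move=> mh; exact: (measurableT_comp mh (measurable_pair x)).
  apply: (@emeasurable_fun_cvg _ (borel X) R setT (fun n x => \int[mu]_y f_ n (x, y)) _ IH) => x _.
  apply: (@cvg_monotone_convergence _ (borel X) R mu setT measurableT
    (fun n y => f_ n (x, y))).
  + by move=> n; exact: mfx.
  + by move=> n y _; exact: f0.
  + by move=> y _; exact: ndf.
Qed.

End section_integral.

(** * Elementary inequalities *)

Lemma gt0_le_poweR (R : realType) (r : R) (x y : \bar R) :
  (0 <= r)%R -> 0 <= x -> x <= y -> x `^ r <= y `^ r.
Proof.
move=> r0 x0 xy; apply: gt0_ler_poweR => //; rewrite in_itv/= ?leey ?andbT//.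
exact: le_trans xy.
Qed.

Lemma poweR_le_root (R : realType) (r : R) (x y : \bar R) :
  (0 < r)%R -> 0 <= x -> 0 <= y -> (x `^ r <= y) = (x <= y `^ r^-1).
Proof.
move=> r0 x0 y0; apply/idP/idP => h.
- rewrite -[x]poweRe1// -(mulfV (lt0r_neq0 r0)) poweRrM.
  by rewrite gt0_le_poweR ?poweR_ge0 ?invr_ge0 ?(ltW r0).
- rewrite -[leRHS]poweRe1// -(mulVf (lt0r_neq0 r0)) poweRrM.
  by rewrite gt0_le_poweR ?(ltW r0).
Qed.

Lemma poweR_sub1 (R : realType) (r : R) (x : \bar R) :
  (1 < r)%R -> 0 <= x -> x * x `^ (r - 1) = x `^ r.
Proof.
move=> r1 x0; rewrite -{1}[x]poweRe1// -poweRD.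
  by rewrite addrC subrK.
by rewrite add_neq0_poweRD_def// addrC subrK gt_eqF// (lt_trans _ r1).
Qed.

Lemma mul2e (R : realType) (x : \bar R) : 0 <= x -> 2%:E * x = x + x.
Proof.
move=> x0; have -> : 2%:E = 1%:E + 1%:E :> \bar R by rewrite -EFinD.
by rewrite ge0_muleDl// mul1e.
Qed.

Lemma poweR_sum_le (R : realType) (q : R) (a b : \bar R) : (0 < q)%R -> 0 <= a -> 0 <= b ->
  (a + b) `^ q <= (2 `^ q)%:E * (a `^ q + b `^ q).
Proof.
move=> q0 a0 b0.
have h c : 0 <= c -> (2%:E * c) `^ q = (2 `^ q)%:E * c `^ q by move=> c0; rewrite poweRM.
have [ab|/ltW ba] := leP a b.
- apply: (@le_trans _ _ ((2%:E * b) `^ q)).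
    apply: gt0_le_poweR; [exact: ltW|exact: adde_ge0|].
    by rewrite mul2e// leeD2r.
  by rewrite h// lee_wpmul2l ?lee_fin ?powR_ge0// leeDr// poweR_ge0.
- apply: (@le_trans _ _ ((2%:E * a) `^ q)).
    apply: gt0_le_poweR; [exact: ltW|exact: adde_ge0|].
    by rewrite mul2e// leeD2l.
  by rewrite h// lee_wpmul2l ?lee_fin ?powR_ge0// leeDl// poweR_ge0.
Qed.

Section conjugate.
Context (R : realType) (p q : R) (hq : (1 < q)%R) (hpq : (p^-1 + q^-1 = 1)%R).

Lemma conjugate_gt0 : (0 < q)%R. Proof. exact: lt_trans hq. Qed.

Lemma conjugate_gt1 : (1 < p)%R.
Proof.
have pi : (p^-1 = 1 - q^-1)%R by rewrite -hpq addrK.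
have : (0 < p^-1 < 1)%R.
  by rewrite pi subr_gt0 invf_lt1 ?conjugate_gt0// hq gtrBl invr_gt0 conjugate_gt0.
move=> /andP[p0 p1]; rewrite -(invrK p) invf_gt1//.
Qed.

Lemma conjugate_mul : (p * q = p + q)%R.
Proof.
have p0 : p != 0%R by rewrite gt_eqF// (lt_trans _ conjugate_gt1).
have q0 : q != 0%R by rewrite gt_eqF// conjugate_gt0.
by rewrite -[LHS]mulr1 -hpq; field; rewrite p0 q0.
Qed.

Lemma conjugate_sub1_div : (q / p = q - 1)%R.
Proof.
have p0 : p != 0%R by rewrite gt_eqF// (lt_trans _ conjugate_gt1).
by have := conjugate_mul => h; apply: (mulIf p0); rewrite divfK//; nra.
Qed.

Lemma conjugate_sub1_mul : ((q - 1) * p = q)%R.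
Proof. by have := conjugate_mul; nra. Qed.

(** Young's inequality with the constant in front of b^q as small as desired, so
    that this term can be absorbed. *)
Lemma young_eps (M eta : R) : (0 <= M)%R -> (0 < eta)%R -> exists2 D : R, (0 < D)%R &
  forall a b : \bar R, 0 <= a -> 0 <= b ->
    M%:E * (a * b) <= D%:E * a `^ p + eta%:E * b `^ q.
Proof.
move=> M0 eta0; have p1 := conjugate_gt1.
have p0 : (0 < p)%R by exact: lt_trans p1.
have q0 := conjugate_gt0.
(* d <= 1 and q > 1 give d^q <= d <= eta. *)
pose d : R := Num.min 1%R eta; pose D : R := ((M / d) `^ p + 1)%R.
have d0 : (0 < d)%R by rewrite lt_min ltr01.
have D0 : (0 < D)%R by rewrite ltr_wpDl ?powR_ge0.
have R0 (a b : \bar R) : 0 <= D%:E * a `^ p + eta%:E * b `^ q.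
  by rewrite adde_ge0// mule_ge0 ?poweR_ge0 ?lee_fin ?(ltW D0) ?(ltW eta0).
exists D => // -[a| |] [b| |]// a0 b0.
- rewrite !poweR_EFin -!EFinM -EFinD lee_fin.
  rewrite !lee_fin in a0 b0.
  have dle1 : (d <= 1)%R by rewrite ge_min lexx.
  have dle : (d <= eta)%R by rewrite ge_min lexx orbT.
  have -> : (M * (a * b) = (M / d * a) * (d * b))%R.
    by field; rewrite gt_eqF.
  have Md0 : (0 <= M / d)%R by rewrite divr_ge0// ltW.
  have Mda0 : (0 <= M / d * a)%R by rewrite mulr_ge0.
  have db0 : (0 <= d * b)%R by rewrite mulr_ge0// ltW.
  apply: le_trans (conjugate_powR Mda0 db0 p0 q0 hpq) _.
  have inv_le1 (r : R) : (1 < r -> 0 <= r^-1 <= 1)%R.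
    move=> r1; have r0 : (0 < r)%R by exact: lt_trans r1.
    by rewrite invr_ge0 (ltW r0) invf_le1// ltW.
  have /andP[pi0 pi1] := inv_le1 _ p1; have /andP[qi0 qi1] := inv_le1 _ hq.
  rewrite (powRM _ Md0)// (powRM _ (ltW d0))//.
  have dq : (d `^ q <= eta)%R.
    apply: le_trans dle; apply: ge1r_powR; rewrite ?d0//; exact: ltW.
  have a'0 := powR_ge0 a p; have b'0 := powR_ge0 b q.
  have m'0 := powR_ge0 (M / d) p; have d'0 := powR_ge0 d q.
  apply: lerD.
  + apply: (@le_trans _ _ ((M / d) `^ p * a `^ p)%R).
      by rewrite ler_piMr// mulr_ge0.
    by rewrite ler_wpM2r// lerDl.
  + apply: (@le_trans _ _ (d `^ q * b `^ q)%R).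
      by rewrite ler_piMr// mulr_ge0.
    by rewrite ler_wpM2r.
- have [->|a'] := eqVneq a%:E 0; first by rewrite mul0e mule0 R0.
  rewrite poweRyr ?gt_eqF// (gt0_muley (x := eta%:E)) ?lte_fin// addey ?leey//.
- have [->|b'] := eqVneq b%:E 0; first by rewrite mule0 mule0 R0.
  rewrite poweRyr ?gt_eqF// (gt0_muley (x := D%:E)) ?lte_fin// addye ?leey//.
- rewrite !poweRyr ?gt_eqF// (gt0_muley (x := D%:E)) ?lte_fin// addye ?leey//.
  by rewrite -ltNye (lt_le_trans ltNy0)// mule_ge0 ?lee_fin ?(ltW eta0).
Qed.

End conjugate.

(** Convexity of t^q in the form c^q - a^q <= q (c - a) c^(q-1), here with the
    increment c - a <= b. *)
Lemma poweR_le_telescope (R : realType) (q : R) (a b c : \bar R) : (1 < q)%R ->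
  0 <= a -> 0 <= b -> 0 <= c -> c <= a + b ->
  c `^ q <= a `^ q + q%:E * (b * c `^ (q - 1)).
Proof.
move=> q1 a0 b0 c0 cab.
have q0 : (0 < q)%R by exact: lt_trans q1.
have qm : (0 < q - 1)%R by rewrite subr_gt0.
have R0 : 0 <= a `^ q + q%:E * (b * c `^ (q - 1)).
  by rewrite adde_ge0 ?poweR_ge0// !mule_ge0 ?poweR_ge0 ?lee_fin ?(ltW q0).
have [cz|cn0] := eqVneq c 0; first by rewrite {1}cz poweR0r ?gt_eqF.
have cp : 0 < c `^ (q - 1) by rewrite poweR_gt0// lt0e cn0.
have [ay|ay] := eqVneq a +oo.
  rewrite ay poweRyr ?gt_eqF// addye ?leey//.
  by rewrite -ltNye (lt_le_trans ltNy0)// !mule_ge0 ?poweR_ge0 ?lee_fin ?(ltW q0).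
have [bye|by_] := eqVneq b +oo.
  rewrite bye gt0_mulye// gt0_muley ?lte_fin// addey ?leey//.
  by rewrite -ltNye (lt_le_trans ltNy0)// poweR_ge0.
move: a b c a0 b0 c0 cab ay by_ cn0 {cp R0} => [a| |]// [b| |]// [c| |]//.
rewrite -EFinD !lee_fin => a0 b0 c0 cab _ _ cn0.
have p0 : (0 < q / (q - 1))%R by rewrite divr_gt0.
have : (a * c `^ (q - 1) <= a `^ q / q + (c `^ (q - 1)) `^ (q / (q - 1)) / (q / (q - 1)))%R.
  apply: conjugate_powR => //; first exact: powR_ge0.
  by field; rewrite !gt_eqF.
rewrite -powRrM (mulrC (q - 1)%R) divfK ?gt_eqF//.
have -> : (c `^ q = c * c `^ (q - 1))%R.
  rewrite -{2}(powRr1 c0) -powRD; last by rewrite addrC subrK gt_eqF.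
  by rewrite addrC subrK.
have w0 : (0 <= c `^ (q - 1))%R by exact: powR_ge0.
move: (c `^ (q - 1))%R w0 (a `^ q)%R => w w0 A.
rewrite invf_div => h.
have : (q * (a * w) <= A + (q - 1) * (c * w))%R.
  by move: h; rewrite -(ler_pM2l q0) => /le_trans; apply; rewrite le_eqVlt; apply/orP; left; apply/eqP; field; rewrite gt_eqF.
have : (c * w <= (a + b) * w)%R by rewrite ler_wpM2r.
move=> h1 h2; nra.
Qed.

(** V plays the role of the tails of the series of b: telescoping the q-th powers
    of the tails gives a sum of b_i V_i^(q-1). *)
Lemma telescope_poweR_sum (R : realType) (q : R) (V b : (\bar R)^nat) n :
  (1 < q)%R -> (forall i, 0 <= V i) -> (forall i, 0 <= b i) ->
  (forall i, V i <= V i.+1 + b i) -> V n = 0 ->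
  V 0%N `^ q <= q%:E * \sum_(i < n) b i * V i `^ (q - 1).
Proof.
move=> q1 V0 b0; have q0 : (0 < q)%R by exact: lt_trans q1.
elim: n V b V0 b0 => [|n IH] V b V0 b0 Vb Vn.
  by rewrite big_ord0 mule0 Vn poweR0r ?gt_eqF.
have s0 (W c : (\bar R)^nat) : (forall i, 0 <= W i) -> (forall i, 0 <= c i) ->
    0 <= \sum_(i < n) c i * W i `^ (q - 1).
  by move=> W0 c0; apply: sume_ge0 => i _; rewrite mule_ge0// poweR_ge0.
rewrite big_ord_recl ge0_muleDr ?mule_ge0 ?poweR_ge0// ?(s0 (fun i => V i.+1) (fun i => b i.+1))//.
rewrite addeC.
apply: le_trans (poweR_le_telescope q1 (V0 1%N) (b0 0%N) (V0 0%N) (Vb 0%N)) _.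
by rewrite leeD2r//; exact: (IH (fun i => V i.+1) (fun i => b i.+1)).
Qed.

Lemma nneseries_le (R : realType) (u : (\bar R)^nat) (M : \bar R) :
  (forall i, 0 <= u i) -> (forall n, \sum_(i < n) u i <= M) ->
  \sum_(i <oo) u i <= M.
Proof.
move=> u0 uM; apply: lime_le; first exact: is_cvg_nneseries.
by apply: nearW => n; rewrite big_mkord.
Qed.

Lemma ge_nneseries (R : realType) (u : (\bar R)^nat) n :
  (forall i, 0 <= u i) -> \sum_(i < n) u i <= \sum_(i <oo) u i.
Proof.
by move=> u0; rewrite -(big_mkord xpredT); exact: nneseries_lim_ge.
Qed.

(** One step of a discrete version of the differential inequality
    -S' >= c S^(alpha+1), T' = 1, for which T S^alpha <= 1/(c alpha) is preserved.
    With t = S'/S the claim reduces to t^alpha (1 + alpha (1 - t)) <= 1, which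
    follows from t^alpha <= exp(-alpha (1 - t)) and 1 + z <= exp z. *)
Lemma ode_step (R : realType) (alpha c T b S S' beta : R) :
  (0 < alpha)%R -> (0 < c)%R -> (0 <= T)%R -> (0 <= b)%R -> (0 < S)%R ->
  (0 <= S')%R -> (S' <= S)%R ->
  (c * S `^ (alpha + 1) * b <= S - S')%R -> (T * S `^ alpha <= (c * alpha)^-1)%R ->
  ((T + b) * S' `^ alpha <= (c * alpha)^-1)%R.
Proof.
move=> a0 c0 T0 b0 S0 S'0 S'S hb hT.
have ca0 : (0 < c * alpha)%R by rewrite mulr_gt0.
have [->|S'n0] := eqVneq S' 0%R.
  by rewrite powR0 ?gt_eqF// mulr0 invr_ge0 ltW.
(* t^alpha measures the decay of S^alpha, and 1 - t bounds the growth of T. *)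
pose t : R := (S' / S)%R.
have t0 : (0 < t)%R by rewrite divr_gt0// lt0r S'n0.
have St : S' = (t * S)%R by rewrite divfK ?gt_eqF.
rewrite St powRM ?(ltW t0) ?(ltW S0)//.
have ta : (t `^ alpha * (1 + alpha * (1 - t)) <= 1)%R.
  have tE : (t `^ alpha <= expR (alpha * (t - 1)))%R.
    rewrite /powR gt_eqF// ler_expR ler_wpM2l ?(ltW a0)//.
    by have := @le_ln1Dx R (t - 1)%R; rewrite (addrC 1%R) subrK; apply; lra.
  have eE : (1 + alpha * (1 - t) <= expR (alpha * (1 - t)))%R by exact: expR_ge1Dx.
  apply: (@le_trans _ _ (expR (alpha * (t - 1)) * expR (alpha * (1 - t)))%R).
    apply: ler_pM => //; first exact: powR_ge0.
    have : (t <= 1)%R by rewrite ler_pdivrMr// mul1r.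
    by move=> t1; rewrite addr_ge0// mulr_ge0 ?subr_ge0// ltW.
  rewrite -expRD (_ : _ + _ = 0)%R ?expR0//; ring.
have Sb : (c * (S `^ alpha * b) <= 1 - t)%R.
  move: hb; rewrite powRD ?gt_eqF ?addr_gt0// powRr1 ?(ltW S0)// St.
  have -> : (c * (S `^ alpha * S) * b = S * (c * (S `^ alpha * b)))%R by ring.
  have -> : (S - t * S = S * (1 - t))%R by ring.
  by rewrite ler_pM2l.
have ti : (0 <= t `^ alpha)%R by exact: powR_ge0.
rewrite -(ler_pM2l ca0) mulfV ?gt_eqF//.
have {}hT : (c * alpha * (T * S `^ alpha) <= 1)%R.
  by rewrite -(mulfV (lt0r_neq0 ca0)) ler_pM2l.
apply: le_trans ta.
move: (t `^ alpha)%R (S `^ alpha)%R ti Sb hT => u v u0 Sb hT.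
have -> : (c * alpha * ((T + b) * (u * v)) = u * (c * alpha * (T * v) + alpha * (c * (v * b))))%R by ring.
by rewrite ler_wpM2l// lerD// ler_wpM2l// ltW.
Qed.

(** The condition x^p <= L is the same as x <= L^(1/p), which is closed under
    limits; infinite values need no separate treatment. *)
Lemma limn_poweR_le (R : realType) (a : (\bar R)^nat) (p : R) : (0 < p)%R ->
  nondecreasing_seq a -> (forall n, 0 <= a n) ->
  limn a `^ p <= limn (fun n => a n `^ p).
Proof.
move=> p0 nda a0.
have ndp : nondecreasing_seq (fun n => a n `^ p).
  by move=> m n mn; apply: gt0_le_poweR => //; [exact: ltW|exact: nda].
have a00 : 0 <= limn a by apply: le_trans (a0 0%N) _; exact: nondecreasing_le_limn.
have L0 : 0 <= limn (fun n => a n `^ p).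
  apply: (@le_trans _ _ (a 0%N `^ p)); first exact: poweR_ge0.
  exact: (@nondecreasing_le_limn _ (fun n => a n `^ p)).
rewrite poweR_le_root//; apply: lime_le.
  exact: ereal_nondecreasing_is_cvgn.
apply: nearW => n; rewrite -poweR_le_root//.
exact: (@nondecreasing_le_limn _ (fun n => a n `^ p)).
Qed.

Lemma limn_poweR (R : realType) (a : (\bar R)^nat) (p : R) : (0 < p)%R ->
  nondecreasing_seq a -> (forall n, 0 <= a n) ->
  limn (fun n => a n `^ p) = limn a `^ p.
Proof.
move=> p0 nda a0; apply/eqP; rewrite eq_le limn_poweR_le// andbT.
have pm : (0 <= p)%R by exact: ltW.
apply: lime_le.
  by apply: ereal_nondecreasing_is_cvgn => m n mn; apply: gt0_le_poweR => //; exact: nda.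
by apply: nearW => n; apply: gt0_le_poweR => //; exact: nondecreasing_le_limn.
Qed.

(** Truncating the n-th term at height n does not change a monotone limit.  This
    provides bounded functions to which the absorption arguments apply. *)
Lemma limn_truncate (R : realType) (a : (\bar R)^nat) : nondecreasing_seq a ->
  limn a <= limn (fun n => mine (a n) n%:R%:E).
Proof.
move=> nda.
have ndm : nondecreasing_seq (fun n => mine (a n) n%:R%:E).
  move=> m n mn; rewrite le_min !ge_min nda//=.
  by rewrite lee_fin ler_nat mn orbT.
set L := limn (fun n => mine (a n) n%:R%:E).
have aL n : mine (a n) n%:R%:E <= L.
  exact: (@nondecreasing_le_limn _ (fun n => mine (a n) n%:R%:E)).
have [Ly|Ly] := eqVneq L +oo; first by rewrite Ly leey.
have [m Lm] : exists m : nat, L < m%:R%:E.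
  move: Ly; case: L {aL} => [l _| |]//; last by exists 0%N; rewrite ltNyr.
  by exists (Num.truncn l).+1; rewrite lte_fin truncnS_gt.
apply: lime_le; first exact: ereal_nondecreasing_is_cvgn.
exists m => // n /= mn; have := aL n; rewrite ge_min => /orP[//|].
rewrite leNgt => /negP[]; apply: lt_le_trans Lm _.
by rewrite lee_fin ler_nat.
Qed.

(** The finiteness of Y is essential: for Y = +oo the hypothesis says nothing. *)
Lemma absorb_half (R : realType) (Y I : \bar R) : 0 <= Y -> Y < +oo -> 0 <= I ->
  Y <= I + (2^-1)%:E * Y -> Y <= 2%:E * I.
Proof.
case: Y => [y| |]//; case: I => [i| |]//; last first.
  by move=> _ _ _ _; rewrite gt0_muley// leey.
by rewrite -!EFinM -EFinD !lee_fin => _ _ _ h; lra.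
Qed.

(** Exists because q > 1: the choice delta^(q-1) = 1/(2^(q+1) (C+1)) makes
    2^q delta^q C at most delta/2, after which eps is taken small enough. *)
Lemma supersolution_constants (R : realType) (q C : R) : (1 < q)%R -> (0 <= C)%R ->
  exists eps delta : R, [/\ (0 < eps)%R, (0 < delta)%R &
    (2 `^ q * (eps `^ q + delta `^ q * C) <= delta)%R].
Proof.
move=> q1 C0; have q0 : (0 < q)%R by exact: lt_trans q1.
have qm : (0 < q - 1)%R by rewrite subr_gt0.
pose a : R := (2 `^ q)%R; have a0 : (0 < a)%R by exact: powR_gt0.
have aC : (0 < 2 * (a * (C + 1)))%R by rewrite !mulr_gt0// ltr_wpDl.
pose delta : R := ((2 * (a * (C + 1)))^-1 `^ (q - 1)^-1)%R.
have d0 : (0 < delta)%R by rewrite powR_gt0// invr_gt0.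
have dq : (delta `^ q * (2 * (a * (C + 1))) = delta)%R.
  have -> : (q = 1 + (q - 1))%R by ring.
  rewrite powRD; last by apply/implyP => _; rewrite gt_eqF.
  rewrite powRr1 ?(ltW d0)// -mulrA -[X in (delta * (X * _))%R]powRrM mulVf ?gt_eqF//.
  by rewrite powRr1 ?mulVf ?mulr1 ?gt_eqF// invr_ge0 ltW.
pose eps : R := ((delta / (2 * a)) `^ q^-1)%R.
have e0 : (0 < eps)%R by rewrite powR_gt0// divr_gt0// mulr_gt0.
have eq_ : (2 * a * eps `^ q = delta)%R.
  rewrite -powRrM mulVf ?gt_eqF// powRr1; last by rewrite divr_ge0 ?(ltW d0)// mulr_ge0// ltW.
  by field; rewrite gt_eqF.
exists eps, delta; split => //; rewrite -/a.
have h0 : (0 <= delta `^ q)%R by exact: powR_ge0.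
move: eq_ dq h0; move: (eps `^ q)%R (delta `^ q)%R => x y h1 h2 h0.
have : (0 <= a * y)%R by rewrite mulr_ge0// ltW.
nra.
Qed.

(** * Dyadic sums and integrals against dt/t^2 *)

Section dyadic_scales.
Context (R : realType).

Definition scale (r : R) (i : nat) : R := (r * 2 ^+ i)%R.

Lemma scale0 r : scale r 0 = r. Proof. by rewrite /scale expr0 mulr1. Qed.

Lemma scaleS r i : scale r i.+1 = scale (r * 2)%R i.
Proof. by rewrite /scale exprS mulrA. Qed.

Lemma scaleSr r i : scale r i.+1 = (scale r i * 2)%R.
Proof. by rewrite /scale exprSr mulrA. Qed.

Lemma scaleD r i j : scale (scale r i) j = scale r (i + j).
Proof. by rewrite /scale -mulrA -exprD. Qed.

Lemma scaleM c r i : scale (c * r)%R i = (c * scale r i)%R.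
Proof. by rewrite /scale mulrA. Qed.

Lemma scale_gt0 r i : (0 < r)%R -> (0 < scale r i)%R.
Proof. by move=> r0; rewrite mulr_gt0// exprn_gt0. Qed.

Lemma scale_small (r t : R) : (0 < r)%R -> (0 < t)%R ->
  exists i, ((scale r i)^-1 <= t)%R.
Proof.
move=> r0 t0; exists (Num.truncn (r * t)^-1).+1.
have rt : (0 < r * t)%R by rewrite mulr_gt0.
rewrite -[leRHS]invrK lef_pV2 ?posrE ?scale_gt0 ?invr_gt0// /scale.
rewrite -(ler_pM2l (_ : 0 < r^-1)%R) ?invr_gt0// mulKf ?gt_eqF// -invfM.
apply: (@le_trans _ _ ((Num.truncn (r * t)^-1).+1%:R)).
  exact/ltW/truncnS_gt.
by rewrite -natrX ler_nat ltnW// ltn_expl.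
Qed.

(** A geometric sum: its largest term is at most min(k, 1/r). *)
Lemma dyadic_sum_le (k : \bar R) n (r : R) : (0 < r)%R -> 0 <= k ->
  \sum_(i < n) (if (scale r i)^-1%:E <= k then (scale r i)^-1%:E else 0) <=
  2%:E * mine k r^-1%:E.
Proof.
elim: n r => [|n IH] r r0 k0.
  by rewrite big_ord0 mule_ge0 ?lee_fin// le_min k0 lee_fin invr_ge0 ltW.
rewrite big_ord_recl/= scale0.
under eq_bigr do rewrite scaleS.
have r20 : (0 < r * 2)%R by rewrite mulr_gt0.
apply: le_trans (leeD2l _ (IH (r * 2)%R r20 k0)) _.
have [rk|kr] := leP r^-1%:E k.
- have -> : mine k (r * 2)^-1%:E = (r * 2)^-1%:E.
    apply: min_r; apply: le_trans rk; rewrite lee_fin invfM.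
    by rewrite ler_piMr ?invr_ge0 ?(ltW r0)// invf_le1// ler1n.
  rewrite -EFinM -EFinD -EFinM lee_fin le_eqVlt; apply/orP; left; apply/eqP.
  by field; rewrite gt_eqF.
- by rewrite add0e lee_pmul2l// ge_min lexx.
Qed.

(** The largest term not exceeding k is within a factor 2 of k, unless it is the
    first one. *)
Lemma dyadic_sum_ge (k : \bar R) (r : R) : (0 < r)%R -> 0 < k ->
  mine k r^-1%:E <=
  2%:E * \sum_(i <oo) (if (scale r i)^-1%:E <= k then (scale r i)^-1%:E else 0).
Proof.
move=> r0 k0; set u := fun i => if (scale r i)^-1%:E <= k then (scale r i)^-1%:E else 0.
rewrite -/u.
have u0 i : 0 <= u i.
  by rewrite /u; case: ifP => // _; rewrite lee_fin invr_ge0 ltW// scale_gt0.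
have uS n : u n <= \sum_(i <oo) u i.
  apply: le_trans (ge_nneseries n.+1 u0); rewrite big_ord_recr/= leeDr//.
  exact: sume_ge0.
have [rk|kr] := leP r^-1%:E k.
  apply: (@le_trans _ _ (1 * u 0%N)); first by rewrite mul1e /u scale0 rk.
  by rewrite lee_pmul// lee_fin ler1n.
case: k k0 kr @u u0 uS => [k| |]// k0 kr u u0 uS.
rewrite lte_fin in k0.
have := scale_small r0 k0.
have exP : exists i, (fun i => ((scale r i)^-1 <= k)%R) i by exact: scale_small.
case: (ex_minnP exP) => -[|i] ik imin _.
  by move: kr; rewrite lte_fin ltNge -(scale0 r) ik.
apply: (@le_trans _ _ (2%:E * u i.+1)); last by rewrite lee_pmul2l//; exact: uS.
rewrite /u lee_fin ik -EFinM lee_fin scaleSr.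
have : (k < (scale r i)^-1)%R.
  by rewrite ltNge; apply/negP => /imin; rewrite ltnn.
have si : scale r i != 0%R by rewrite gt_eqF// scale_gt0.
by move=> /ltW /le_trans; apply; rewrite le_eqVlt; apply/orP; left; apply/eqP; field.
Qed.

End dyadic_scales.

(** The factor t^-2 has integral 1/(2a) over ]a, 2a], while h is monotone;
    integrals against t^-2 dt are therefore sums of h(r_i)/r_i up to constants. *)
Section dyadic_integrals.
Context (R : realType).
Variables (h : R -> \bar R) (h0 : forall t, 0 <= h t)
  (hnd : forall s t, (s <= t)%R -> h s <= h t).

Let mh (D : set R) : measurable D -> measurable_fun D h.
Proof.
move=> mD; apply: measurable_funTS.
apply: (measurability _ (ErealGenOInfty.measurableE R)).
move=> _ [_ [r ->] <-]; rewrite setTI preimage_itvoy.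
apply: is_interval_measurable => s t /= rs rt u /andP[su ut].
by apply: lt_le_trans rs _; exact: hnd.
Qed.

Let mt2 (D : set R) : (forall t, D t -> (0 < t)%R) -> measurable D ->
  measurable_fun D (fun t : R => (t ^- 2)%:E).
Proof.
move=> D0 mD; apply/measurable_EFinP.
apply: (eq_measurable_fun (fun t : R => t `^ (-2))%R) => [t|].
  by rewrite inE => /D0 t0; rewrite powRN -[X in powR _ X]/(2%:R) powR_mulrn// ltW.
exact: measurable_funTS (@measurable_powR R (-2)%R).
Qed.

Let int_const (a b : R) (c : \bar R) : (0 < a)%R -> (a <= b)%R -> 0 <= c ->
  \int[lebesgue_measure]_(t in `]a, b]) c = c * (b - a)%:E.
Proof.
move=> a0 ab c0; rewrite integral_cst//=; congr (_ * _).
rewrite lebesgue_measure_itv/= lte_fin EFinB; case: ltP => // ba.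
by rewrite (le_anti (introT andP (conj ab ba))) subee.
Qed.

Let dyadic_piece (a : R) : (0 < a)%R ->
  h a * ((4 * a)^-1)%:E <= \int[lebesgue_measure]_(t in `]a, (a * 2)%R]) (h t * (t ^- 2)%:E)
   <= h (a * 2)%R * (a^-1)%:E.
Proof.
move=> a0; have a2 : (a <= a * 2)%R by lra.
have int0 t : `]a, (a * 2)%R]%classic t -> (0 < t)%R.
  by rewrite /= in_itv/= => /andP[at_ _]; exact: lt_trans at_.
have mf : measurable_fun `]a, (a * 2)%R]%classic (fun t => h t * (t ^- 2)%:E).
  by apply: emeasurable_funM; [exact: mh|exact: mt2].
apply/andP; split.
- rewrite (_ : _ * _ = \int[lebesgue_measure]_(t in `]a, (a * 2)%R]) (h a * ((a * 2) ^- 2)%:E)).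
  { apply: ge0_le_integral => //.
    + by move=> t _; rewrite mule_ge0// lee_fin invr_ge0 sqr_ge0.
    + move=> t; rewrite /= in_itv/= => /andP[at_ ta]; have t0 := lt_trans a0 at_.
      apply: lee_pmul => //; first by rewrite lee_fin invr_ge0 sqr_ge0.
        by apply: hnd; exact: ltW.
      by rewrite lee_fin lef_pV2 ?posrE ?exprn_gt0// ?lerXn2r ?nnegrE//; lra. }
  rewrite int_const//; last by rewrite mule_ge0// lee_fin invr_ge0 sqr_ge0.
  rewrite -muleA; congr (_ * _); rewrite -EFinM; congr EFin.
  by field; rewrite gt_eqF.
- rewrite (_ : _ * a^-1%:E = \int[lebesgue_measure]_(t in `]a, (a * 2)%R]) (h (a * 2)%R * (a ^- 2)%:E)).
  { apply: ge0_le_integral => //.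
    + by move=> t _; rewrite mule_ge0// lee_fin invr_ge0 sqr_ge0.
    + move=> t; rewrite /= in_itv/= => /andP[at_ ta]; have t0 := lt_trans a0 at_.
      apply: lee_pmul => //; first by rewrite lee_fin invr_ge0 sqr_ge0.
        exact: hnd.
      by rewrite lee_fin lef_pV2 ?posrE ?exprn_gt0// ?lerXn2r ?nnegrE//; lra. }
  rewrite int_const//; last by rewrite mule_ge0// lee_fin invr_ge0 sqr_ge0.
  rewrite -muleA; congr (_ * _); rewrite -EFinM; congr EFin.
  by field; rewrite gt_eqF.
Qed.

Let F (t : R) : \bar R := h t * (t ^- 2)%:E.

Let F0 t : 0 <= F t.
Proof. by rewrite mule_ge0// lee_fin invr_ge0 sqr_ge0. Qed.

Let mF (D : set R) : (forall t, D t -> (0 < t)%R) -> measurable D -> measurable_fun D F.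
Proof. by move=> D0 mD; apply: emeasurable_funM; [exact: mh|exact: mt2]. Qed.

Let int_split n (r : R) : (0 < r)%R ->
  \int[lebesgue_measure]_(t in `]r, scale r n]) F t =
  \sum_(i < n) \int[lebesgue_measure]_(t in `]scale r i, (scale r i * 2)%R]) F t.
Proof.
move=> r0; elim: n => [|n IH].
  by rewrite scale0 big_ord0 set_itvoc0 integral_set0.
have sn : (r <= scale r n)%R by rewrite ler_peMr ?(ltW r0)// exprn_ege1// ler1n.
have ssn : (scale r n <= scale r n * 2)%R.
  by rewrite ler_peMr ?ler1n// ltW// scale_gt0.
rewrite big_ord_recr/= -IH -ge0_integral_setU//.
- rewrite scaleSr; congr (integral _ _ _).
  by rewrite -itv_bndbnd_setU.
- apply: mF => [t|]; last exact: measurableU.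
  by case; rewrite /= in_itv/= => /andP[+ _]; apply: lt_trans => //; exact: scale_gt0.
- rewrite disj_set2E; apply/eqP/seteqP; split => // t [] /=.
  rewrite !in_itv/= => /andP[_ tn] /andP[nt _].
  by have := lt_le_trans nt tn; rewrite ltxx.
Qed.

Lemma sum_le_integral_near n (r : R) : (0 < r)%R ->
  \sum_(i < n) (scale r i)^-1%:E * h (scale r i) <=
  4%:E * \int[lebesgue_measure]_(t in `]0%R, scale r n]) (h t * (t ^- 2)%:E).
Proof.
move=> r0.
apply: (@le_trans _ _ (4%:E * \int[lebesgue_measure]_(t in `]r, scale r n]) F t)).
  rewrite int_split// ge0_sume_distrr; last by move=> i _; exact: integral_ge0.
  apply: lee_sum => i _; have si := scale_gt0 i r0.
  have /andP[h1 _] := dyadic_piece si.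
  apply: (@le_trans _ _ (4%:E * (h (scale r i) * ((4 * scale r i)^-1)%:E))).
    rewrite muleCA -EFinM muleC lee_wpmul2l// lee_fin le_eqVlt; apply/orP; left.
    by apply/eqP; field; rewrite gt_eqF.
  by rewrite lee_pmul2l.
rewrite lee_pmul2l//; apply: ge0_subset_integral => //.
- by apply: mF => // t; rewrite /= in_itv/= => /andP[].
- move=> t; rewrite /= !in_itv/= => /andP[rt ->]; rewrite andbT.
  exact: lt_trans rt.
Qed.

Lemma sum_le_integral_far (r : R) : (0 < r)%R ->
  \sum_(i <oo) (scale r i)^-1%:E * h (scale r i) <=
  4%:E * \int[lebesgue_measure]_(t in `[r, +oo[) (h t * (t ^- 2)%:E).
Proof.
move=> r0; apply: nneseries_le => [i|n].
  by rewrite mule_ge0// lee_fin invr_ge0 ltW// scale_gt0.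
apply: (@le_trans _ _ (4%:E * \int[lebesgue_measure]_(t in `]r, scale r n]) F t)).
  rewrite int_split// ge0_sume_distrr; last by move=> i _; exact: integral_ge0.
  apply: lee_sum => i _; have si := scale_gt0 i r0.
  have /andP[h1 _] := dyadic_piece si.
  apply: (@le_trans _ _ (4%:E * (h (scale r i) * ((4 * scale r i)^-1)%:E))).
    rewrite muleCA -EFinM muleC lee_wpmul2l// lee_fin le_eqVlt; apply/orP; left.
    by apply/eqP; field; rewrite gt_eqF.
  by rewrite lee_pmul2l.
rewrite lee_pmul2l//; apply: ge0_subset_integral => //.
- by apply: mF => // t; rewrite /= in_itv/= andbT; exact: lt_le_trans.
- by move=> t; rewrite /= !in_itv/= andbT => /andP[rt _]; exact: ltW.
Qed.

Let int_pieces_le n (r : R) : (0 < r)%R ->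
  \int[lebesgue_measure]_(t in `]r, scale r n]) F t <=
  \sum_(i < n) (scale r i)^-1%:E * h (scale r i.+1).
Proof.
move=> r0; rewrite int_split//; apply: lee_sum => i _.
have /andP[_ +] := dyadic_piece (scale_gt0 i r0).
by rewrite muleC scaleSr.
Qed.

Lemma integral_far_le (r : R) : (0 < r)%R ->
  \int[lebesgue_measure]_(t in `[r, +oo[) (h t * (t ^- 2)%:E) <=
  2%:E * \sum_(i <oo) (scale (r * 2) i)^-1%:E * h (scale (r * 2) i).
Proof.
move=> r0; have r20 : (0 < r * 2)%R by rewrite mulr_gt0.
have s0 i : 0 <= (scale (r * 2) i)^-1%:E * h (scale (r * 2) i).
  by rewrite mule_ge0// lee_fin invr_ge0 ltW// scale_gt0.
rewrite -integral_itv_obnd_cbnd; last first.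
  by apply: mF => // t; rewrite /= in_itv/= andbT; exact: lt_trans.
pose G n : set R := `]r, scale r n]%classic.
have UG : `]r, +oo[%classic = \bigcup_n G n.
  apply/seteqP; split => t /=; last first.
    by move=> [n _]; rewrite /G/= !in_itv/= andbT => /andP[].
  rewrite in_itv/= andbT => rt.
  have t0 : (0 < t)%R by exact: lt_trans rt.
  have ti : (0 < t^-1)%R by rewrite invr_gt0.
  have [n] := scale_small r0 ti.
  by rewrite lef_pV2 ?posrE ?scale_gt0// => tn; exists n => //; rewrite /G/= in_itv/= rt.
have ndG : nondecreasing_seq G.
  move=> m n mn; apply/subsetPset => t; rewrite /G/= !in_itv/= => /andP[-> tm]/=.
  by apply: le_trans tm _; rewrite ler_pM2l// ler_weXn2l// ler1n.
have mG n : measurable (G n) by exact: measurable_itv.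
have mFG n : measurable_fun (G n) F.
  by apply: mF => // t; rewrite /G/= in_itv/= => /andP[+ _]; exact: lt_trans.
have cv := ge0_nondecreasing_set_cvg_integral (mu := @lebesgue_measure R)
  ndG mG mFG (fun i x _ => F0 x).
rewrite UG -(cvg_lim _ cv)//; apply: lime_le; first exact: cvgP cv.
apply: nearW => n; apply: le_trans (int_pieces_le n r0) _.
apply: (@le_trans _ _ (2%:E * \sum_(i < n) (scale (r * 2) i)^-1%:E * h (scale (r * 2) i))).
  rewrite ge0_sume_distrr//; apply: lee_sum => i _; rewrite scaleS muleA.
  rewrite lee_wpmul2r// -EFinM lee_fin -scaleS scaleSr le_eqVlt; apply/orP; left.
  by apply/eqP; field; rewrite gt_eqF// scale_gt0.
by rewrite lee_pmul2l// ge_nneseries.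
Qed.

(** The integral starts at 0, so there is no smallest scale: finite sums ending
    at the scale r are considered, with arbitrarily small first scale s. *)
Lemma integral_near_le (r : R) (C : \bar R) : (0 < r)%R ->
  (forall s n, (0 < s)%R -> scale s n = r ->
    \sum_(i < n.+1) (scale s i)^-1%:E * h (scale s i) <= C) ->
  \int[lebesgue_measure]_(t in `]0%R, r]) (h t * (t ^- 2)%:E) <= 2%:E * C.
Proof.
move=> r0 hC.
pose s n : R := (r / 2 ^+ n)%R.
have s0 n : (0 < s n)%R by rewrite divr_gt0// exprn_gt0.
have sr n : scale (s n) n = r by rewrite /scale divfK// gt_eqF// exprn_gt0.
pose G n : set R := `]s n, r]%classic.
have UG : `]0%R, r]%classic = \bigcup_n G n.
  apply/seteqP; split => t /=; last first.
    move=> [n _]; rewrite /G/= !in_itv/= => /andP[st ->]; rewrite andbT.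
    exact: lt_trans st.
  rewrite in_itv/= => /andP[t0 tr].
  have tr0 : (0 < t / (2 * r))%R by rewrite divr_gt0// mulr_gt0.
  have [n] := scale_small (ltr01 : (0 < 1 :> R)%R) tr0.
  rewrite /scale mul1r => nt; exists n => //; rewrite /G/= in_itv/= tr andbT.
  apply: (@le_lt_trans _ _ (r * (t / (2 * r)))%R).
    by rewrite /s ler_pM2l.
  have -> : (r * (t / (2 * r)) = t / 2)%R by field; rewrite gt_eqF.
  by rewrite ltr_pdivrMr//; lra.
have ndG : nondecreasing_seq G.
  move=> m n mn; apply/subsetPset => t; rewrite /G/= !in_itv/= => /andP[st ->].
  rewrite andbT; apply: le_lt_trans st.
  by rewrite /s ler_pM2l// lef_pV2 ?posrE ?exprn_gt0// ler_weXn2l// ler1n.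
have mG n : measurable (G n) by exact: measurable_itv.
have mFG n : measurable_fun (G n) F.
  apply: mF => // t; rewrite /G/= in_itv/= => /andP[+ _]; exact: lt_trans.
have cv := ge0_nondecreasing_set_cvg_integral (mu := @lebesgue_measure R) ndG mG mFG (fun i x _ => F0 x).
rewrite UG -(cvg_lim _ cv)//; apply: lime_le; first exact: cvgP cv.
apply: nearW => n; rewrite /G -[in X in `]_, X]%classic](sr n).
apply: le_trans (int_pieces_le n (s0 n)) _.
apply: (@le_trans _ _ (2%:E * \sum_(i < n) (scale (s n) i.+1)^-1%:E * h (scale (s n) i.+1))).
  rewrite ge0_sume_distrr//; last first.
    by move=> i _; rewrite mule_ge0// lee_fin invr_ge0 ltW// scale_gt0.
  apply: lee_sum => i _; rewrite muleA lee_wpmul2r// -EFinM lee_fin scaleSr.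
  by rewrite le_eqVlt; apply/orP; left; apply/eqP; field; rewrite gt_eqF// scale_gt0.
rewrite lee_pmul2l//; apply: le_trans (hC _ _ (s0 n) (sr n)).
rewrite big_ord_recl leeDr// mule_ge0// lee_fin invr_ge0 ltW// scale_gt0//.
Qed.

End dyadic_integrals.

(** * Dyadic form of the kernel operator *)

(** The quasi-metric inequality without reciprocals, and therefore without
    case distinctions at infinite values; M is twice the quasi-metric constant. *)
Lemma quasi_metric_min (R : realType) (X : pmetricType R) (K : X -> X -> \bar R) :
  quasi_metric_kernel K -> exists2 M : R, (1 <= M)%R &
    forall x y z, mine (K x z) (K z y) <= M%:E * K x y.
Proof.
move=> hK; have [k k1 hk] := qmk_quasi_metric hK.
exists (2 * k)%R => [|x y z]; first by nra.
move: (hk x y z) (qmk_gt0 hK x y) (qmk_gt0 hK x z) (qmk_gt0 hK z y).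
have k0 : (0 < 2 * k)%R by nra.
case: (K x y) => [r| |]//; last by rewrite gt0_muley ?lte_fin// leey.
case: (K x z) => [s| |]//; case: (K z y) => [t| |]//; rewrite ?lte_fin => + r0 s0 t0;
  rewrite ?invey ?inver ?gt_eqF// ?add0e ?adde0 -?EFinD -?EFinM ?lee_fin ?mule0 ?lee_fin.
- move=> h; rewrite -EFin_min lee_fin leNgt; apply/negP; rewrite lt_min => /andP[rs rt].
  have krp : (0 < 2 * k * r)%R by rewrite mulr_gt0.
  have : (s^-1 < (2 * k * r)^-1)%R by rewrite ltf_pV2 ?posrE.
  have : (t^-1 < (2 * k * r)^-1)%R by rewrite ltf_pV2 ?posrE.
  have E : (k * ((2 * k * r)^-1 + (2 * k * r)^-1) = r^-1)%R by field; nra.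
  move=> h1 h2; have : (k * (s^-1 + t^-1) < r^-1)%R.
    by rewrite -E ltr_pM2l ?ltrD// (lt_le_trans _ k1).
  by rewrite ltNge h.
- move=> h; rewrite min_l ?leey// lee_fin.
  rewrite -(ler_pM2r (_ : 0 < r^-1)%R) ?invr_gt0// mulfK ?gt_eqF//.
  have : (s * r^-1 <= s * (k / s))%R by rewrite ler_pM2l.
  by rewrite mulrCA divff ?gt_eqF// mulr1; nra.
- move=> h; rewrite ?min_r ?leey// ?lee_fin.
  rewrite -(ler_pM2r (_ : 0 < r^-1)%R) ?invr_gt0// mulfK ?gt_eqF//.
  have : (t * r^-1 <= t * (k / t))%R by rewrite ler_pM2l.
  by rewrite mulrCA divff ?gt_eqF// mulr1; nra.
- by rewrite mulr0 leNgt invr_gt0 r0.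
Qed.

Section potentials.
Context (R : realType) (X : pmetricType R).
Variable sigma : {sigma_finite_measure set (borel X) -> \bar R}.
Variables (K : X -> X -> \bar R) (hK : quasi_metric_kernel K).
Variables (M : R) (M1 : (1 <= M)%R).
Hypothesis hM : forall x y z, mine (K x z) (K z y) <= M%:E * K x y.

Local Notation B := (qball K).
Local Notation op := (kernel_op K sigma).
Local Notation meas g := (measurable_fun [set: borel X] g).

Let M0 : (0 < M)%R. Proof. exact: lt_le_trans M1. Qed.

Let K0 x y : 0 < K x y. Proof. exact: qmk_gt0. Qed.

Let Kge0 x y : 0 <= K x y. Proof. exact: ltW. Qed.

Let KC x y : K x y = K y x. Proof. exact: qmk_sym. Qed.

Let mK x : meas (K x). Proof. exact: measurable_kernel_section. Qed.

Let mB x a : measurable (B x a). Proof. exact: measurable_qball. Qed.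

Lemma qballE x (a : R) y : (0 < a)%R -> B x a y <-> a^-1%:E <= K x y.
Proof.
move=> a0; rewrite /qball /rho /=.
have := K0 x y; case: (K x y) => [r| |] //; last first.
  by rewrite invey lee_fin ltW // leey.
rewrite lte_fin => r0; rewrite inver gt_eqF // !lee_fin.
by rewrite -(invrK a) lef_pV2 ?posrE ?invr_gt0// invrK.
Qed.

Lemma qball_indic x (a : R) y : (0 < a)%R ->
  (\1_(B x a) y)%:E = if a^-1%:E <= K x y then 1 else 0 :> \bar R.
Proof.
move=> a0; rewrite indicE; case: ifPn => h.
  by rewrite mem_set//; apply/qballE.
by rewrite memNset// => /(qballE _ _ a0); apply/negP.
Qed.

(** Since rho(y,z) <= M max(rho(y,x), rho(x,z)), two points of B_b(x) are at
    distance at most M b of each other. *)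
Lemma qball_near x y z (a b : R) : (0 < a)%R -> (a <= b)%R ->
  B x a y -> B x b z -> B y (M * b)%R z.
Proof.
move=> a0 ab; have b0 : (0 < b)%R by exact: lt_le_trans ab.
rewrite !qballE ?mulr_gt0// => xy xz.
rewrite invfM EFinM -(@lee_pmul2l _ M%:E) ?lte_fin// muleA -EFinM divff ?gt_eqF//.
rewrite div1r; apply: le_trans (hM y z x); rewrite le_min xz andbT KC.
by apply: le_trans xy; rewrite lee_fin lef_pV2.
Qed.

Lemma subset_qball x (s t : R) : (s <= t)%R -> B x s `<=` B x t.
Proof. by move=> st y /le_trans; apply; rewrite lee_fin. Qed.

Definition mass (g : borel X -> \bar R) (A : set (borel X)) : \bar R :=
  \int[sigma]_(y in A) g y.

(** The general set function m allows the measure sigma as well as the mass of a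
    density; likewise in [dyadic_potential]. *)
Definition dyadic_term (m : set (borel X) -> \bar R) x r i : \bar R :=
  (scale r i)^-1%:E * m (B x (scale r i)).

Definition dyadic_potential m x r := \sum_(i <oo) dyadic_term m x r i.

(** A model of min(K, 1/r), see [dyadic_kernel_le] and [dyadic_kernel_ge]. *)
Definition dyadic_kernel x r y : \bar R :=
  \sum_(i <oo) (scale r i)^-1%:E * (\1_(B x (scale r i)) y)%:E.

Let dterm_ge0 (r : R) i (z : \bar R) : (0 < r)%R -> 0 <= z ->
  0 <= (scale r i)^-1%:E * z.
Proof. by move=> r0 z0; rewrite mule_ge0// lee_fin invr_ge0 ltW// scale_gt0. Qed.

Lemma dyadic_kernel_ge0 x r y : (0 < r)%R -> 0 <= dyadic_kernel x r y.
Proof. by move=> r0; apply: nneseries_ge0 => i _ _; rewrite dterm_ge0// lee_fin. Qed.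

Let dyadic_kernelE x r y : (0 < r)%R -> dyadic_kernel x r y =
  \sum_(i <oo) (if (scale r i)^-1%:E <= K x y then (scale r i)^-1%:E else 0).
Proof.
move=> r0; apply: eq_eseriesr => i _; rewrite qball_indic ?scale_gt0//.
by case: ifPn => _; rewrite ?mule1 ?mule0.
Qed.

Lemma dyadic_kernel_le x r y : (0 < r)%R ->
  dyadic_kernel x r y <= 2%:E * mine (K x y) r^-1%:E.
Proof.
move=> r0; rewrite dyadic_kernelE//; apply: nneseries_le => [i|n].
  by case: ifP => // _; rewrite lee_fin invr_ge0 ltW// scale_gt0.
exact: dyadic_sum_le.
Qed.

Lemma dyadic_kernel_ge x r y : (0 < r)%R ->
  mine (K x y) r^-1%:E <= 2%:E * dyadic_kernel x r y.
Proof. by move=> r0; rewrite dyadic_kernelE//; exact: dyadic_sum_ge. Qed.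

Lemma measurable_dyadic_kernel x r : (0 < r)%R -> meas (dyadic_kernel x r).
Proof.
move=> r0; apply: ge0_emeasurable_sum => [i y _ _|i _].
  by rewrite dterm_ge0// lee_fin.
by apply: measurable_funeM; apply/measurable_EFinP; exact: measurable_indic.
Qed.

Lemma mass_indic g A : mass g A = \int[sigma]_y ((\1_A y)%:E * g y).
Proof.
rewrite /mass integral_mkcond; apply: eq_integral => y _.
by rewrite epatch_indic muleC.
Qed.

Lemma dyadic_potentialE g x r : (0 < r)%R -> meas g -> (forall y, 0 <= g y) ->
  dyadic_potential (mass g) x r = \int[sigma]_y (dyadic_kernel x r y * g y).
Proof.
move=> r0 mg g0.
have m1 i : meas (fun y => (\1_(B x (scale r i)) y)%:E * g y).
  apply: emeasurable_funM => //; apply/measurable_EFinP.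
  exact: measurable_indic.
have -> : (fun y => dyadic_kernel x r y * g y) = (fun y =>
    \sum_(i <oo) (scale r i)^-1%:E * ((\1_(B x (scale r i)) y)%:E * g y)).
  apply/funext => y; rewrite -nneseriesZr_ge0//.
    by apply: eq_eseriesr => i _; rewrite muleA.
  by move=> i; rewrite dterm_ge0// lee_fin.
rewrite integral_nneseries//.
- apply: eq_eseriesr => i _; rewrite ge0_integralZl_EFin//.
  + by rewrite -mass_indic.
  + by move=> y _; rewrite mule_ge0.
  + by rewrite invr_ge0 ltW// scale_gt0.
- by move=> i; exact: measurable_funeM.
- by move=> i y _; rewrite dterm_ge0// mule_ge0.
Qed.

Lemma kernel_op_ge0 g x : (forall y, 0 <= g y) -> 0 <= op g x.
Proof. by move=> g0; apply: integral_ge0 => y _; rewrite mule_ge0. Qed.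

Lemma le_kernel_op g h x : meas g -> meas h -> (forall y, 0 <= g y) ->
  (forall y, g y <= h y) -> op g x <= op h x.
Proof.
move=> mg mh g0 gh; apply: ge0_le_integral => //.
- by move=> y _; rewrite mule_ge0.
- exact: emeasurable_funM.
- exact: emeasurable_funM.
- by move=> y _; rewrite lee_wpmul2l.
Qed.

Let le_dyadic g x r C h : (0 < r)%R -> (0 <= C)%R -> meas g -> (forall y, 0 <= g y) ->
  meas h -> (forall y, dyadic_kernel x r y <= C%:E * h y) -> (forall y, 0 <= h y) ->
  dyadic_potential (mass g) x r <= C%:E * \int[sigma]_y (h y * g y).
Proof.
move=> r0 C0 mg g0 mh le h0; rewrite dyadic_potentialE// -ge0_integralZl_EFin//; last 2 first.
  by move=> y _; rewrite mule_ge0.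
  exact: emeasurable_funM.
apply: ge0_le_integral => //.
- by move=> y _; rewrite mule_ge0// dyadic_kernel_ge0.
- by apply: emeasurable_funM => //; exact: measurable_dyadic_kernel.
- by apply: measurable_funeM; exact: emeasurable_funM.
- by move=> y _; rewrite muleA lee_wpmul2r.
Qed.

Lemma dyadic_potential_le g x r : (0 < r)%R -> meas g -> (forall y, 0 <= g y) ->
  dyadic_potential (mass g) x r <= 2%:E * op g x.
Proof.
move=> r0 mg g0; apply: le_dyadic => // y.
by apply: le_trans (dyadic_kernel_le _ _ r0) _; rewrite lee_pmul2l// ge_min lexx.
Qed.

(** For y in B_r(x), min(K(x,z), 1/r) <= min(K(x,z), K(x,y)) <= M K(y,z): the
    dyadic potential at scales >= r around x is a lower bound, up to a constant,
    on the whole ball. *)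
Lemma dyadic_potential_le_near g x y r : (0 < r)%R -> meas g ->
  (forall y, 0 <= g y) -> B x r y ->
  dyadic_potential (mass g) x r <= (2 * M)%:E * op g y.
Proof.
move=> r0 mg g0 xy; apply: le_dyadic => //; first by rewrite mulr_ge0// ltW.
move=> z; apply: le_trans (dyadic_kernel_le _ _ r0) _.
rewrite EFinM -muleA lee_pmul2l//.
apply: le_trans (hM y z x); rewrite le_min !ge_min lexx /= andbT (KC y x).
by move/(qballE _ _ r0) : xy => ->; rewrite orbT.
Qed.

(** Outside B_{Mr}(x), the quasi-metric inequality applied to y in B_r(x) gives
    K(y,z) <= M K(x,z), and there K(x,z) < 1/r is seen by the dyadic potential. *)
Lemma kernel_op_le_far g x y r : (0 < r)%R -> meas g -> (forall y, 0 <= g y) ->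
  B x r y ->
  op g y <= op (fun z => (\1_(B x (M * r)%R) z)%:E * g z) y +
            (2 * M)%:E * dyadic_potential (mass g) x r.
Proof.
move=> r0 mg g0 xy; rewrite dyadic_potentialE//.
have Mr0 : (0 < M * r)%R by rewrite mulr_gt0.
have m1 : meas (fun z => (\1_(B x (M * r)%R) z)%:E * g z).
  apply: emeasurable_funM => //; apply/measurable_EFinP; exact: measurable_indic.
have md : meas (fun z => dyadic_kernel x r z * g z).
  by apply: emeasurable_funM => //; exact: measurable_dyadic_kernel.
have MM : (0 <= 2 * M)%R by rewrite mulr_ge0// ltW.
rewrite -ge0_integralZl_EFin//; last by move=> z _; rewrite mule_ge0// dyadic_kernel_ge0.
rewrite -ge0_integralD//; last 4 first.
  by move=> z _; rewrite !mule_ge0// lee_fin.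
  exact: emeasurable_funM.
  by move=> z _; rewrite !mule_ge0// ?lee_fin// dyadic_kernel_ge0.
  exact: measurable_funeM.
apply: ge0_le_integral => //.
- by move=> z _; rewrite mule_ge0.
- exact: emeasurable_funM.
- by apply: emeasurable_funD; [exact: emeasurable_funM|exact: measurable_funeM].
- move=> z _; rewrite qball_indic//; case: ifPn => [h|].
  rewrite mul1e leeDl// mule_ge0 ?lee_fin//.
  by rewrite mule_ge0// dyadic_kernel_ge0.
rewrite -ltNge mul0e mule0 add0e muleA => h; rewrite lee_wpmul2r//.
have Kxz : M%:E * K x z < r^-1%:E.
  rewrite -lte_pdivlMl//; apply: lt_le_trans h _.
  by rewrite -EFinM invfM.
have Kyz : K y z <= M%:E * K x z.
  have := hM x z y; rewrite ge_min => /orP[h1|//].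
  by move/(qballE _ _ r0) : xy => /le_trans/(_ h1); rewrite leNgt Kxz.
apply: (le_trans Kyz); rewrite mulrC EFinM -muleA lee_pmul2l ?lte_fin//.
apply: le_trans (dyadic_kernel_ge x z r0); rewrite le_min lexx/=.
apply: (le_trans (ltW h)); rewrite lee_fin lef_pV2 ?posrE//.
by rewrite ler_peMl ?(ltW r0).
Qed.

Definition trunc_kernel n x y := mine (K x y) (scale 1 n)%:E.

Let trunc_kernel_ge0 n x y : 0 <= trunc_kernel n x y.
Proof. by rewrite le_min Kge0/= lee_fin ltW// scale_gt0. Qed.

Let trunc_kernel_nd x y : nondecreasing_seq (fun n => trunc_kernel n x y).
Proof.
move=> m n mn; rewrite /trunc_kernel le_min !ge_min lexx/= lee_fin.
by rewrite /scale !mul1r ler_weXn2l ?orbT// ler1n.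
Qed.

Let trunc_kernel_lim x y : limn (fun n => trunc_kernel n x y) = K x y.
Proof.
apply/eqP; rewrite eq_le; apply/andP; split.
  apply: lime_le; first by apply: ereal_nondecreasing_is_cvgn; exact: trunc_kernel_nd.
  by apply: nearW => n; rewrite /trunc_kernel ge_min lexx.
have h (A : R) : A%:E <= K x y -> A%:E <= limn (fun n => trunc_kernel n x y).
  move=> AK; apply: le_trans (nondecreasing_le_limn (Num.truncn A).+1 (trunc_kernel_nd x y)).
  rewrite /trunc_kernel le_min AK/= lee_fin /scale mul1r.
  apply: (@le_trans _ _ ((Num.truncn A).+1%:R)); first exact/ltW/truncnS_gt.
  by rewrite -natrX ler_nat ltnW// ltn_expl.
move: h (K0 x y); case: (K x y) => [k| |]// h _; first exact: h.
rewrite leye_eq; apply/eqP/eqyP => A _; exact/h/leey.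
Qed.

Let measurable_trunc_kernel n x : meas (trunc_kernel n x).
Proof. exact: measurable_mine. Qed.

Definition trunc_op n g x := \int[sigma]_y (trunc_kernel n x y * g y).

Lemma trunc_op_ge0 n g x : (forall y, 0 <= g y) -> 0 <= trunc_op n g x.
Proof. by move=> g0; apply: integral_ge0 => y _; rewrite mule_ge0. Qed.

Lemma trunc_op_nd g x : meas g -> (forall y, 0 <= g y) ->
  nondecreasing_seq (fun n => trunc_op n g x).
Proof.
move=> mg g0 m n mn; apply: ge0_le_integral => //.
- by move=> y _; rewrite mule_ge0.
- exact: emeasurable_funM.
- exact: emeasurable_funM.
- by move=> y _; rewrite lee_wpmul2r//; exact: trunc_kernel_nd.
Qed.

Lemma trunc_op_lim g x : meas g -> (forall y, 0 <= g y) ->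
  limn (fun n => trunc_op n g x) = op g x.
Proof.
move=> mg g0; rewrite /trunc_op -monotone_convergence//.
- by apply: eq_integral => y _; rewrite limn_muler// trunc_kernel_lim.
- by move=> n; exact: emeasurable_funM.
- by move=> n y _; rewrite mule_ge0.
- by move=> y _ m n mn; rewrite lee_wpmul2r//; exact: trunc_kernel_nd.
Qed.

Lemma trunc_op_le n g x : meas g -> (forall y, 0 <= g y) ->
  trunc_op n g x <= 2%:E * dyadic_potential (mass g) x (scale 1 n)^-1%R.
Proof.
move=> mg g0; have s0 : (0 < (scale 1 n)^-1 :> R)%R by rewrite invr_gt0 scale_gt0.
rewrite dyadic_potentialE//.
have md : meas (fun z => dyadic_kernel x (scale 1 n)^-1%R z * g z).
  by apply: emeasurable_funM => //; exact: measurable_dyadic_kernel.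
rewrite -ge0_integralZl_EFin//; last by move=> z _; rewrite mule_ge0// dyadic_kernel_ge0.
apply: ge0_le_integral => //.
- by move=> y _; rewrite mule_ge0.
- exact: emeasurable_funM.
- exact: measurable_funeM.
- move=> y _; rewrite muleA lee_wpmul2r//.
  by have := dyadic_kernel_ge x y s0; rewrite invrK.
Qed.

(** Dyadic potentials only see min(K, 1/r); the truncation level 1/r = 2^n tends
    to infinity and monotone convergence recovers K. *)
Lemma kernel_op_le_dyadic g x (C : \bar R) : meas g -> (forall y, 0 <= g y) ->
  (forall r, (0 < r)%R -> dyadic_potential (mass g) x r <= C) -> op g x <= 2%:E * C.
Proof.
move=> mg g0 gC; rewrite -trunc_op_lim//; apply: lime_le.
  by apply: ereal_nondecreasing_is_cvgn; exact: trunc_op_nd.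
apply: nearW => n; apply: le_trans (trunc_op_le n x mg g0) _.
by rewrite lee_pmul2l// gC// invr_gt0 scale_gt0.
Qed.

(** * Quasi-symmetry of the kernel operator *)

Let measurable_snd_borel : measurable_fun [set: borel (X * X)%type]
  ((fun z => z.2) : borel (X * X)%type -> borel X).
Proof.
apply: (@measurability _ _ _ (borel X) setT _ (@open X)); first by [].
move=> _ [U oU <-]; rewrite setTI; apply: sub_sigma_algebra.
by apply: open_comp => // z _; exact: cvg_snd.
Qed.

Lemma measurable_kernel_op g : meas g -> (forall y, 0 <= g y) -> meas (op g).
Proof.
move=> mg g0; apply: (measurable_fun_section_integral sigma
  (H := fun z => K z.1 z.2 * g z.2)) => [|z]; last by rewrite mule_ge0.
apply: emeasurable_funM; first exact: (qmk_borel hK).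
exact: (measurableT_comp mg measurable_snd_borel).
Qed.

Lemma measurable_trunc_op n g : meas g -> (forall y, 0 <= g y) -> meas (trunc_op n g).
Proof.
move=> mg g0; apply: (measurable_fun_section_integral sigma
  (H := fun z => trunc_kernel n z.1 z.2 * g z.2)) => [|z]; last by rewrite mule_ge0.
apply: emeasurable_funM; last exact: (measurableT_comp mg measurable_snd_borel).
by apply: measurable_mine; [exact: (qmk_borel hK)|exact: measurable_cst].
Qed.

Lemma measurable_mass_qball g r : (0 < r)%R -> meas g -> (forall y, 0 <= g y) ->
  meas (fun x => mass g (B x r)).
Proof.
move=> r0 mg g0.
pose E : set (borel (X * X)%type) := [set z | r^-1%:E <= K z.1 z.2].
have mE : measurable E.
  rewrite (_ : E = setT `&` (fun z : X * X => K z.1 z.2) @^-1` [set t | r^-1%:E <= t]).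
    by apply: (qmk_borel hK) => //; rewrite -set_itvcy; exact: emeasurable_itv.
  by rewrite setTI.
rewrite (_ : (fun _ => _) = (fun x => \int[sigma]_y ((\1_E (x, y))%:E * g y))).
  apply: (measurable_fun_section_integral sigma
    (H := fun z => (\1_E z)%:E * g z.2)) => [|z]; last by rewrite mule_ge0 ?lee_fin.
  apply: emeasurable_funM; last exact: (measurableT_comp mg measurable_snd_borel).
  by apply/measurable_EFinP; exact: measurable_indic.
apply/funext => x; rewrite mass_indic; apply: eq_integral => y _.
by rewrite qball_indic// indicE; case: ifPn => h; [rewrite mem_set|rewrite memNset//; exact/negP].
Qed.

Lemma mass_ge0 g A : (forall y, 0 <= g y) -> 0 <= mass g A.
Proof. by move=> g0; apply: integral_ge0 => y _. Qed.

(** With the Tonelli theorem both sides of [ball_average_exchange] would be equal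
    for the same radius s.  As a substitute, an inequality with the larger radius
    M^2 s is proved for functions b supported in sets called [good]. *)
Section exchange.
Variables (a : borel X -> \bar R) (ma : meas a) (a0 : forall x, 0 <= a x).
Variables (s : R) (s0 : (0 < s)%R).

Let c : R := (M * M)%R.

Let Ms0 : (0 < M * s)%R. Proof. by rewrite mulr_gt0. Qed.

Let cs0 : (0 < c * s)%R. Proof. by rewrite !mulr_gt0. Qed.

Let avg b := \int[sigma]_x (a x * mass b (B x s)).

Let dual b := \int[sigma]_y (b y * mass a (B y (c * s)%R)).

Let good (A : set (borel X)) := measurable A /\ forall b, meas b ->
  (forall y, 0 <= b y) -> (forall y, ~ A y -> b y = 0) -> avg b <= dual b.

Let measurable_mul_indic (A : set (borel X)) (b : borel X -> \bar R) : measurable A -> meas b ->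
  meas (fun y => (\1_A y)%:E * b y).
Proof.
move=> mA mb; apply: emeasurable_funM => //.
by apply/measurable_EFinP; exact: measurable_indic.
Qed.

Let indic_ge0 (A : set (borel X)) (b : borel X -> \bar R) y : (forall y, 0 <= b y) -> 0 <= (\1_A y)%:E * b y.
Proof. by move=> b0; rewrite mule_ge0 ?lee_fin. Qed.

(** For b supported in B_s(x0), mass b (B_s(x)) vanishes unless x is in
    B_{Ms}(x0), and B_{Ms}(x0) is contained in B_{MMs}(y) for every y in B_s(x0);
    a product of two integrals over fixed sets separates the two variables. *)
Let good_qball x0 : good (B x0 s).
Proof.
split=> // b mb b0 bA.
pose I := \int[sigma]_y b y.
have I0 : 0 <= I by apply: integral_ge0.
have massb x : mass b (B x s) <= (\1_(B x0 (M * s)%R) x)%:E * I.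
{ rewrite qball_indic//; case: ifPn => h.
  - rewrite mul1e mass_indic; apply: ge0_le_integral => //.
    + by move=> y _; exact: indic_ge0.
    + exact: measurable_mul_indic.
    + by move=> y _; rewrite qball_indic//; case: ifP; rewrite ?mul1e ?mul0e.
  - rewrite mul0e mass_indic integral0_eq// => y _.
    have [yx0|yx0] := pselect (B x0 s y); last by rewrite bA// mule0.
    rewrite qball_indic//; case: ifPn => [xy|]; last by rewrite mul0e.
    exfalso; move/negP: h; apply; apply/(qballE _ _ Ms0).
    apply: (@qball_near y x0 x s s) => //; apply/(qballE _ _ s0).
      by rewrite KC; exact/(qballE _ _ s0).
    by rewrite KC. }
have mbs : meas (fun x => mass b (B x s)) by exact: measurable_mass_qball.
have mas : meas (fun x => mass a (B x (c * s)%R)) by exact: measurable_mass_qball.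
apply: (@le_trans _ _ (\int[sigma]_x ((\1_(B x0 (M * s)%R) x)%:E * a x * I))).
{   apply: ge0_le_integral => //.
  - by move=> x _; rewrite mule_ge0// mass_ge0.
  - exact: emeasurable_funM.
  - by apply: emeasurable_funM => //; exact: measurable_mul_indic.
  - by move=> x _; rewrite muleAC muleC lee_wpmul2r. }
rewrite ge0_integralZr//; [|exact: measurable_mul_indic|by move=> x _; exact: indic_ge0].
rewrite -mass_indic /I -ge0_integralZl ?mass_ge0//.
apply: ge0_le_integral => //.
- by move=> y _; rewrite mule_ge0// mass_ge0.
- exact: measurable_funeM.
- exact: emeasurable_funM.
- move=> y _; have [yx0|yx0] := pselect (B x0 s y); last by rewrite bA// mule0 mul0e.
  rewrite muleC lee_wpmul2l//; apply: ge0_subset_integral => //.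
  + exact: measurable_funTS.
  + rewrite /c -mulrA => x xx0; apply: qball_near s0 _ yx0 xx0.
    by rewrite ler_peMl// ltW.
Qed.

Let good_bigcup (F : (set (borel X))^nat) : (forall n, good (F n)) ->
  good (\bigcup_n F n).
Proof.
move=> gF; have mF n : measurable (F n) by case: (gF n).
split=> [|b mb b0 bF]; first exact: bigcup_measurable.
have mD n : measurable (seqDU F n).
  by apply: measurableD => //; exact: bigsetU_measurable.
pose bn n y := (\1_(seqDU F n) y)%:E * b y.
have mbn n : meas (bn n) by exact: measurable_mul_indic.
have bn0 n y : 0 <= bn n y by exact: indic_ge0.
have bE y : b y = \sum_(n <oo) bn n y.
  have [[n _ Fy]|Fy] := pselect ((\bigcup_n seqDU F n) y); last first.
    rewrite bF; last by rewrite seqDU_bigcup_eq.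
    rewrite eseries0// => n _ _; rewrite /bn indicE memNset ?mul0e// => Dy.
    by apply: Fy; exists n.
  rewrite (nneseriesD1 (n := n))// eseries0 ?adde0.
    by rewrite /bn indicE mem_set// mul1e.
  move=> k _ kn; rewrite /bn indicE memNset ?mul0e// => Dy.
  have /trivIsetP/(_ k n Logic.I Logic.I kn)/seteqP[+ _] := trivIset_seqDU F.
  by move=> /(_ y); apply.
have -> : avg b = \sum_(n <oo) avg (bn n).
  rewrite -integral_nneseries//; last 2 first.
    by move=> n; apply: emeasurable_funM => //; exact: measurable_mass_qball.
    by move=> n x _; rewrite mule_ge0// mass_ge0.
  apply: eq_integral => x _; under eq_eseriesr do rewrite muleC.
  rewrite nneseriesZr_ge0//; last by move=> n; exact: mass_ge0.
  rewrite muleC; congr (_ * _).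
  rewrite /mass -integral_nneseries//; last by move=> n; exact: measurable_funTS.
  by apply: eq_integral => y _.
have -> : dual b = \sum_(n <oo) dual (bn n).
  rewrite -integral_nneseries//; last 2 first.
    by move=> n; apply: emeasurable_funM => //; exact: measurable_mass_qball.
    by move=> n x _; rewrite mule_ge0// mass_ge0.
  by apply: eq_integral => y _; rewrite nneseriesZr_ge0 ?mass_ge0// -bE.
apply: lee_nneseries => [n _ _|n _].
  by apply: integral_ge0 => x _; rewrite mule_ge0// mass_ge0.
have [_] := gF n; apply => // y Fy; rewrite /bn indicE memNset ?mul0e//.
by move=> /(@subDsetl _ _ _ _).
Qed.

(** Let U be a good set containing all others up to null sets.  Every ball
    B_s(x) is good, hence contained in U up to a null set, so b may be replaced by
    its restriction to U. *)
Lemma ball_average_exchange b : meas b -> (forall y, 0 <= b y) ->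
  \int[sigma]_x (a x * mass b (B x s)) <=
  \int[sigma]_y (b y * mass a (B y (M * M * s)%R)).
Proof.
move=> mb b0; rewrite -/(avg b) -/(dual b).
have good0 : good set0.
  split=> // b' mb' b'0 b'z; rewrite /avg integral0_eq; last first.
    by move=> x _; rewrite /mass integral0_eq ?mule0// => y _; rewrite b'z.
  by apply: integral_ge0 => y _; rewrite mule_ge0// mass_ge0.
have [U [mU gU] nullU] :=
  exhaustion sigma good0 (fun A => @proj1 _ _) good_bigcup.
have -> : avg b = avg (fun y => (\1_U y)%:E * b y).
  apply: eq_integral => x _; congr (_ * _); rewrite /mass.
  apply: ge0_ae_eq_integral => //; last 1 first.
    exists (B x s `\` U); split; [exact: measurableD|exact/nullU/good_qball|].
    move=> y /= /not_implyP[xy h]; split=> // Uy; apply: h.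
    by rewrite indicE mem_set// mul1e.
  exact: measurable_funTS.
  by apply: measurable_funTS; exact: measurable_mul_indic.
  by move=> y _; exact: indic_ge0.
apply: (@le_trans _ _ (dual (fun y => (\1_U y)%:E * b y))).
  apply: gU => [|y|y Uy]; [exact: measurable_mul_indic|exact: indic_ge0|].
  by rewrite indicE memNset// mul0e.
have mas : meas (fun x => mass a (B x (c * s)%R)) by exact: measurable_mass_qball.
apply: ge0_le_integral => //.
- by move=> y _; rewrite mule_ge0 ?indic_ge0 ?mass_ge0.
- by apply: emeasurable_funM => //; exact: measurable_mul_indic.
- exact: emeasurable_funM.
- move=> y _; rewrite lee_wpmul2r ?mass_ge0// indicE.
  by case: (_ \in _); rewrite ?mul1e ?mul0e.
Qed.

End exchange.

(** Apply [ball_average_exchange] at each scale of the dyadic model.  The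
    enlarged radius M^2 r_i costs a factor M^2 in the weight 1/r_i. *)
Lemma kernel_op_exchange a b : meas a -> (forall x, 0 <= a x) -> meas b ->
  (forall x, 0 <= b x) ->
  \int[sigma]_x (a x * op b x) <= (4 * (M * M))%:E * \int[sigma]_y (b y * op a y).
Proof.
move=> ma a0 mb b0.
have mop g : meas g -> (forall x, 0 <= g x) -> meas (op g) by exact: measurable_kernel_op.
have opge0 g x : (forall x, 0 <= g x) -> 0 <= op g x by exact: kernel_op_ge0.
have topge0 n g x : (forall x, 0 <= g x) -> 0 <= trunc_op n g x by exact: trunc_op_ge0.
have mtop n g : meas g -> (forall x, 0 <= g x) -> meas (trunc_op n g) by exact: measurable_trunc_op.
have -> : \int[sigma]_x (a x * op b x) =
    limn (fun n => \int[sigma]_x (a x * trunc_op n b x)).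
  rewrite -monotone_convergence//; last 3 first.
    by move=> n; apply: emeasurable_funM => //; exact: mtop.
    by move=> n x _; rewrite mule_ge0// topge0.
    by move=> x _ m n mn; rewrite lee_wpmul2l//; exact: trunc_op_nd.
  apply: eq_integral => x _; under [in RHS]eq_fun do rewrite muleC.
  rewrite muleC limn_muler; [by rewrite trunc_op_lim|exact: trunc_op_nd| |exact: a0].
  by move=> n; exact: topge0.
have nd : nondecreasing_seq (fun n => \int[sigma]_x (a x * trunc_op n b x)).
  move=> m n mn; apply: ge0_le_integral; [exact: measurableT|
    by move=> x _; rewrite mule_ge0// topge0|
    by apply: emeasurable_funM => //; exact: mtop|
    by apply: emeasurable_funM => //; exact: mtop|].
  by move=> x _; apply: lee_wpmul2l => //; exact: trunc_op_nd.
apply: lime_le; first exact: ereal_nondecreasing_is_cvgn.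
apply: nearW => n; pose r : R := ((scale 1 n)^-1)%R.
have r0 : (0 < r)%R by rewrite invr_gt0 scale_gt0.
have MM0 : (0 < M * M)%R by rewrite mulr_gt0.
have mmass g i : meas g -> (forall x, 0 <= g x) -> meas (fun x => mass g (B x (scale r i))).
  by move=> mg g0; apply: measurable_mass_qball => //; rewrite scale_gt0.
have si i : (0 <= (scale r i)^-1)%R by rewrite invr_ge0 ltW// scale_gt0.
have mdp : meas (fun x => dyadic_potential (mass b) x r).
  apply: ge0_emeasurable_sum => [i y _ _|i _].
    by rewrite mule_ge0 ?mass_ge0// lee_fin.
  by apply: measurable_funeM; exact: mmass.
have dp0 g x t : (0 < t)%R -> (forall x, 0 <= g x) -> 0 <= dyadic_potential (mass g) x t.
  move=> t0 g0; apply: nneseries_ge0 => i _ _.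
  by rewrite dterm_ge0// mass_ge0.
apply: (@le_trans _ _ (\int[sigma]_x (2%:E * (a x * dyadic_potential (mass b) x r)))).
{ apply: ge0_le_integral => //.
  - by move=> x _; rewrite mule_ge0// topge0.
  - by apply: emeasurable_funM => //; exact: mtop.
  - by apply: measurable_funeM; exact: emeasurable_funM.
  - by move=> x _; rewrite muleCA lee_wpmul2l// trunc_op_le. }
rewrite ge0_integralZl_EFin//; last 2 first.
  by move=> x _; rewrite mule_ge0// dp0.
  exact: emeasurable_funM.
have -> : (4 * (M * M))%R = (2 * (2 * (M * M)))%R by ring.
rewrite (EFinM 2 (2 * (M * M))%R) -muleA lee_pmul2l//.
have -> : \int[sigma]_x (a x * dyadic_potential (mass b) x r) =
    \sum_(i <oo) (scale r i)^-1%:E * \int[sigma]_x (a x * mass b (B x (scale r i))).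
  transitivity (\int[sigma]_x \sum_(i <oo) (scale r i)^-1%:E * (a x * mass b (B x (scale r i)))).
    apply: eq_integral => x _; rewrite muleC -nneseriesZr_ge0//.
      by apply: eq_eseriesr => i _; rewrite -muleA (muleC _ (a x)).
    by move=> i; rewrite dterm_ge0// mass_ge0.
  rewrite integral_nneseries//; last 2 first.
    by move=> i; apply: measurable_funeM; apply: emeasurable_funM => //; exact: mmass.
    by move=> i x _; rewrite dterm_ge0// mule_ge0// mass_ge0.
  apply: eq_eseriesr => i _; rewrite ge0_integralZl_EFin//.
    by move=> x _; rewrite mule_ge0// mass_ge0.
  by apply: emeasurable_funM => //; exact: mmass.
have MMr0 : (0 < M * M * r)%R by rewrite mulr_gt0.
have mmass2 i : meas (fun x => mass a (B x (scale (M * M * r) i))).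
  by apply: measurable_mass_qball => //; rewrite scale_gt0.
apply: (@le_trans _ _ (\sum_(i <oo) (scale r i)^-1%:E *
    \int[sigma]_y (b y * mass a (B y (scale (M * M * r) i))))).
  apply: lee_nneseries => [i _ _|i _].
    by rewrite dterm_ge0// integral_ge0// => x _; rewrite mule_ge0// mass_ge0.
  rewrite lee_wpmul2l ?lee_fin// scaleM.
  by apply: ball_average_exchange => //; rewrite scale_gt0.
have -> : \sum_(i <oo) (scale r i)^-1%:E *
    \int[sigma]_y (b y * mass a (B y (scale (M * M * r) i))) =
    (M * M)%:E * \int[sigma]_y (b y * dyadic_potential (mass a) y (M * M * r)%R).
  transitivity (\sum_(i <oo) (M * M)%:E * ((scale (M * M * r) i)^-1%:E *
      \int[sigma]_y (b y * mass a (B y (scale (M * M * r) i))))).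
    apply: eq_eseriesr => i _; rewrite muleA -EFinM; congr (_%:E * _).
    by rewrite scaleM -{1}(mulKf (lt0r_neq0 MM0) (scale r i)^-1%R) mulrCA -invfM.
  rewrite nneseriesZl; last first.
    move=> i _; rewrite dterm_ge0// integral_ge0// => y _.
    by rewrite mule_ge0// mass_ge0.
  congr (_ * _).
  transitivity (\int[sigma]_y \sum_(i <oo) (scale (M * M * r) i)^-1%:E * (b y * mass a (B y (scale (M * M * r) i)))).
  { rewrite integral_nneseries//; last 2 first.
      by move=> i; apply: measurable_funeM; exact: emeasurable_funM.
      by move=> i x _; rewrite dterm_ge0// mule_ge0// mass_ge0.
    apply: eq_eseriesr => i _; rewrite ge0_integralZl_EFin//.
    - by move=> x _; rewrite mule_ge0// mass_ge0.
    - exact: emeasurable_funM.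
    - by rewrite invr_ge0 ltW// scale_gt0. }
  apply: eq_integral => y _; rewrite [in RHS]muleC -nneseriesZr_ge0//.
    by apply: eq_eseriesr => i _; rewrite -muleA (muleC _ (b y)).
  by move=> i; rewrite dterm_ge0// mass_ge0.
have -> : (2 * (M * M))%R = (M * M * 2)%R by ring.
rewrite (EFinM (M * M)%R 2) -muleA lee_pmul2l ?lte_fin//.
have mdp2 : meas (fun y => dyadic_potential (mass a) y (M * M * r)%R).
  apply: ge0_emeasurable_sum => [i y _ _|i _].
    by rewrite dterm_ge0// mass_ge0.
  exact: measurable_funeM.
rewrite -ge0_integralZl_EFin//; last 2 first.
  by move=> x _; rewrite mule_ge0// opge0.
  by apply: emeasurable_funM => //; exact: mop.
apply: ge0_le_integral => //.
- by move=> y _; rewrite mule_ge0// dp0.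
- exact: emeasurable_funM.
- by apply: measurable_funeM; apply: emeasurable_funM => //; exact: mop.
- by move=> y _; rewrite muleCA lee_wpmul2l// dyadic_potential_le.
Qed.

(** * The cross condition over dyadic scales *)

Lemma dyadic_term_ge0 m x r i : (0 < r)%R -> (forall A, 0 <= m A) ->
  0 <= dyadic_term m x r i.
Proof. by move=> r0 m0; rewrite dterm_ge0. Qed.

Lemma dyadic_potential_ge0 m x r : (0 < r)%R -> (forall A, 0 <= m A) ->
  0 <= dyadic_potential m x r.
Proof. by move=> r0 m0; apply: nneseries_ge0 => i _ _; exact: dyadic_term_ge0. Qed.

(** The cross condition on the scales r 2^i.  The index n separates the scales
    below r 2^n, summed for sigma, from those above, summed for g. *)
Definition dyadic_cross g (alpha : R) (A : R) := forall x r n, (0 < r)%R ->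
  (\sum_(i < n) dyadic_term sigma x r i) *
  (dyadic_potential (mass g) x (scale r n)) `^ alpha <= A%:E.

Lemma le_mass g A1 A2 : meas g -> (forall y, 0 <= g y) -> measurable A1 ->
  measurable A2 -> A1 `<=` A2 -> mass g A1 <= mass g A2.
Proof.
move=> mg g0 m1 m2 A12; apply: ge0_subset_integral => //.
exact: measurable_funTS.
Qed.

Lemma dyadic_potential_recl m x r : (0 < r)%R -> (forall A, 0 <= m A) ->
  dyadic_potential m x r = dyadic_term m x r 0 + dyadic_potential m x (r * 2)%R.
Proof.
move=> r0 m0; rewrite /dyadic_potential nneseries_recl//.
  rewrite -nneseries_addn//; last by move=> i; exact: dyadic_term_ge0.
  by congr (_ + _); apply: eq_eseriesr => i _; rewrite /dyadic_term addn1 scaleS.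
by move=> i _; exact: dyadic_term_ge0.
Qed.

(** The term at scale r is controlled by the one at scale 2r, since the balls
    increase. *)
Lemma dyadic_potential_double g x r : (0 < r)%R -> meas g -> (forall y, 0 <= g y) ->
  dyadic_potential (mass g) x r <= 3%:E * dyadic_potential (mass g) x (r * 2)%R.
Proof.
move=> r0 mg g0; have m0 A : 0 <= mass g A by exact: mass_ge0.
have r20 : (0 < r * 2)%R by rewrite mulr_gt0.
rewrite dyadic_potential_recl//.
apply: (@le_trans _ _ (2%:E * dyadic_term (mass g) x (r * 2)%R 0 +
                       1%:E * dyadic_potential (mass g) x (r * 2)%R)).
  rewrite mul1e leeD2r// /dyadic_term !scale0 muleA -EFinM.
  have -> : (2 * (r * 2)^-1 = r^-1)%R by field; rewrite gt_eqF.
  rewrite lee_wpmul2l ?lee_fin ?invr_ge0 ?(ltW r0)//; apply: le_mass => //.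
  by apply: subset_qball => //; lra.
have -> : 3%:E = 2%:E + 1%:E :> \bar R by rewrite -EFinD; congr (_%:E); ring.
rewrite ge0_muleDl ?lee_fin//.
rewrite leeD2r// lee_pmul2l//.
rewrite [leRHS]dyadic_potential_recl//.
by rewrite leeDl// dyadic_potential_ge0// mulr_gt0.
Qed.

(** Both integrands are monotone in t up to the factor t^-2, so each integral is
    comparable to a dyadic sum with first or last scale a. *)
Lemma cross_dyadicP (nu : {measure set (borel X) -> \bar R}) g (alpha : R) :
  (0 < alpha)%R -> meas g -> (forall y, 0 <= g y) -> (forall A, nu A = mass g A) ->
  cross_condition K sigma nu alpha <-> exists A : R, dyadic_cross g alpha A.
Proof.
move=> al0 mg g0 nuE; have m0 A : 0 <= mass g A by exact: mass_ge0.
have hnd (m : {measure set (borel X) -> \bar R}) x (s t : R) : (s <= t)%R ->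
    m (B x s) <= m (B x t).
  by move=> st; apply: le_measure; rewrite ?inE//; exact: subset_qball.
have nuS x r : dyadic_potential (mass g) x r =
    \sum_(i <oo) (scale r i)^-1%:E * nu (B x (scale r i)).
  by apply: eq_eseriesr => i _; rewrite nuE.
pose In x a := \int[lebesgue_measure]_(t in `]0%R, a]) (sigma (B x t) * (t ^- 2)%:E).
pose If x a := \int[lebesgue_measure]_(t in `[a, +oo[) (nu (B x t) * (t ^- 2)%:E).
have In0 x a : 0 <= In x a.
  by apply: integral_ge0 => t _; rewrite mule_ge0// lee_fin invr_ge0 sqr_ge0.
have If0 x a : 0 <= If x a.
  by apply: integral_ge0 => t _; rewrite mule_ge0// lee_fin invr_ge0 sqr_ge0.
rewrite /cross_condition; set Z := [set z | _]; split.
- move=> supZ; have Z0 : 0 <= ereal_sup Z.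
    apply: (@le_trans _ _ (In point 1%R * If point 1%R `^ alpha)).
      by rewrite mule_ge0// poweR_ge0.
    by apply: ereal_sup_ubound; exists point, 1%R.
  have Zf : ereal_sup Z \is a fin_num by rewrite ge0_fin_numE.
  (* Each sum is at most 4 times the corresponding integral; the second factor 4
   is raised to the power alpha. *)
exists (4 * 4 `^ alpha * fine (ereal_sup Z))%R => x r n r0.
  have sn := scale_gt0 n r0.
  apply: (@le_trans _ _ ((4%:E * In x (scale r n)) * (4%:E * If x (scale r n)) `^ alpha)).
  { apply: lee_pmul => //.
    + by apply: sume_ge0 => i _; exact: dyadic_term_ge0.
    + exact: poweR_ge0.
    + by apply: (@sum_le_integral_near _ (fun t => sigma (B x t))) => // s t /hnd.
    + apply: gt0_le_poweR; [exact: ltW|exact: dyadic_potential_ge0|].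
      rewrite nuS; apply: (@sum_le_integral_far _ (fun t => nu (B x t))) => // s t.
      exact: hnd. }
  rewrite poweRM// muleACA poweR_EFin -EFinM.
  rewrite (EFinM (4 * 4 `^ alpha)%R (fine _)) fineK// lee_wpmul2l//.
  by apply: ereal_sup_ubound; exists x, (scale r n).
- move=> [A hA].
  apply: (@le_lt_trans _ _ (2 * 2 `^ alpha * A)%:E); last by rewrite ltry.
  apply: ge_ereal_sup => _ [x [a a0 ->]]; rewrite -/(In x a) -/(If x a).
  have a20 : (0 < a * 2)%R by rewrite mulr_gt0.
  pose S := dyadic_potential (mass g) x (a * 2)%R.
  have S0 : 0 <= S by exact: dyadic_potential_ge0.
  have A0 : (0 <= A)%R.
    by rewrite -lee_fin; apply: le_trans (hA x a 0%N a0); rewrite big_ord0 mul0e.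
  have IfS : If x a <= 2%:E * S.
    rewrite /S nuS; apply: (@integral_far_le _ (fun t => nu (B x t))) => // s t.
    exact: hnd.
  have InC (C : \bar R) : (forall s n, (0 < s)%R -> scale s n = a ->
      \sum_(i < n.+1) dyadic_term sigma x s i <= C) -> In x a <= 2%:E * C.
    move=> h; apply: (@integral_near_le _ (fun t => sigma (B x t))) => // s t.
    exact: hnd.
  have hS s n : (0 < s)%R -> scale s n = a ->
      (\sum_(i < n.+1) dyadic_term sigma x s i) * S `^ alpha <= A%:E.
    by move=> s0 sa; have := hA x s n.+1 s0; rewrite scaleSr sa.
  have R0 : 0 <= (2 * 2 `^ alpha * A)%:E.
    by rewrite lee_fin !mulr_ge0// powR_ge0.
  have [Sz|Sn0] := eqVneq S 0.
    have -> : If x a = 0.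
      by apply/eqP; rewrite eq_le If0 andbT; move: IfS; rewrite Sz mule0.
    by rewrite poweR0r ?gt_eqF// mule0.
  have w0 : 0 < S `^ alpha by rewrite poweR_gt0// lt0e Sn0.
  have Ifw : If x a `^ alpha <= (2 `^ alpha)%:E * S `^ alpha.
    apply: le_trans (gt0_le_poweR (ltW al0) (If0 _ _) IfS) _.
    by rewrite poweRM.
  have [wy|wy] := eqVneq (S `^ alpha) +oo.
    have : In x a <= 2%:E * 0.
      apply: InC => s n s0 sa; have := hS s n s0 sa; rewrite wy.
      set T := \sum_(i < n.+1) _; have T0 : 0 <= T.
        by apply: sume_ge0 => i _; exact: dyadic_term_ge0.
      move=> hT; rewrite leNgt; apply/negP => Tp; move: hT.
      by rewrite gt0_muley// leye_eq.
    rewrite mule0 => In_0; have -> : In x a = 0.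
      by apply/eqP; rewrite eq_le In0 andbT.
    by rewrite mul0e.
  have wf : S `^ alpha \is a fin_num by rewrite ge0_fin_numE ?poweR_ge0// ltey.
  move: (S `^ alpha) w0 wf hS Ifw => [w| |]// w0 _ hS Ifw; rewrite lte_fin in w0.
  have InA : In x a <= 2%:E * (A / w)%:E.
    apply: InC => s n s0 sa; have := hS s n s0 sa.
    by rewrite -lee_pdivlMr// EFinM.
  apply: le_trans (lee_pmul _ _ InA Ifw) _ => //; first exact: poweR_ge0.
  rewrite -!EFinM lee_fin le_eqVlt; apply/orP; left; apply/eqP.
  by field; rewrite gt_eqF.
Qed.

(** Summation by parts.  With T_n the partial sums of d_i, the boundary term
    T_n S_n^q is at most A S_n, and T_{n+1} (S_n^q - S_{n+1}^q) is at most
    q b_n T_{n+1} S_n^(q-1), where the cross condition applies because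
    S_n <= 3 S_{n+1}. *)
Lemma dyadic_cross_sum g (q A : R) x r : (1 < q)%R -> meas g ->
  (forall y, 0 <= g y) -> dyadic_cross g (q - 1) A -> (0 < r)%R ->
  \sum_(i <oo) dyadic_term sigma x r i * dyadic_potential (mass g) x (scale r i) `^ q
  <= (A + q * (3 `^ (q - 1) * A))%:E * dyadic_potential (mass g) x r.
Proof.
move=> q1 mg g0 hA r0; have m0 D : 0 <= mass g D by exact: mass_ge0.
have qm : (0 < q - 1)%R by rewrite subr_gt0.
have q0 : (0 < q)%R by exact: lt_trans q1.
have A0 : (0 <= A)%R.
  by rewrite -lee_fin; apply: le_trans (hA x r 0%N r0); rewrite big_ord0 mul0e.
pose d i := dyadic_term sigma x r i.
pose b i := dyadic_term (mass g) x r i.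
pose S i := dyadic_potential (mass g) x (scale r i).
pose T n := \sum_(i < n) d i.
have d0 i : 0 <= d i by exact: dyadic_term_ge0.
have b0 i : 0 <= b i by exact: dyadic_term_ge0.
have S0 i : 0 <= S i by apply: dyadic_potential_ge0 => //; exact: scale_gt0.
have T0 n : 0 <= T n by exact: sume_ge0.
have SS i : S i = S i.+1 + b i.
  rewrite /S dyadic_potential_recl ?scale_gt0// scaleSr addeC; congr (_ + _).
  by rewrite /dyadic_term scale0.
have TS i : T i.+1 = T i + d i by rewrite /T big_ord_recr.
have hS n : T n * S n `^ (q - 1) <= A%:E by exact: hA.
have hS1 i : T i.+1 * S i `^ (q - 1) <= (3 `^ (q - 1) * A)%:E.
  apply: (@le_trans _ _ (T i.+1 * ((3 `^ (q - 1))%:E * S i.+1 `^ (q - 1)))).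
    rewrite lee_wpmul2l// -poweR_EFin -poweRM//; apply: gt0_le_poweR => //.
      exact: ltW.
    by rewrite /S scaleSr dyadic_potential_double// scale_gt0.
  by rewrite muleCA EFinM lee_wpmul2l// lee_fin powR_ge0.
have C0 : (0 <= 3 `^ (q - 1) * A)%R by rewrite mulr_ge0// powR_ge0.
have Abel n : \sum_(i < n) d i * S i `^ q <=
    T n * S n `^ q + q%:E * \sum_(i < n) (3 `^ (q - 1) * A)%:E * b i.
  elim: n => [|n IH]; first by rewrite !big_ord0 mule0 adde0 /T big_ord0 mul0e.
  have bs0 : 0 <= \sum_(i < n) (3 `^ (q - 1) * A)%:E * b i.
    by apply: sume_ge0 => i _; rewrite mule_ge0.
  rewrite !big_ord_recr/= ge0_muleDr//; last by rewrite mule_ge0.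
  apply: le_trans (leeD2r _ IH) _.
  rewrite addeAC -ge0_muleDl// -TS [leRHS]addeA [leRHS]addeAC leeD2r//.
  apply: (@le_trans _ _ (T n.+1 * (S n.+1 `^ q + q%:E * (b n * S n `^ (q - 1))))).
    rewrite lee_wpmul2l//; apply: poweR_le_telescope => //.
    by rewrite -SS.
  rewrite ge0_muleDr ?poweR_ge0//; last first.
    by apply: mule_ge0; [rewrite lee_fin ltW|apply: mule_ge0 => //; exact: poweR_ge0].
  rewrite leeD2l// muleCA lee_pmul2l ?lte_fin// muleCA muleC [leRHS]muleC.
  by rewrite muleC lee_wpmul2l.
apply: nneseries_le => [i|n].
  by rewrite mule_ge0// poweR_ge0.
apply: le_trans (Abel n) _.
have SnS : S n <= S 0%N.
  elim: n => // n; apply: le_trans; rewrite (SS n) leeDl//.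
rewrite EFinD ge0_muleDl//; last by rewrite lee_fin mulr_ge0// ltW.
apply: leeD.
  rewrite -poweR_sub1// muleCA muleC; apply: lee_pmul => //.
    by rewrite mule_ge0// poweR_ge0.
  by move: SnS; rewrite /S scale0.
rewrite (EFinM q (3 `^ (q - 1) * A)%R) -muleA lee_pmul2l ?lte_fin// -ge0_sume_distrr// lee_wpmul2l ?lee_fin//.
exact: ge_nneseries.
Qed.

(** * From testing on balls to a pointwise bound *)

Let measurable_indicM (D : set (borel X)) (g : borel X -> \bar R) : measurable D ->
  meas g -> meas (fun y => (\1_D y)%:E * g y).
Proof.
move=> mD mg; apply: emeasurable_funM => //.
by apply/measurable_EFinP; exact: measurable_indic.
Qed.

Let measurable_poweR_op g q : meas g -> (forall y, 0 <= g y) ->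
  meas (fun y => op g y `^ q).
Proof.
move=> mg g0; apply: (measurableT_comp (measurable_poweR q)).
exact: measurable_kernel_op.
Qed.

Section testing_to_pointwise.
Variables (w : borel X -> \bar R) (mw : meas w) (w0 : forall y, 0 <= w y).
Variables (q A C : R) (q1 : (1 < q)%R) (C0 : (0 <= C)%R).
Hypothesis cross : dyadic_cross w (q - 1) A.
Hypothesis testing : forall x a, (0 < a)%R ->
  \int[sigma]_(y in B x a) (op (fun z => (\1_(B x a) z)%:E * w z) y `^ q) <=
  C%:E * mass w (B x a).

Let q0 : (0 < q)%R. Proof. exact: lt_trans q1. Qed.

Let indic_ge0 (D : set (borel X)) y : 0 <= (\1_D y)%:E * w y.
Proof. by rewrite mule_ge0// lee_fin. Qed.

Let D : R := (2 `^ q * (C * (2 * M) + (2 * M) `^ q * (2 * (A + q * (3 `^ (q - 1) * A)))))%R.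

(** On each ball B_{r_i}(x), bound Kw by its part coming from B_{M r_i}(x) plus
    the far part 2M S_i.  The q-th powers of the local parts are integrated by the
    testing inequality, which reproduces the dyadic potential of w; the far parts
    give the sum treated in [dyadic_cross_sum]. *)
Lemma pointwise_of_testing x :
  op (fun y => op w y `^ q) x <= (2 * D)%:E * op w x.
Proof.
have MM : (0 <= 2 * M)%R by rewrite mulr_ge0// ltW.
have A0 : (0 <= A)%R.
  by rewrite -lee_fin; apply: le_trans (cross x 0%N ltr01); rewrite big_ord0 mul0e.
have op0 y : 0 <= op w y by exact: kernel_op_ge0.
have mass0 D' : 0 <= mass w D' by exact: mass_ge0.
rewrite EFinM -muleA; apply: kernel_op_le_dyadic; [exact: measurable_poweR_op|
  by move=> y; exact: poweR_ge0|move=> r r0].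
have Mr0 : (0 < M * r)%R by rewrite mulr_gt0.
pose S i := dyadic_potential (mass w) x (scale r i).
have S0 i : 0 <= S i by apply: dyadic_potential_ge0 => //; exact: scale_gt0.
have term i : dyadic_term (mass (fun y => op w y `^ q)) x r i <=
    (2 `^ q)%:E * ((C * M)%:E * dyadic_term (mass w) x (M * r)%R i +
      ((2 * M) `^ q)%:E * (dyadic_term sigma x r i * S i `^ q)).
  have s0 := scale_gt0 i r0; set s := scale r i in s0.
  have Ms0 : (0 < M * s)%R by rewrite mulr_gt0.
  have sMs : (s <= M * s)%R by rewrite ler_peMl// ltW.
  pose loc := fun z => (\1_(B x (M * s)%R) z)%:E * w z.
  have mloc : meas loc by exact: measurable_indicM.
  have loc0 z : 0 <= loc z by exact: indic_ge0.
  have oploc0 y : 0 <= op loc y by exact: kernel_op_ge0.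
  have far0 : 0 <= (2 * M)%:E * S i by rewrite mule_ge0.
  have massle : mass (fun y => op w y `^ q) (B x s) <=
     (2 `^ q)%:E * (C%:E * mass w (B x (M * s)%R) +
       ((2 * M) `^ q)%:E * (sigma (B x s) * S i `^ q)).
    have mlocq (D' : set (borel X)) : measurable D' -> measurable_fun D' (fun y => op loc y `^ q).
      by move=> mD'; apply: measurable_funTS; exact: measurable_poweR_op.
    apply: (@le_trans _ _ (\int[sigma]_(y in B x s)
        ((2 `^ q)%:E * (op loc y `^ q + ((2 * M)%:E * S i) `^ q)))).
    { apply: ge0_le_integral => //.
      + by move=> y _; exact: poweR_ge0.
      + by apply: measurable_funTS; exact: measurable_poweR_op.
      + by apply: measurable_funeM; apply: emeasurable_funD => //; exact: mlocq.
      + move=> y xy; apply: le_trans (poweR_sum_le q0 (oploc0 y) far0).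
        apply: gt0_le_poweR => //; first exact: ltW.
        exact: kernel_op_le_far. }
    rewrite ge0_integralZl_EFin//; last 2 first.
      by move=> y _; rewrite adde_ge0// poweR_ge0.
      by apply: emeasurable_funD => //; exact: mlocq.
    rewrite lee_wpmul2l ?lee_fin ?powR_ge0// ge0_integralD//; last 3 first.
      by move=> y _; exact: poweR_ge0.
      exact: mlocq.
      by move=> y _; exact: poweR_ge0.
    apply: leeD.
    { apply: le_trans (testing x Ms0); apply: ge0_subset_integral => //.
      + exact: mlocq.
      + by move=> y _; exact: poweR_ge0.
      + exact: subset_qball. }
    by rewrite integral_cst// poweRM// poweR_EFin -muleA lee_wpmul2l ?lee_fin ?powR_ge0// muleC.
  rewrite {1}/dyadic_term -/s.
  apply: le_trans (lee_wpmul2l _ massle) _; first by rewrite lee_fin invr_ge0 ltW.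
  rewrite muleCA lee_wpmul2l ?lee_fin ?powR_ge0// ge0_muleDr; last 2 first.
    by rewrite mule_ge0.
    by rewrite !mule_ge0 ?poweR_ge0// lee_fin powR_ge0.
  apply: leeD.
    rewrite /dyadic_term scaleM -/s !muleA -!EFinM lee_wpmul2r// lee_fin.
    by rewrite le_eqVlt; apply/orP; left; apply/eqP; field; rewrite !gt_eqF.
  by rewrite muleCA /dyadic_term -/s -(muleA s^-1%:E).
apply: (@le_trans _ _ ((2 `^ q)%:E * ((C * M)%:E * dyadic_potential (mass w) x (M * r)%R +
   ((2 * M) `^ q)%:E * ((A + q * (3 `^ (q - 1) * A))%:E * dyadic_potential (mass w) x r)))).
{ have t1 i : 0 <= (C * M)%:E * dyadic_term (mass w) x (M * r)%R i.
    rewrite mule_ge0//; first by rewrite lee_fin mulr_ge0// ltW.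
    exact: dyadic_term_ge0.
  have t2' i : 0 <= dyadic_term sigma x r i * S i `^ q.
    by rewrite mule_ge0 ?poweR_ge0//; exact: dyadic_term_ge0.
  have t2 i : 0 <= ((2 * M) `^ q)%:E * (dyadic_term sigma x r i * S i `^ q).
    by rewrite mule_ge0// lee_fin powR_ge0.
  apply: (@le_trans _ _ (\sum_(i <oo) (2 `^ q)%:E *
      ((C * M)%:E * dyadic_term (mass w) x (M * r)%R i +
      ((2 * M) `^ q)%:E * (dyadic_term sigma x r i * S i `^ q)))).
    apply: lee_nneseries => [i _ _|i _]; last exact: term.
    by apply: dyadic_term_ge0 => // D'; apply: integral_ge0 => y _; exact: poweR_ge0.
  rewrite nneseriesZl; last by move=> i _; rewrite adde_ge0.
  rewrite lee_wpmul2l ?lee_fin ?powR_ge0// nneseriesD//.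
  apply: leeD.
    by rewrite nneseriesZl// => i _; exact: dyadic_term_ge0.
  rewrite nneseriesZl// lee_wpmul2l ?lee_fin ?powR_ge0//.
  exact: dyadic_cross_sum. }
have hM1 : dyadic_potential (mass w) x (M * r)%R <= 2%:E * op w x.
  exact: dyadic_potential_le.
have hM2 : dyadic_potential (mass w) x r <= 2%:E * op w x.
  exact: dyadic_potential_le.
have AA : (0 <= A + q * (3 `^ (q - 1) * A))%R.
  by rewrite addr_ge0// !mulr_ge0 ?powR_ge0// ltW.
rewrite /D (EFinM (2 `^ q)%R) -muleA lee_wpmul2l ?lee_fin ?powR_ge0//.
rewrite (EFinD (C * (2 * M))%R) ge0_muleDl; last 2 first.
  by rewrite lee_fin mulr_ge0.
  by rewrite lee_fin !mulr_ge0 ?powR_ge0.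
apply: leeD.
  apply: le_trans (lee_wpmul2l _ hM1) _; first by rewrite lee_fin mulr_ge0// ltW.
  by rewrite muleA -EFinM -mulrA (mulrC M).
apply: le_trans (lee_wpmul2l _ (lee_wpmul2l _ hM2)) _.
- by rewrite lee_fin powR_ge0.
- by rewrite lee_fin.
- by rewrite !muleA -!EFinM -mulrA (mulrC 2%R (A + _)%R) mulrA.
Qed.

(** On a ball of positive sigma-measure the cross condition makes the dyadic
    potential of w, hence the far part of Kw, finite; in particular w has finite
    mass on a larger ball, so that by the testing inequality the local part of Kw
    is in L^q there.  Countably many balls around one point cover X. *)
Lemma kernel_op_fin_of_testing : {ae sigma, forall x, op w x < +oo}.
Proof.
have A0 : (0 <= A)%R.
  by rewrite -lee_fin; apply: le_trans (cross point 0%N ltr01); rewrite big_ord0 mul0e.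
have mass0 D' : 0 <= mass w D' by exact: mass_ge0.
have Sfin x r : (0 < r)%R -> 0 < sigma (B x r) ->
    dyadic_potential (mass w) x r < +oo.
  move=> r0 sB; have := cross x 1%N r0; rewrite big_ord1 /dyadic_term scale0 scaleS scale0 => h.
  apply: (le_lt_trans (dyadic_potential_double x r0 mw w0)).
  have : dyadic_potential (mass w) x (r * 2)%R < +oo.
    rewrite ltey; apply/eqP => Sy; move: h; rewrite Sy poweRyr; last first.
      by rewrite gt_eqF// subr_gt0.
    by rewrite gt0_muley// mule_gt0// lte_fin invr_gt0.
  by move=> h2; apply: lte_mul_pinfty.
have loc n : {ae sigma, forall y, B point n.+1%:R y -> op w y < +oo}.
  have n0 : (0 < n.+1%:R :> R)%R by [].
  have Mn0 : (0 < M * n.+1%:R)%R by rewrite mulr_gt0.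
  have nM : (n.+1%:R <= M * n.+1%:R)%R by rewrite ler_peMl.
  set s : R := n.+1%:R in n0 Mn0 nM *.
  have [sB|sB] := eqVneq (sigma (B point s)) 0.
    exists (B point s); split => // y /= /not_implyP[]//.
  have sBp : 0 < sigma (B point s) by rewrite lt0e sB measure_ge0.
  have sBMp : 0 < sigma (B point (M * s)%R).
    apply: (lt_le_trans sBp); apply: le_measure; rewrite ?inE//.
    exact: subset_qball.
  have Sf := Sfin _ _ n0 sBp; have SMf := Sfin _ _ Mn0 sBMp.
  have wB : mass w (B point (M * s)%R) < +oo.
    have : dyadic_term (mass w) point (M * s)%R 0 < +oo.
      apply: le_lt_trans SMf; rewrite [leRHS]dyadic_potential_recl// leeDl//.
      by rewrite dyadic_potential_ge0// mulr_gt0.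
    rewrite /dyadic_term scale0; have := mass0 (B point (M * s)%R).
    case: (mass _ _) => // [t _ _|_]; first by rewrite ltry.
    by rewrite gt0_muley// lte_fin invr_gt0.
  pose loc := fun z => (\1_(B point (M * s)%R) z)%:E * w z.
  have mloc : meas loc by exact: measurable_indicM.
  have loc0 z : 0 <= loc z by exact: indic_ge0.
  have mlq : measurable_fun (B point (M * s)%R) (fun y => op loc y `^ q).
    by apply: measurable_funTS; exact: measurable_poweR_op.
  have int_fin : sigma.-integrable (B point (M * s)%R) (fun y => op loc y `^ q).
    apply/integrableP; split => //.
    under eq_integral do rewrite gee0_abs ?poweR_ge0//.
    apply: le_lt_trans (testing point Mn0) _.
    exact: lte_mul_pinfty.
  have := integrable_ae (mB _ _) int_fin.
  apply: filterS => y h xy.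
  have yM : B point (M * s)%R y by exact: subset_qball xy.
  have /fin_numPlt/andP[_] := h yM.
  move=> /lty_poweRy; rewrite gt_eqF// => /(_ isT) lf.
  apply: le_lt_trans (kernel_op_le_far n0 mw w0 xy) _.
  rewrite lte_add_pinfty//; apply: lte_mul_pinfty => //.
  by rewrite lee_fin mulr_ge0// ltW.
have /ae_foralln : forall n, {ae sigma, forall y, B point n.+1%:R y -> op w y < +oo} by [].
apply: filterS => y h.
have [n pn] : exists n : nat, B point n.+1%:R y.
  have := K0 point y; case E : (K point y) => [k| |]// k0.
    exists (Num.truncn k^-1); apply/qballE => //; rewrite E lee_fin.
    by rewrite -[leRHS]invrK lef_pV2 ?posrE ?invr_gt0// ltW// truncnS_gt.
  by exists 0%N; apply/qballE => //; rewrite E leey.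
exact: (h n).
Qed.

End testing_to_pointwise.

(** * Consequences of a supersolution *)

(** The tails V_i of the dyadic sum of Kg(x), truncated at N, satisfy
    V_i <= 2M min(Kg(y), N) for y in B_{r_i}(x).  Telescoping their p-th powers and
    moving V_i^(p-1) under the integral over that ball gives the claim. *)
Lemma truncated_power_le g (p N : R) x : meas g -> (forall y, 0 <= g y) ->
  (1 < p)%R -> (0 <= N)%R ->
  mine (op g x) N%:E `^ p <=
  (2 `^ p * (p * (2 * ((2 * M) `^ (p - 1)))))%:E *
    op (fun y => g y * mine (op g y) N%:E `^ (p - 1)) x.
Proof.
move=> mg g0 p1 N0; have p0 : (0 < p)%R by exact: lt_trans p1.
have pm : (0 <= p - 1)%R by rewrite subr_ge0 ltW.
have MM : (0 <= 2 * M)%R by rewrite mulr_ge0// ltW.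
have op0 y : 0 <= op g y by exact: kernel_op_ge0.
pose t y := mine (op g y) N%:E `^ (p - 1).
have t0 y : 0 <= t y by exact: poweR_ge0.
have mt : meas t.
  apply: (measurableT_comp (measurable_poweR (p - 1))).
  by apply: measurable_mine => //; exact: measurable_kernel_op.
have mgt : meas (fun y => g y * t y) by exact: emeasurable_funM.
have gt0 y : 0 <= g y * t y by rewrite mule_ge0.
have opt0 : 0 <= op (fun y => g y * t y) x by exact: kernel_op_ge0.
have massg0 D : 0 <= mass g D by exact: mass_ge0.
have massgt0 D : 0 <= mass (fun y => g y * t y) D by exact: mass_ge0.
have min0 (z : \bar R) : 0 <= z -> 0 <= mine z N%:E by move=> z0; rewrite le_min z0 lee_fin.
pose C := (p * (2 * ((2 * M) `^ (p - 1))))%R.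
have C0 : (0 <= C)%R by rewrite !mulr_ge0 ?powR_ge0// ltW.
pose Y := C%:E * op (fun y => g y * t y) x.
have Y0 : 0 <= Y by rewrite mule_ge0.
have partial r n : (0 < r)%R ->
    mine (\sum_(i < n) dyadic_term (mass g) x r i) N%:E `^ p <= Y.
{ move=> r0; pose S i := dyadic_potential (mass g) x (scale r i).
  pose b i := dyadic_term (mass g) x r i.
  have b0 i : 0 <= b i by exact: dyadic_term_ge0.
  have bs0 i m : 0 <= \sum_(i <= j < m) b j by exact: sume_ge0.
  (* Finite tails, so that V n = 0 starts the telescoping. *)
pose V i := mine (\sum_(i <= j < n) b j) N%:E.
  have V0 i : 0 <= V i by exact: min0.
  have VS i : V i <= S i.
    rewrite /V ge_min; apply/orP; left.
    have [ni|ni] := leqP n i.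
      by rewrite big_geq// dyadic_potential_ge0// scale_gt0.
    apply: le_trans (ge_nneseries (n - i) _); last first.
      by move=> j; apply: dyadic_term_ge0 => //; exact: scale_gt0.
    rewrite -(big_mkord xpredT (fun j => dyadic_term (mass g) x (scale r i) j)).
    rewrite -[in X in X <= _](add0n i) -(subnK (ltnW ni)) big_addn.
    by under eq_bigr do rewrite /b /dyadic_term addnC -scaleD.
  have Vt i y : B x (scale r i) y -> V i `^ (p - 1) <= ((2 * M) `^ (p - 1))%:E * t y.
    move=> xy; have si := scale_gt0 i r0.
    have : V i <= (2 * M)%:E * mine (op g y) N%:E.
      have h1 : V i <= (2 * M)%:E * op g y.
        exact: le_trans (VS i) (dyadic_potential_le_near si mg g0 xy).
      have h2 : V i <= (2 * M)%:E * N%:E.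
        apply: (@le_trans _ _ N%:E); first by rewrite ge_min lexx orbT.
        rewrite -EFinM lee_fin ler_peMl//.
        by rewrite (le_trans M1)// ler_peMl ?(ltW M0)// ler1n.
      by case: (leP (op g y) N%:E).
    move=> /(gt0_le_poweR pm (V0 i)); rewrite poweRM ?lee_fin//.
    exact: min0.
  have Vb i : V i <= V i.+1 + b i.
    rewrite /V; have [ni|ni] := leqP n i.
      rewrite big_geq// min_l ?lee_fin//.
      by rewrite adde_ge0// min0.
    rewrite [in leLHS]big_ltn// addeC.
    have [sN|sN] := leP (\sum_(i.+1 <= j < n) b j) N%:E.
      by rewrite ge_min lexx.
    by rewrite ge_min leeDr// orbT.
  have Vn : V n = 0 by rewrite /V big_geq// min_l// lee_fin.
  have := telescope_poweR_sum p1 V0 b0 Vb Vn.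
  rewrite {1}/V big_mkord => /le_trans; apply.
  rewrite /Y /C EFinM -muleA lee_pmul2l ?lte_fin//.
  apply: (@le_trans _ _ (((2 * M) `^ (p - 1))%:E *
      dyadic_potential (mass (fun y => g y * t y)) x r)); last first.
    rewrite (mulrC 2%R ((2 * M) `^ (p - 1))%R) EFinM -muleA lee_wpmul2l ?lee_fin ?powR_ge0//.
    exact: dyadic_potential_le.
  apply: (@le_trans _ _ (((2 * M) `^ (p - 1))%:E *
      \sum_(i < n) dyadic_term (mass (fun y => g y * t y)) x r i)); last first.
    rewrite lee_wpmul2l ?lee_fin ?powR_ge0// ge_nneseries// => i.
    exact: dyadic_term_ge0.
  rewrite ge0_sume_distrr; last by move=> i _; exact: dyadic_term_ge0.
  apply: lee_sum => i _; rewrite /b /dyadic_term muleCA -muleA.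
  rewrite lee_wpmul2l ?lee_fin ?invr_ge0 ?(ltW (scale_gt0 i r0))//.
  rewrite /mass -ge0_integralZr ?poweR_ge0//; last exact: measurable_funTS.
  rewrite -ge0_integralZl_EFin ?powR_ge0//; last exact: measurable_funTS.
  apply: ge0_le_integral => //.
  - by move=> y _; rewrite mule_ge0// poweR_ge0.
  - by apply: emeasurable_funM => //; exact: measurable_funTS.
  - by apply: measurable_funeM; exact: measurable_funTS.
  - by move=> y xy; rewrite muleCA lee_wpmul2l// Vt. }
have root (z : \bar R) : 0 <= z -> (mine z N%:E `^ p <= Y) =
    (z <= Y `^ p^-1) || (N%:E <= Y `^ p^-1).
  by move=> z0; rewrite poweR_le_root// ?ge_min// min0.
have opY : (op g x <= 2%:E * Y `^ p^-1) || (N%:E <= Y `^ p^-1).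
  have [NY|YN] := leP N%:E (Y `^ p^-1); first by rewrite orbT.
  rewrite orbF; apply: kernel_op_le_dyadic => // r r0.
  apply: nneseries_le => [i|n]; first exact: dyadic_term_ge0.
  have := partial r n r0; rewrite root; last first.
    by apply: sume_ge0 => i _; exact: dyadic_term_ge0.
  by case/orP => // NY; move: YN; rewrite ltNge NY.
rewrite EFinM -muleA -/Y -/t.
apply: (@le_trans _ _ ((2%:E * Y `^ p^-1) `^ p)).
  apply: gt0_le_poweR; [exact: ltW|exact: min0|rewrite ge_min].
  case/orP: opY => [->//|NY]; apply/orP; right; apply: le_trans NY _.
  by rewrite mul2e ?poweR_ge0// leeDl// poweR_ge0.
rewrite poweRM ?poweR_ge0// -poweRrM mulVf ?gt_eqF// poweRe1//.
Qed.

Section supersolution.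
Variables (u : borel X -> R) (mu_ : meas (EFin \o u)) (u0 : forall x, (0 <= u x)%R).
Variables (p q : R) (q1 : (1 < q)%R) (hpq : (p^-1 + q^-1 = 1)%R).

Let v (x : borel X) : \bar R := ((u x) `^ q)%:E.

Hypothesis super : {ae sigma, forall x, op v x <= (u x)%:E}.

Let q0 : (0 < q)%R. Proof. exact: lt_trans q1. Qed.

Let v0 x : 0 <= v x. Proof. by rewrite lee_fin powR_ge0. Qed.

Let mv : meas v.
Proof. exact: (measurableT_comp (measurable_poweR q) mu_). Qed.

Let MM : (0 < 2 * M)%R. Proof. by rewrite mulr_gt0. Qed.

Let c : R := ((2 * M) `^ q)^-1%R.

Let c0 : (0 < c)%R. Proof. by rewrite invr_gt0 powR_gt0. Qed.

Let A : R := ((c * (q - 1))^-1)%R.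

Let mass0 D : 0 <= mass v D. Proof. exact: mass_ge0. Qed.

(** The potential is at most 2M Kv on the ball, and Kv <= u is finite almost
    everywhere, hence at some point of a ball of positive measure. *)
Lemma dyadic_potential_fin x r : (0 < r)%R -> 0 < sigma (B x r) ->
  dyadic_potential (mass v) x r < +oo.
Proof.
move=> r0 sB; rewrite ltNge leye_eq; apply/negP => /eqP Sy.
move: super => [N [mN N0 sN]].
have : sigma (B x r) <= sigma N.
  apply: le_measure; rewrite ?inE// => y xy; apply: sN => /= h.
  have := dyadic_potential_le_near r0 mv v0 xy; rewrite Sy leye_eq => /eqP oy.
  have : (2 * M)%:E * op v y < +oo.
    apply: lte_mul_pinfty => //; first by rewrite lee_fin ltW.
    by apply: le_lt_trans h _; rewrite ltry.
  by rewrite oy.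
by rewrite leNgt N0 sB.
Qed.

(** On the ball, u >= Kv >= S/2M by [dyadic_potential_le_near], so v = u^q is at
    least (S/2M)^q there. *)
Lemma dyadic_mass_lower x r : (0 < r)%R ->
  c%:E * (dyadic_potential (mass v) x r `^ q * sigma (B x r)) <= mass v (B x r).
Proof.
move=> r0; have S0 := dyadic_potential_ge0 x r0 mass0.
rewrite muleA -[sigma _]mul1e -(integral_cst sigma (mB x r)) -ge0_integralZl.
- apply: ae_ge0_le_integral => //.
  + by move=> y _; rewrite mule1 mule_ge0 ?poweR_ge0// lee_fin ltW.
  + by apply: measurable_funeM.
  + exact: measurable_funTS.
  + case: super => N [mN N0 sN]; exists N; split => // y /= /not_implyP[xy hy].
    apply: sN => /= h; apply: hy; rewrite mule1.
    have h1 := dyadic_potential_le_near r0 mv v0 xy.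
    have h2 : dyadic_potential (mass v) x r <= (2 * M)%:E * (u y)%:E.
      by apply: le_trans h1 _; rewrite lee_pmul2l ?lte_fin.
    have := gt0_le_poweR (ltW q0) S0 h2.
    rewrite -EFinM poweR_EFin powRM ?(ltW MM)// => h3.
    apply: le_trans (lee_wpmul2l _ h3) _; first by rewrite lee_fin ltW.
    by rewrite -EFinM mulKf// gt_eqF// powR_gt0.
- by [].
- exact: measurable_cst.
- by [].
- by rewrite mule_ge0 ?poweR_ge0// lee_fin ltW.
Qed.

(** Induction on n by [ode_step], with time steps sigma(B_{r_i}(x))/r_i. *)
Lemma supersolution_cross : dyadic_cross v (q - 1) A.
Proof.
move=> x r n r0; have qm : (0 < q - 1)%R by rewrite subr_gt0.
pose d i := dyadic_term sigma x r i.
pose b i := dyadic_term (mass v) x r i.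
pose S i := dyadic_potential (mass v) x (scale r i).
pose T m := \sum_(i < m) d i.
have d0 i : 0 <= d i by exact: dyadic_term_ge0.
have b0 i : 0 <= b i by exact: dyadic_term_ge0.
have S0 i : 0 <= S i by apply: dyadic_potential_ge0 => //; exact: scale_gt0.
have T0 m : 0 <= T m by exact: sume_ge0.
have A0 : (0 <= A)%R by rewrite invr_ge0 mulr_ge0// ltW.
have SS i : S i = S i.+1 + b i.
  rewrite /S dyadic_potential_recl ?scale_gt0// scaleSr addeC; congr (_ + _).
  by rewrite /dyadic_term scale0.
have bS i : c%:E * (S i `^ q * d i) <= b i.
  rewrite /d /b /dyadic_term (muleCA (S i `^ q)) (muleCA c%:E).
  rewrite lee_wpmul2l ?lee_fin ?invr_ge0 ?(ltW (scale_gt0 i r0))//.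
  by apply: dyadic_mass_lower; exact: scale_gt0.
rewrite -/(T n) -/(S n); elim: n => [|n IH].
  by rewrite /T big_ord0 mul0e lee_fin.
have TS : T n.+1 = T n + d n by rewrite /T big_ord_recr.
have [sB|sB] := eqVneq (sigma (B x (scale r n))) 0.
  have -> : T n.+1 = 0.
    rewrite /T big1// => i _; rewrite /d /dyadic_term.
    suff -> : sigma (B x (scale r i)) = 0 by rewrite mule0.
    apply: subset_measure0 sB => //; apply: subset_qball.
    by rewrite /scale ler_pM2l// ler_weXn2l ?ler1n// -ltnS.
  by rewrite mul0e lee_fin.
have Sn : S n < +oo.
  by apply: dyadic_potential_fin; [exact: scale_gt0|rewrite lt0e sB measure_ge0].
have [->|S1] := eqVneq (S n.+1) 0.
  by rewrite poweR0r ?gt_eqF// mule0 lee_fin.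
have S1p : 0 < S n.+1 by rewrite lt0e S1 S0.
have Snp : 0 < S n by rewrite SS; apply: lt_le_trans S1p _; rewrite leeDl.
have bn : b n < +oo by apply: le_lt_trans Sn; rewrite (SS n) leeDr.
have wp : 0 < S n `^ q by rewrite poweR_gt0.
have dn : d n < +oo.
  rewrite ltNge leye_eq; apply/negP => /eqP dy; have := bS n.
  by rewrite dy gt0_muley// gt0_muley ?lte_fin// leye_eq => /eqP h; rewrite h in bn.
have wp1 : 0 < S n `^ (q - 1) by rewrite poweR_gt0.
have Tn : T n < +oo.
  rewrite ltNge leye_eq; apply/negP => /eqP Ty; move: IH.
  by rewrite Ty gt0_mulye// leye_eq.
have S1f : S n.+1 < +oo by apply: le_lt_trans Sn; rewrite (SS n) leeDl.
have := SS n; move: IH (bS n) (d0 n) (S0 n.+1) (T0 n) Snp; rewrite TS.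
move: (T n) (d n) (b n) (S n) (S n.+1) Tn dn bn Sn S1f => [T_| |]// [d_| |]// [b_| |]// [S_| |]// [S1_| |]//.
move=> _ _ _ _ _ IH h d_0 S1_0 T_0 S_0 E.
rewrite -EFinD poweR_EFin -EFinM lee_fin.
rewrite poweR_EFin -EFinM lee_fin in IH.
rewrite poweR_EFin -!EFinM lee_fin in h.
move: E; rewrite -EFinD => -[E].
rewrite !lee_fin in d_0 S1_0 T_0; rewrite lte_fin in S_0.
apply: (@ode_step _ (q - 1)%R c T_ d_ S_ S1_) => //.
- rewrite E; have : (0 <= b_)%R; last by lra.
  apply: le_trans h; rewrite mulr_ge0 ?(ltW c0)// mulr_ge0// powR_ge0//.
- have -> : (S_ - S1_ = b_)%R by rewrite E; ring.
  by rewrite subrK -mulrA.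
Qed.

End supersolution.

Lemma kernel_op_limn (g : (borel X -> \bar R)^nat) x : (forall n, meas (g n)) ->
  (forall n y, 0 <= g n y) -> (forall y, nondecreasing_seq (g^~ y)) ->
  op (fun y => limn (g^~ y)) x = limn (fun n => op (g n) x).
Proof.
move=> mg g0 ndg; rewrite /kernel_op -monotone_convergence//.
- apply: eq_integral => y _; rewrite muleC -limn_muler//.
  by congr (limn _); apply/funext => n; rewrite muleC.
- by move=> n; exact: emeasurable_funM.
- by move=> n y _; rewrite mule_ge0.
- by move=> y _ m n mn; rewrite lee_wpmul2l//; exact: ndg.
Qed.

Lemma measurable_truncate_pow g (N r : R) : meas g -> (forall y, 0 <= g y) ->
  meas (fun y => mine (op g y) N%:E `^ r).
Proof.
move=> mg g0; apply: (measurableT_comp (measurable_poweR r)).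
by apply: measurable_mine => //; exact: measurable_kernel_op.
Qed.

Section norm_inequality.
Variables (u : borel X -> R) (mu_ : meas (EFin \o u)).
Variables (p q : R) (q1 : (1 < q)%R) (hpq : (p^-1 + q^-1 = 1)%R).

Let v (x : borel X) : \bar R := ((u x) `^ q)%:E.

Hypothesis super : {ae sigma, forall x, op v x <= (u x)%:E}.

Let p1 : (1 < p)%R. Proof. exact: (conjugate_gt1 q1 hpq). Qed.

Let p0 : (0 < p)%R. Proof. exact: lt_trans p1. Qed.

Let pm : (0 <= p - 1)%R. Proof. by rewrite subr_ge0 ltW. Qed.

Let q0 : (0 < q)%R. Proof. exact: lt_trans q1. Qed.

Let v0 x : 0 <= v x. Proof. by rewrite lee_fin powR_ge0. Qed.

Let mv : meas v.
Proof. exact: (measurableT_comp (measurable_poweR q) mu_). Qed.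

Let c1 : R := (2 `^ p * (p * (2 * ((2 * M) `^ (p - 1)))))%R.
Let c2 : R := (4 * (M * M))%R.

Let c10 : (0 <= c1)%R. Proof. by rewrite !mulr_ge0 ?powR_ge0// ltW. Qed.
Let c20 : (0 <= c2)%R. Proof. by rewrite !mulr_ge0// ltW. Qed.

(** With t = min(Kg, N)^(p-1): bound the p-th power by K(g t), move K onto v,
    and split g (t Kv) by Young's inequality.  As (p-1)q = p and (Kv)^q <= v, the
    power (t Kv)^q is at most min(Kg, N)^p v and is absorbed. *)
Let absorb_norm : exists2 D : R, (0 < D)%R & forall g (N : R), meas g ->
  (forall y, 0 <= g y) -> (0 <= N)%R ->
  \int[sigma]_y (mine (op g y) N%:E `^ p * v y) < +oo ->
  \int[sigma]_y (mine (op g y) N%:E `^ p * v y) <= (2 * D)%:E * \int[sigma]_y g y `^ p.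
Proof.
have [D D0 young] := @young_eps _ p q q1 hpq (c1 * c2)%R 2^-1%R (mulr_ge0 c10 c20) (ltac:(by rewrite invr_gt0)).
exists D => // g N mg g0 N0 Yfin.
have mpow r := measurable_truncate_pow N r mg g0.
pose t y := mine (op g y) N%:E `^ (p - 1).
have t0 y : 0 <= t y by exact: poweR_ge0.
have mgp : meas (fun y => g y `^ p) by exact: (measurableT_comp (measurable_poweR p)).
have opg0 y : 0 <= op g y by exact: kernel_op_ge0.
have opv0 y : 0 <= op v y by exact: kernel_op_ge0.
have mopv : meas (op v) by exact: measurable_kernel_op.
have mtop : meas (fun y => t y * op v y) by apply: emeasurable_funM => //; exact: mpow.
have mgt : meas (fun y => g y * t y) by apply: emeasurable_funM => //; exact: mpow.
have gt0 y : 0 <= g y * t y by rewrite mule_ge0.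
have top0 y : 0 <= t y * op v y by rewrite mule_ge0.
have opgt0 y : 0 <= op (fun y => g y * t y) y by exact: kernel_op_ge0.
have mopgt : meas (op (fun y => g y * t y)) by exact: measurable_kernel_op.
have mtopq : meas (fun y => (t y * op v y) `^ q) by exact: (measurableT_comp (measurable_poweR q)).
have mY : meas (fun y => mine (op g y) N%:E `^ p * v y) by apply: emeasurable_funM => //; exact: mpow.
rewrite EFinM -muleA; apply: absorb_half => //.
  by apply: integral_ge0 => y _; rewrite mule_ge0// poweR_ge0.
  rewrite mule_ge0 ?lee_fin ?(ltW D0)//.
  by apply: integral_ge0 => y _; rewrite poweR_ge0.
have h1 : \int[sigma]_y (mine (op g y) N%:E `^ p * v y) <=
    c1%:E * \int[sigma]_y (v y * op (fun y => g y * t y) y).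
{ rewrite -ge0_integralZl_EFin//.
  - apply: ge0_le_integral => //.
    + by move=> y _; rewrite mule_ge0// poweR_ge0.
    + by apply: measurable_funeM; exact: emeasurable_funM.
    + move=> y _; rewrite (muleC (v y)) muleA lee_wpmul2r//.
      exact: truncated_power_le.
  - by move=> y _; rewrite mule_ge0.
  - exact: emeasurable_funM. }
have h2 : \int[sigma]_y (v y * op (fun y => g y * t y) y) <=
    c2%:E * \int[sigma]_y ((g y * t y) * op v y).
  exact: kernel_op_exchange.
apply: (le_trans h1); apply: (le_trans (lee_wpmul2l _ h2)); first by rewrite lee_fin.
rewrite muleA -EFinM -!ge0_integralZl_EFin//; first last.
  by rewrite mulr_ge0.
  exact: emeasurable_funM.
  by move=> y _; rewrite mule_ge0.
  exact: ltW.
  by move=> y _; exact: poweR_ge0.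
  by move=> y _; rewrite mule_ge0// poweR_ge0.
apply: (@le_trans _ _ (\int[sigma]_y (D%:E * g y `^ p + (2^-1)%:E * (t y * op v y) `^ q))).
{ apply: ge0_le_integral => //.
  - by move=> y _; apply: mule_ge0; [rewrite lee_fin mulr_ge0|apply: mule_ge0].
  - by apply: measurable_funeM; exact: emeasurable_funM.
  - by apply: emeasurable_funD; exact: measurable_funeM.
  - by move=> y _; rewrite -(muleA (g y)); exact: young. }
rewrite ge0_integralD//; first last.
  exact: measurable_funeM.
  by move=> y _; rewrite mule_ge0// poweR_ge0.
  exact: measurable_funeM.
  by move=> y _; rewrite mule_ge0 ?poweR_ge0// lee_fin ltW.
rewrite leeD2l//; apply: ae_ge0_le_integral => //.
- by move=> y _; rewrite mule_ge0// poweR_ge0.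
- exact: measurable_funeM.
- by move=> y _; rewrite !mule_ge0// poweR_ge0.
- exact: measurable_funeM.
- case: super => Z [mZ Z0 sZ]; exists Z; split => // y /= /not_implyP[_ hy].
  apply: sZ => /= h; apply: hy; rewrite lee_wpmul2l//.
  rewrite poweRM// /t -poweRrM (_ : ((p - 1) * q = p)%R); last first.
    by apply: (@conjugate_sub1_mul _ q p p1); rewrite addrC.
  rewrite lee_wpmul2l ?poweR_ge0// /v -poweR_EFin.
  by apply: gt0_le_poweR => //; exact: ltW.
Qed.

(** The a priori finiteness required by [absorb_norm] holds for bounded g
    carried by a set of finite measure on which u is bounded, because there
    int v Kg <= C int g Kv <= C int g u < oo. *)
Lemma norm_inequality_of_supersolution : exists2 C : R, (0 <= C)%R &
  forall g, meas g -> (forall y, 0 <= g y) ->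
  \int[sigma]_y (op g y `^ p * v y) <= C%:E * \int[sigma]_y g y `^ p.
Proof.
have [D D0 absorb] := absorb_norm.
have [F [FT ndF /all_and2[mF finF]]] := (sigma_finiteP setT sigma).1 (sigma_finiteT sigma).
have C0 : (0 <= 2 * D)%R by rewrite mulr_ge0// ltW.
exists (2 * D)%R => // g mg g0.
(* Truncations of g: bounded by j, carried by the set E j of finite measure on
   which u <= j; they increase to g. *)
pose U j : set (borel X) := [set y | u y%R <= j%:R]%R.
have mU j : measurable (U j).
  rewrite (_ : U j = setT `&` (EFin \o u) @^-1` [set z | z <= j%:R%:E]).
    by apply: mu_ => //; rewrite -set_itvNyc; exact: emeasurable_itv.
  by rewrite setTI; apply/seteqP; split => y /=; rewrite lee_fin.
pose E j := F j `&` U j.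
have mE j : measurable (E j) by exact: measurableI.
have ndE j k : (j <= k)%N -> E j `<=` E k.
  move=> jk y [Fy Uy]; split; first by have /subsetPset := ndF _ _ jk; apply.
  by rewrite /U/= (le_trans Uy)// ler_nat.
pose gj j y := (\1_(E j) y)%:E * mine (g y) j%:R%:E.
have mg0 (j : nat) y : 0 <= mine (g y) j%:R%:E by rewrite le_min g0 lee_fin ler0n.
have gj0 j y : 0 <= gj j y by rewrite mule_ge0 ?lee_fin.
have mgj j : meas (gj j).
  by apply: measurable_indicM => //; exact: measurable_mine.
have ndmin y j k : (j <= k)%N -> mine (g y) j%:R%:E <= mine (g y) k%:R%:E.
  by move=> jk; rewrite le_min !ge_min lexx/= lee_fin ler_nat jk orbT.
have ndgj y : nondecreasing_seq (gj^~ y).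
  move=> j k jk; apply: lee_pmul; rewrite ?lee_fin//; last exact: ndmin.
  by rewrite !indicE ler_nat; case: (boolP (y \in E j)) => // /set_mem/(ndE _ _ jk)/mem_set ->.
have gjg j y : gj j y <= g y.
  rewrite /gj indicE; case: (_ \in _); rewrite ?mul0e// mul1e ge_min lexx//.
have limgj y : limn (gj^~ y) = g y.
  apply/eqP; rewrite eq_le; apply/andP; split.
    apply: lime_le; first exact: ereal_nondecreasing_is_cvgn.
    by apply: nearW => j; exact: gjg.
  have [k Ey] : exists k, E k y.
    have : setT y by []. rewrite FT => -[i _ Fy].
    pose k := maxn i (Num.truncn (u y)).+1.
    exists k; split; first by have /subsetPset := ndF _ _ (leq_maxl i (Num.truncn (u y)).+1); apply.
    rewrite /U/= (le_trans (ltW (truncnS_gt _)))// ler_nat leq_maxr//.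
  have nda : nondecreasing_seq (fun j => mine (g y) j%:R%:E) by move=> i j; exact: ndmin.
  apply: (@le_trans _ _ (limn (fun j : nat => mine (g y) j%:R%:E))).
    apply: le_trans (@limn_truncate _ (fun=> g y) _); last by move=> *; exact: lexx.
    by rewrite lim_cst.
  apply: lime_le; first exact: ereal_nondecreasing_is_cvgn.
  exists k => // j /= kj.
  apply: le_trans (nondecreasing_le_limn j (ndgj y)).
  by rewrite /gj indicE mem_set ?mul1e//; exact: ndE Ey.
have opgj0 j y : 0 <= op (gj j) y by exact: kernel_op_ge0.
have ndop y : nondecreasing_seq (fun j => op (gj j) y).
  by move=> j k jk; apply: le_kernel_op => // z; exact: ndgj.
pose h j y := mine (op (gj j) y) j%:R%:E `^ p.
have min0 j y : 0 <= mine (op (gj j) y) j%:R%:E by rewrite le_min opgj0 lee_fin ler0n.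
have mh j : meas (h j) by exact: measurable_truncate_pow.
have ndm y : nondecreasing_seq (fun j => mine (op (gj j) y) j%:R%:E).
  move=> j k jk; rewrite le_min !ge_min ndop//=.
  by rewrite lee_fin ler_nat jk orbT.
have ndh y : nondecreasing_seq (h^~ y).
  move=> j k jk; apply: gt0_le_poweR => //; first exact: ltW.
  exact: ndm.
have h0 j y : 0 <= h j y by exact: poweR_ge0.
(* One factor Kg of (Kg)^p is kept for the exchange of K, and the remaining
   truncated factors are bounded by j. *)
have hfin j : \int[sigma]_y (h j y * v y) < +oo.
{ have jp0 : (0 <= j%:R `^ (p - 1))%R :> bool by exact: powR_ge0.
  have mgv : meas (fun y => gj j y * op v y).
    by apply: emeasurable_funM => //; exact: measurable_kernel_op.
  have opv0 y : 0 <= op v y by exact: kernel_op_ge0.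
  apply: (@le_lt_trans _ _ ((j%:R `^ (p - 1))%:E * (c2%:E * \int[sigma]_y (gj j y * op v y)))).
    have mvop : meas (fun y => v y * op (gj j) y).
      by apply: emeasurable_funM => //; exact: measurable_kernel_op.
    apply: (@le_trans _ _ ((j%:R `^ (p - 1))%:E * \int[sigma]_y (v y * op (gj j) y))).
    { rewrite -ge0_integralZl_EFin//; last by move=> y _; rewrite mule_ge0.
      apply: ge0_le_integral => //.
      - by move=> y _; rewrite mule_ge0.
      - by apply: emeasurable_funM.
      - by apply: measurable_funeM.
      - move=> y _; rewrite /h -poweR_sub1// (muleC (v y)) muleA lee_wpmul2r//.
        rewrite muleC; apply: lee_pmul => //; first exact: poweR_ge0.
          rewrite -poweR_EFin; apply: gt0_le_poweR => //.
          by rewrite ge_min lexx orbT.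
        by rewrite ge_min lexx. }
    by rewrite lee_wpmul2l ?lee_fin//; exact: kernel_op_exchange.
  apply: lte_mul_pinfty; [by rewrite lee_fin|by []|].
  apply: lte_mul_pinfty; [by rewrite lee_fin|by []|].
  apply: (@le_lt_trans _ _ (\int[sigma]_y ((j%:R * j%:R)%:E * (\1_(E j) y)%:E))).
  { apply: ae_ge0_le_integral => //.
    - by move=> y _; rewrite mule_ge0.
    - by apply: measurable_funeM; apply/measurable_EFinP; exact: measurable_indic.
    - case: super => Z [mZ Z0 sZ]; exists Z; split => // y /= /not_implyP[_ hy].
      apply: sZ => /= hs; apply: hy; rewrite /gj indicE.
      have [/set_mem[Fy Uy]|_] := boolP (y \in E j); last by rewrite !mul0e mule0.
      rewrite mul1e mule1 EFinM; apply: lee_pmul => //.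
        by rewrite ge_min lexx orbT.
      by apply: (le_trans hs); rewrite lee_fin. }
  rewrite ge0_integralZl_EFin//; last first.
    by apply/measurable_EFinP; exact: measurable_indic.
  rewrite integral_indic// setIT; apply: lte_mul_pinfty; [by rewrite lee_fin mulr_ge0|by []|].
  apply: le_lt_trans (finF j); apply: le_measure; rewrite ?inE//.
  exact: subIsetl. }
apply: (@le_integral_limn _ _ _ sigma (fun j (y : borel X) => h j y * v y)).
- by move=> j; apply: emeasurable_funM.
- by move=> j y; rewrite mule_ge0.
- by move=> y j k jk; rewrite lee_wpmul2r//; exact: ndh.
- by apply: emeasurable_funM => //; exact: measurable_poweR_op.
- by move=> y; rewrite mule_ge0// poweR_ge0.
- move=> y; rewrite limn_muler// lee_wpmul2r//.
  have -> : op g y = limn (fun j => op (gj j) y).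
    rewrite -kernel_op_limn//; congr (op _ y).
    by apply/funext => z; rewrite limgj.
  apply: le_trans (limn_poweR_le p0 (ndm y) (min0 ^~ y)).
  apply: gt0_le_poweR; [exact: ltW| |exact: limn_truncate].
  apply: le_trans (opgj0 0%N y) _; exact: (@nondecreasing_le_limn _ (fun j => op (gj j) y)).
- move=> j; apply: (le_trans (absorb _ _ (mgj j) (gj0 j) (ler0n _ j) (hfin j))).
  rewrite lee_wpmul2l ?lee_fin//; apply: ge0_le_integral => //.
  + by move=> y _; exact: poweR_ge0.
  + exact: (measurableT_comp (measurable_poweR p)).
  + exact: (measurableT_comp (measurable_poweR p)).
  + by move=> y _; apply: gt0_le_poweR => //; exact: ltW.
Qed.

End norm_inequality.

(** * From the norm inequality to testing on balls *)

(** Duality on the explicit function g = 1_B (K b)^(q-1) with b = 1_B w: the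
    integral Y of 1_B (K b)^q is, up to truncations, int g Kb <= C int b Kg, and by Young's
    inequality 1_B w Kg is split into w 1_B and a small multiple of (Kg)^p w, whose integral
    is at most a small multiple of int g^p = Y. *)
Lemma testing_of_norm_inequality (w : borel X -> \bar R) (p q C : R) :
  meas w -> (forall y, 0 <= w y) -> (1 < q)%R -> (p^-1 + q^-1 = 1)%R -> (0 <= C)%R ->
  (forall g : borel X -> R, (forall y, (0 <= g y)%R) -> g \in Lfun sigma p%:E ->
    \int[sigma]_y (op (EFin \o g) y `^ p * w y) <= C%:E * \int[sigma]_y (g y `^ p)%:E) ->
  exists2 C' : R, (0 <= C')%R & forall x a, (0 < a)%R ->
    \int[sigma]_(y in B x a) (op (fun z => (\1_(B x a) z)%:E * w z) y `^ q) <=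
    C'%:E * mass w (B x a).
Proof.
move=> mw w0 q1 hpq C0 norm.
have p1 : (1 < p)%R by exact: (conjugate_gt1 q1 hpq).
have p0 : (0 < p)%R by exact: lt_trans p1.
have q0 : (0 < q)%R by exact: lt_trans q1.
have qm : (0 <= q - 1)%R by rewrite subr_ge0 ltW.
have hqp : (q^-1 + p^-1 = 1)%R by rewrite addrC.
pose c2 : R := (4 * (M * M))%R.
have c20 : (0 <= c2)%R by rewrite !mulr_ge0// ltW.
(* Makes eta C <= 1/2, the threshold of [absorb_half]. *)
pose eta : R := (2 * (C + 1))^-1%R.
have eta0 : (0 < eta)%R by rewrite invr_gt0 mulr_gt0// ltr_wpDl.
have etaC : (eta * C <= 2^-1)%R.
  rewrite /eta mulrC ler_pdivrMr ?mulr_gt0 ?ltr_wpDl//; lra.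
have [D D0 young] := @young_eps _ q p p1 hqp c2 eta c20 eta0.
exists (2 * D)%R => [|x a a0]; first by rewrite mulr_ge0// ltW.
have [F [FT ndF /all_and2[mF finF]]] := (sigma_finiteP setT sigma).1 (sigma_finiteT sigma).
set b := fun z => (\1_(B x a) z)%:E * w z.
have mb : meas b by exact: measurable_indicM.
have b0 y : 0 <= b y by rewrite mule_ge0 ?lee_fin.
have opb0 y : 0 <= op b y by exact: kernel_op_ge0.
pose E n := B x a `&` F n.
have mE n : measurable (E n) by exact: measurableI.
pose k n y := mine (op b y) n%:R%:E.
have k0 n y : 0 <= k n y by rewrite le_min opb0 lee_fin ler0n.
have kn n y : k n y <= n%:R%:E by rewrite ge_min lexx orbT.
have kop n y : k n y <= op b y by rewrite ge_min lexx.
have mk n r : meas (fun y => k n y `^ r) by exact: measurable_truncate_pow.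
pose h n y := (\1_(E n) y)%:E * k n y `^ q.
have mh n : meas (h n) by apply: measurable_indicM.
have h0 n y : 0 <= h n y by rewrite mule_ge0 ?lee_fin ?poweR_ge0.
have ndk y : nondecreasing_seq (fun n => k n y `^ q).
  move=> m n mn; apply: gt0_le_poweR => //; first exact: ltW.
  by rewrite /k le_min !ge_min lexx/= lee_fin ler_nat mn orbT.
have ndE m n : (m <= n)%N -> E m `<=` E n.
  by move=> mn y [By Fy]; split => //; have /subsetPset := ndF _ _ mn; apply.
have ndh y : nondecreasing_seq (h^~ y).
  move=> m n mn; apply: lee_pmul; rewrite ?lee_fin ?poweR_ge0//; last exact: ndk.
  by rewrite !indicE ler_nat; case: (boolP (y \in E m)) => // /set_mem/(ndE _ _ mn)/mem_set ->.
rewrite -/(mass (fun y => op b y `^ q) _) mass_indic.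
apply: (@le_integral_limn _ _ _ sigma h) => //.
  by apply: measurable_indicM => //; exact: measurable_poweR_op.
  by move=> y; rewrite mule_ge0 ?lee_fin ?poweR_ge0.
{ move=> y; rewrite {1}indicE; have [/set_mem xy|_] := boolP (y \in B x a); last first.
    rewrite mul0e; apply: le_trans (h0 0%N y) _.
    exact: (@nondecreasing_le_limn _ (h^~ y)).
  rewrite mul1e.
  have [m _ Fy] : (\bigcup_i F i) y by rewrite -FT.
  apply: (@le_trans _ _ (limn (fun n => k n y `^ q))).
    apply: le_trans (limn_poweR_le q0 _ (k0 ^~ y)).
      apply: gt0_le_poweR => //; first exact: ltW.
      by apply: le_trans (@limn_truncate _ (fun=> op b y) _); [rewrite lim_cst|move=> *; exact: lexx].
    by move=> i j ij; rewrite /k le_min !ge_min lexx/= lee_fin ler_nat ij orbT.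
  apply: lime_le; first exact: ereal_nondecreasing_is_cvgn.
  exists m => // n /= mn; apply: le_trans (@nondecreasing_le_limn _ (h^~ y) n (ndh y)).
  rewrite /h indicE mem_set ?mul1e//; split => //.
  by have /subsetPset := ndF _ _ mn; apply. }
move=> n.
pose g y := fine ((\1_(E n) y)%:E * k n y `^ (q - 1)).
have gE y : (g y)%:E = (\1_(E n) y)%:E * k n y `^ (q - 1).
  rewrite /g fineK// ge0_fin_numE ?mule_ge0 ?lee_fin ?poweR_ge0//.
  apply: lte_mul_pinfty => //.
  rewrite poweR_lty//; exact: le_lt_trans (kn n y) (ltry _).
have mg : meas (EFin \o g).
  rewrite (_ : EFin \o g = fun y => (\1_(E n) y)%:E * k n y `^ (q - 1)).
    exact: measurable_indicM.
  by apply/funext => y; rewrite -gE.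
have g0 y : (0 <= g y)%R by rewrite -lee_fin gE mule_ge0 ?lee_fin ?poweR_ge0.
have gp y : (g y `^ p)%:E = h n y.
  rewrite -poweR_EFin gE /h indicE; case: (_ \in _).
    by rewrite !mul1e -poweRrM (conjugate_sub1_mul q1 hpq).
  by rewrite !mul0e poweR0r// gt_eqF.
have Yfin : \int[sigma]_y h n y < +oo.
  apply: (@le_lt_trans _ _ (\int[sigma]_y ((n%:R `^ q)%:E * (\1_(E n) y)%:E))).
  { apply: ge0_le_integral => //.
    - by apply: measurable_funeM; apply/measurable_EFinP; exact: measurable_indic.
    - move=> y _; rewrite /h muleC lee_wpmul2r ?lee_fin//.
      by rewrite -poweR_EFin; apply: gt0_le_poweR => //; exact: ltW. }
  rewrite ge0_integralZl_EFin ?powR_ge0//; last first.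
    by apply/measurable_EFinP; exact: measurable_indic.
  rewrite integral_indic// setIT; apply: lte_mul_pinfty; [by rewrite lee_fin powR_ge0|by []|].
  apply: le_lt_trans (finF n); apply: le_measure; rewrite ?inE//.
  exact: subIsetr.
have gL : g \in Lfun sigma p%:E.
  rewrite inE; apply/andP; split; first by rewrite inE; apply/measurable_EFinP.
  rewrite inE /finite_norm; have := poweR_Lnorm sigma (EFin \o g) (lt0r_neq0 p0).
  under eq_integral do rewrite /= ger0_norm// gp.
  move=> NY; have := Yfin; rewrite -NY; move: (Lnorm_ge0 sigma p%:E (EFin \o g)).
  change (0 <= 'N[sigma]_p%:E[EFin \o g] -> 'N[sigma]_p%:E[EFin \o g] `^ p < +oo ->
    'N[sigma]_p%:E[EFin \o g] < +oo).
  case: ('N[sigma]_p%:E[EFin \o g]) => [r _ _| |]//; first by rewrite ltry.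
  by rewrite poweRyr// gt_eqF.
rewrite EFinM -muleA; apply: absorb_half => //.
  exact: integral_ge0.
  by apply: mule_ge0; [rewrite lee_fin ltW|exact: mass_ge0].
have g0' y : 0 <= (EFin \o g) y by rewrite lee_fin.
have mopg : meas (op (EFin \o g)) by exact: measurable_kernel_op.
have opg0 y : 0 <= op (EFin \o g) y by exact: kernel_op_ge0.
have mopgp : meas (fun y => op (EFin \o g) y `^ p) by exact: measurable_poweR_op.
have mopb : meas (op b) by exact: measurable_kernel_op.
have h1 : \int[sigma]_y h n y <= \int[sigma]_y ((EFin \o g) y * op b y).
{ apply: ge0_le_integral => //.
  - exact: emeasurable_funM.
  - move=> y _; rewrite [(EFin \o g) y]gE /h -muleA lee_wpmul2l ?lee_fin//.
    rewrite -poweR_sub1// muleC lee_wpmul2l ?poweR_ge0//. }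
apply: (le_trans h1); apply: (le_trans (kernel_op_exchange mg g0' mb b0)).
rewrite -/c2 -ge0_integralZl_EFin//; first last.
  exact: emeasurable_funM.
  by move=> y _; rewrite mule_ge0.
apply: (@le_trans _ _ (\int[sigma]_y (D%:E * b y + eta%:E * (op (EFin \o g) y `^ p * w y)))).
{ apply: ge0_le_integral => //.
  - by move=> y _; rewrite mule_ge0 ?lee_fin// mule_ge0.
  - by apply: measurable_funeM; exact: emeasurable_funM.
  - by apply: emeasurable_funD; apply: measurable_funeM => //; exact: emeasurable_funM.
  - move=> y _; rewrite /b; move: (opg0 y); set O := op (EFin \o g) y => O0.
    rewrite indicE; case: (_ \in _); last first.
      by rewrite !mul0e !mule0 add0e mule_ge0 ?lee_fin ?(ltW eta0)// mule_ge0 ?poweR_ge0.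
    have := young 1 O lee01 O0; rewrite poweR_EFin powR1 mule1 !mul1e => yy.
    rewrite (muleC (w y) O) !muleA; apply: (le_trans (lee_wpmul2r (w0 y) yy)).
    by rewrite ge0_muleDl// ?lee_fin ?(ltW D0)// mule_ge0 ?lee_fin ?(ltW eta0) ?poweR_ge0. }
have mopgw : meas (fun y => op (EFin \o g) y `^ p * w y) by exact: emeasurable_funM.
have opgw0 y : 0 <= op (EFin \o g) y `^ p * w y by rewrite mule_ge0// poweR_ge0.
rewrite ge0_integralD//; first last.
  exact: measurable_funeM.
  by move=> y _; apply: mule_ge0 => //; rewrite lee_fin ltW.
  exact: measurable_funeM.
  by move=> y _; apply: mule_ge0 => //; rewrite lee_fin ltW.
rewrite !ge0_integralZl_EFin ?(ltW D0) ?(ltW eta0)// mass_indic leeD2l//.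
apply: (le_trans (lee_wpmul2l _ (norm g g0 gL))); first by rewrite lee_fin ltW.
have -> : \int[sigma]_y (g y `^ p)%:E = \int[sigma]_y h n y.
  by apply: eq_integral => y _; exact: gp.
by rewrite muleA -EFinM lee_wpmul2r//; exact: integral_ge0.
Qed.

(** * Construction of a solution *)

Lemma le_kernel_op_ae g h x : meas g -> meas h -> (forall y, 0 <= g y) ->
  (forall y, 0 <= h y) -> {ae sigma, forall y, g y <= h y} -> op g x <= op h x.
Proof.
move=> mg mh g0 h0 gh; apply: ae_ge0_le_integral => //.
- by move=> y _; rewrite mule_ge0.
- exact: emeasurable_funM.
- by move=> y _; rewrite mule_ge0.
- exact: emeasurable_funM.
- case: gh => Z [mZ Z0 sZ]; exists Z; split => // y /= /not_implyP[_ hy].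
  by apply: sZ => /= gh; apply: hy; rewrite lee_wpmul2l.
Qed.

(** V = eps f + delta K(f^q) satisfies K(V^q) <= delta K(f^q), that is,
    K(V^q) + eps f <= V.  Hence the increasing iterates of U -> K(U^q) + eps f
    starting at 0 stay below V almost everywhere, and monotone convergence shows
    that their limit is a fixed point. *)
Lemma solution_of_pointwise (f : borel X -> \bar R) (q C : R) : meas f ->
  (forall y, 0 <= f y) -> {ae sigma, forall y, f y < +oo} -> (1 < q)%R -> (0 <= C)%R ->
  {ae sigma, forall x, op (fun y => op (fun z => f z `^ q) y `^ q) x <=
      C%:E * op (fun z => f z `^ q) x /\ op (fun z => f z `^ q) x < +oo} ->
  exists2 eps : R, (0 < eps)%R & exists u : borel X -> R,
    [/\ meas u, forall x, (0 <= u x)%R &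
      {ae sigma, forall x,
        (u x)%:E = op (fun y => (u y `^ q)%:E) x + eps%:E * f x}].
Proof.
move=> mf f0 ffin q1 C0 pointwise.
have q0 : (0 < q)%R by exact: lt_trans q1.
have [eps [delta [e0 d0 ed]]] := supersolution_constants q1 C0.
exists eps => //.
have mpow (g : borel X -> \bar R) : meas g -> meas (fun y => g y `^ q).
  by move=> mg; exact: (measurableT_comp (measurable_poweR q)).
pose w z := f z `^ q.
have mw : meas w by exact: mpow.
have w0 z : 0 <= w z by exact: poweR_ge0.
have mopw : meas (op w) by exact: measurable_kernel_op.
have opw0 z : 0 <= op w z by exact: kernel_op_ge0.
have ef0 z : 0 <= eps%:E * f z by rewrite mule_ge0// lee_fin ltW.
have mef : meas (fun z => eps%:E * f z) by exact: measurable_funeM.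
pose V z := eps%:E * f z + delta%:E * op w z.
have V0 z : 0 <= V z by rewrite adde_ge0// mule_ge0// lee_fin ltW.
have mV : meas V by apply: emeasurable_funD => //; exact: measurable_funeM.
have Vq0 z : 0 <= V z `^ q by exact: poweR_ge0.
have mVq : meas (fun z => V z `^ q) by exact: mpow.
have opVq : {ae sigma, forall x, op (fun z => V z `^ q) x <= delta%:E * op w x}.
{ apply: (ae_imp pointwise) => x [h _].
  pose g1 z := (2 `^ q * eps `^ q)%:E * w z.
  pose g2 z := (2 `^ q * delta `^ q)%:E * op w z `^ q.
  have a1 : (0 <= 2 `^ q * eps `^ q)%R by rewrite mulr_ge0 ?powR_ge0.
  have a2 : (0 <= 2 `^ q * delta `^ q)%R by rewrite mulr_ge0 ?powR_ge0.
  have g10 z : 0 <= g1 z by rewrite mule_ge0 ?lee_fin.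
  have g20 z : 0 <= g2 z by rewrite mule_ge0 ?lee_fin ?poweR_ge0.
  have mopwq : meas (fun z => op w z `^ q) by exact: mpow.
  have mg1 : meas g1 by exact: measurable_funeM.
  have mg2 : meas g2 by exact: measurable_funeM.
  have Vle z : V z `^ q <= g1 z + g2 z.
    apply: (le_trans (poweR_sum_le q0 (ef0 z) _)).
      by rewrite mule_ge0// lee_fin ltW.
    rewrite !poweRM ?lee_fin ?(ltW e0) ?(ltW d0)// ge0_muleDr ?mule_ge0 ?poweR_ge0 ?lee_fin ?powR_ge0//.
    by rewrite !muleA -!EFinM.
  apply: (@le_trans _ _ (op (fun z => g1 z + g2 z) x)).
    by apply: le_kernel_op => //; exact: emeasurable_funD.
  have -> : op (fun z => g1 z + g2 z) x = op g1 x + op g2 x.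
  { rewrite /kernel_op -ge0_integralD//.
    - by apply: eq_integral => z _; rewrite ge0_muleDr.
    - by move=> z _; rewrite mule_ge0.
    - exact: emeasurable_funM.
    - by move=> z _; rewrite mule_ge0.
    - exact: emeasurable_funM. }
  have opZ (c : R) g : (0 <= c)%R -> meas g -> (forall z, 0 <= g z) ->
      op (fun z => c%:E * g z) x = c%:E * op g x.
  { move=> c0 mg g0; rewrite /kernel_op -ge0_integralZl_EFin//.
    - by apply: eq_integral => z _; rewrite muleCA.
    - by move=> z _; rewrite mule_ge0.
    - exact: emeasurable_funM. }
  rewrite /g1 /g2 !opZ//; last by move=> z; exact: poweR_ge0.
  apply: (@le_trans _ _ ((2 `^ q * eps `^ q)%:E * op w x +
     (2 `^ q * delta `^ q)%:E * (C%:E * op w x))).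
    by rewrite leeD2l// lee_wpmul2l// lee_fin.
  rewrite muleA -EFinM -ge0_muleDl ?lee_fin//; last by rewrite mulr_ge0.
  by rewrite -EFinD lee_wpmul2r// lee_fin -mulrA -mulrDr. }
pose U := fix U (n : nat) : borel X -> \bar R :=
  if n is m.+1 then fun x => op (fun y => U m y `^ q) x + eps%:E * f x else fun=> 0.
have US n x : U n.+1 x = op (fun y => U n y `^ q) x + eps%:E * f x by [].
have U0 n x : 0 <= U n x.
  case: n => [|n]; first exact: lexx.
  by rewrite US adde_ge0//; apply: kernel_op_ge0 => y; exact: poweR_ge0.
have Uq0 n x : 0 <= U n x `^ q by exact: poweR_ge0.
have mU n : meas (U n).
  elim: n => [|n IH]; first exact: measurable_cst.
  by apply: emeasurable_funD => //; apply: measurable_kernel_op => //; exact: mpow.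
have mUq n : meas (fun x => U n x `^ q) by exact: mpow.
have UU n x : U n x <= U n.+1 x.
  elim: n x => [|n IH] x; first exact: U0.
  rewrite !US leeD2r//; apply: le_kernel_op => // y.
  by apply: gt0_le_poweR => //; exact: ltW.
have ndU x : nondecreasing_seq (U^~ x) by apply/nondecreasing_seqP => n; exact: UU.
have UV n : {ae sigma, forall x, U n x <= V x}.
  elim: n => [|n IH]; first by apply: aeW => x; exact: V0.
  apply: (ae_imp opVq) => x h; rewrite US addeC leeD2l//; apply: le_trans h.
  apply: le_kernel_op_ae => //; apply: (ae_imp IH) => y UV.
  by apply: gt0_le_poweR => //; exact: ltW.
pose L x := limn (U^~ x).
have L0 x : 0 <= L x by apply: le_trans (U0 0%N x) _; exact: (@nondecreasing_le_limn _ (U^~ x)).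
have mL : meas L.
  apply: (@emeasurable_fun_cvg _ _ _ _ U) => // x _.
  exact: ereal_nondecreasing_is_cvgn.
have Lfin : {ae sigma, forall x, L x < +oo}.
  apply: (ae_imp (ae_conj ffin (ae_conj pointwise (ae_foralln UV)))) => x [fx [[_ wx] UVx]].
  apply: (@le_lt_trans _ _ (V x)).
    by apply: lime_le; [exact: ereal_nondecreasing_is_cvgn|exact: nearW].
  rewrite /V lte_add_pinfty//; apply: lte_mul_pinfty => //; by rewrite lee_fin ltW.
have LE x : L x = op (fun y => L y `^ q) x + eps%:E * f x.
  have ndUq y : nondecreasing_seq (fun n => U n y `^ q).
    by move=> m n mn; apply: gt0_le_poweR => //; [exact: ltW|exact: ndU].
  have -> : (fun y => L y `^ q) = (fun y => limn (fun n => U n y `^ q)).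
    by apply/funext => y; rewrite limn_poweR.
  rewrite (kernel_op_limn x mUq)//.
  have ndop : nondecreasing_seq (fun n => op (fun y => U n y `^ q) x).
    by move=> m n mn; apply: le_kernel_op => // y; exact: ndUq.
  apply/cvg_lim => //; rewrite -(cvg_shiftS (U^~ x)) /=.
  apply: cvgeD; [|exact: ereal_nondecreasing_is_cvgn|exact: cvg_cst].
  apply: ge0_adde_def; rewrite inE//.
  apply: (@le_trans _ _ (op (fun y => U 0%N y `^ q) x)).
    by apply: kernel_op_ge0 => y; exact: poweR_ge0.
  exact: (@nondecreasing_le_limn _ (fun n => op (fun y => U n y `^ q) x)).
exists (fine \o L); split.
- exact: (measurableT_comp (fine_measurable measurableT) mL).
- by move=> x; exact: fine_ge0.
- have Lae : {ae sigma, forall x, (fine (L x))%:E = L x}.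
    by apply: (ae_imp Lfin) => x Lx; rewrite fineK// ge0_fin_numE.
  apply: (ae_imp Lae) => x Lx; rewrite /= Lx {1}LE; congr (_ + _).
  have mfL : meas (fun y => (fine (L y) `^ q)%:E).
    under eq_fun do rewrite -poweR_EFin.
    apply: mpow; apply/measurable_EFinP.
    exact: (measurableT_comp (fine_measurable measurableT) mL).
  have mLq : meas (fun y => L y `^ q) by exact: mpow.
  apply/eqP; rewrite eq_le; apply/andP; split; apply: le_kernel_op_ae => //.
  + by move=> y; exact: poweR_ge0.
  + by move=> y; rewrite lee_fin powR_ge0.
  + by apply: (ae_imp Lae) => y Ly; rewrite -poweR_EFin Ly.
  + by move=> y; rewrite lee_fin powR_ge0.
  + by move=> y; exact: poweR_ge0.
  + by apply: (ae_imp Lae) => y Ly; rewrite -poweR_EFin Ly.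
Qed.

(** * The equivalences *)

Lemma eq_kernel_op_ae g h x : meas g -> meas h -> (forall y, 0 <= g y) ->
  (forall y, 0 <= h y) -> {ae sigma, forall y, g y = h y} -> op g x = op h x.
Proof.
move=> mg mh g0 h0 gh; apply/eqP; rewrite eq_le.
by apply/andP; split; apply: le_kernel_op_ae => //; apply: (ae_imp gh) => y ->.
Qed.

(** A pointwise bound between the densities holds for their potentials. *)
Lemma dyadic_cross_le (g h : borel X -> \bar R) (alpha c A : R) : meas g -> meas h ->
  (forall y, 0 <= g y) -> (forall y, 0 <= h y) -> (0 <= c)%R -> (0 <= alpha)%R ->
  {ae sigma, forall y, g y <= c%:E * h y} ->
  dyadic_cross h alpha A -> dyadic_cross g alpha (c `^ alpha * A).
Proof.
move=> mg mh g0 h0 c0 al0 gh crossh x r n r0.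
have s0 := scale_gt0 n r0.
have massgh x' r' : mass g (B x' r') <= c%:E * mass h (B x' r').
{ rewrite /mass -ge0_integralZl_EFin//; last exact: measurable_funTS.
  apply: ae_ge0_le_integral => //.
  - exact: measurable_funTS.
  - by move=> y _; rewrite mule_ge0.
  - by apply: measurable_funeM; exact: measurable_funTS.
  - by apply: (ae_imp gh). }
have Sgh : dyadic_potential (mass g) x (scale r n) <=
    c%:E * dyadic_potential (mass h) x (scale r n).
  have t0 i : 0 <= dyadic_term (mass h) x (scale r n) i.
    by apply: dyadic_term_ge0 => // D; exact: mass_ge0.
  rewrite /dyadic_potential -nneseriesZl//.
  apply: lee_nneseries => [i _ _|i _].
    by apply: dyadic_term_ge0 => // D; exact: mass_ge0.
  rewrite /dyadic_term muleCA lee_wpmul2l// lee_fin invr_ge0 ltW//.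
  exact: scale_gt0.
have T0 : 0 <= \sum_(i < n) dyadic_term sigma x r i.
  by apply: sume_ge0 => i _; exact: dyadic_term_ge0.
have Sg0 : 0 <= dyadic_potential (mass g) x (scale r n).
  by apply: dyadic_potential_ge0 => // D; exact: mass_ge0.
have Sh0 : 0 <= dyadic_potential (mass h) x (scale r n).
  by apply: dyadic_potential_ge0 => // D; exact: mass_ge0.
apply: (le_trans (lee_wpmul2l T0 (gt0_le_poweR al0 Sg0 Sgh))).
rewrite poweRM// poweR_EFin muleCA EFinM lee_wpmul2l ?lee_fin ?powR_ge0//.
exact: crossh.
Qed.

(** From u >= K(u^q) and u >= eps f: the density f^q is at most eps^-q v with
    v = u^q, to which [supersolution_cross] and
    [norm_inequality_of_supersolution] apply. *)
Lemma cross_norm_of_solution (u : borel X -> R) (w f : borel X -> \bar R) (p q eps : R) :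
  meas (EFin \o u) -> (forall x, (0 <= u x)%R) -> meas w -> (forall y, 0 <= w y) ->
  {ae sigma, forall y, w y = f y `^ q} -> {ae sigma, forall y, 0 <= f y} ->
  (1 < q)%R -> (p^-1 + q^-1 = 1)%R -> (0 < eps)%R ->
  {ae sigma, forall x, (u x)%:E = op (fun y => (u y `^ q)%:E) x + eps%:E * f x} ->
  (exists A : R, dyadic_cross w (q - 1) A) /\
  exists2 C : R, (0 <= C)%R & forall g, meas g -> (forall y, 0 <= g y) ->
    \int[sigma]_y (op g y `^ p * w y) <= C%:E * \int[sigma]_y g y `^ p.
Proof.
move=> mu_ u0 mw w0 wf f0 q1 hpq e0 sol.
have q0 : (0 < q)%R by exact: lt_trans q1.
pose v x : \bar R := (u x `^ q)%:E.
have v0 x : 0 <= v x by rewrite lee_fin powR_ge0.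
have mv : meas v by exact: (measurableT_comp (measurable_poweR q) mu_).
have opv0 x : 0 <= op v x by exact: kernel_op_ge0.
have super : {ae sigma, forall x, op v x <= (u x)%:E}.
  by apply: (ae_imp (ae_conj sol f0)) => x [-> fx]; rewrite leeDl// mule_ge0// lee_fin ltW.
pose c : R := (eps^-1 `^ q)%R.
have c0 : (0 <= c)%R by exact: powR_ge0.
have wv : {ae sigma, forall x, w x <= c%:E * v x}.
{ apply: (ae_imp (ae_conj (ae_conj wf f0) sol)) => x [[-> fx] ux].
  have efu : eps%:E * f x <= (u x)%:E by rewrite ux leeDr//.
  have fu : f x <= eps^-1%:E * (u x)%:E by rewrite lee_pdivlMl.
  apply: (le_trans (gt0_le_poweR (ltW q0) fx fu)).
  by rewrite poweRM ?lee_fin ?invr_ge0 ?(ltW e0). }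
split.
  exists (c `^ (q - 1) * ((((2 * M) `^ q)^-1 * (q - 1))^-1))%R.
  apply: (@dyadic_cross_le w v) => //; first by rewrite subr_ge0 ltW.
  exact: (supersolution_cross mu_ u0 q1 super).
have [C C0 norm] := norm_inequality_of_supersolution mu_ q1 hpq super.
exists (c * C)%R => [|g mg g0]; first exact: mulr_ge0.
have mop : meas (fun y => op g y `^ p) by exact: measurable_poweR_op.
apply: (@le_trans _ _ (c%:E * \int[sigma]_y (op g y `^ p * v y))); last first.
  by rewrite EFinM -muleA lee_wpmul2l ?lee_fin//; exact: norm.
rewrite -ge0_integralZl_EFin//; last 2 first.
  by move=> y _; rewrite mule_ge0// poweR_ge0.
  exact: emeasurable_funM.
apply: ae_ge0_le_integral => //.
- by move=> y _; rewrite mule_ge0// poweR_ge0.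
- exact: emeasurable_funM.
- by move=> y _; rewrite mule_ge0 ?lee_fin// mule_ge0// poweR_ge0.
- by apply: measurable_funeM; exact: emeasurable_funM.
- by apply: (ae_imp wv) => y wy _; rewrite muleCA lee_wpmul2l// poweR_ge0.
Qed.

End potentials.

Lemma potential_density (R : realType) (X : pmetricType R)
    (sigma mu : {measure set (borel X) -> \bar R}) (K : X -> X -> \bar R) (w : borel X -> \bar R) x :
  quasi_metric_kernel K -> measurable_fun [set: borel X] w -> (forall y, 0 <= w y) ->
  (forall A, measurable A -> mu A = \int[sigma]_(y in A) w y) ->
  potential K mu x = kernel_op K sigma w x.
Proof.
move=> hK mw w0 muE; apply: (ge0_integral_density mw w0 muE).
  exact: measurable_kernel_section.
by move=> y; exact/ltW/qmk_gt0.
Qed.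

Theorem theorem1p3 (R : realType) (X : pmetricType R)
    (sigma : {sigma_finite_measure set (borel X) -> \bar R})
    (K : X -> X -> \bar R) (hK : quasi_metric_kernel K)
    (p q : R) (hq : (1 < q)%R) (hpq : (p^-1 + q^-1 = 1)%R)
    (f : borel X -> \bar R) (mf : measurable_fun [set: borel X] f)
    (hf : {ae sigma, forall x, 0 <= f x < +oo}) :
  let omega : {measure set (borel X) -> \bar R} := power_density sigma q mf in
  let solvable :=
    exists eps : R, (0 < eps)%R /\
    exists u : borel X -> R,
      [/\ measurable_fun [set: borel X] u,
          forall x, (0 <= u x)%R &
          {ae sigma, forall x,
            (u x)%:E = kernel_op K sigma (fun y => (u y `^ q)%:E) x
                       + eps%:E * f x}] in
  let cond2 :=
    cross_condition K sigma omega (q / p) /\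
    exists C : R, forall g : borel X -> R,
      (forall x, (0 <= g x)%R) -> g \in Lfun sigma p%:E ->
      \int[omega]_x (kernel_op K sigma (EFin \o g) x `^ p)
        <= C%:E * \int[sigma]_x (g x `^ p)%:E in
  let cond3 :=
    cross_condition K sigma omega (q / p) /\
    exists C : R, forall (x : X) (a : R), (0 < a)%R ->
      \int[sigma]_(y in qball K x a)
          (potential K (mrestr omega (measurable_qball hK x a)) y `^ q)
        <= C%:E * omega (qball K x a) in
  let cond4 :=
    exists C : R, {ae sigma, forall x,
      kernel_op K sigma (fun y => potential K omega y `^ q) x
        <= C%:E * potential K omega x
      /\ potential K omega x < +oo} in
  [/\ solvable <-> cond2, solvable <-> cond3 & solvable <-> cond4].
Proof.
move=> omega solvable cond2 cond3 cond4.
have [M M1 hM] := quasi_metric_min hK.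
have qm : (0 < q - 1)%R by rewrite subr_gt0.
have p1 : (1 < p)%R by exact: (conjugate_gt1 hq hpq).
pose w y := f y `^ q.
have mw : measurable_fun [set: borel X] w.
  exact: (measurableT_comp (measurable_poweR q) mf).
have w0 y : 0 <= w y by exact: poweR_ge0.
have omegaE A : omega A = mass sigma w A by [].
have crossE : cross_condition K sigma omega (q / p) <->
    exists A : R, dyadic_cross sigma K w (q - 1) A.
  by rewrite (conjugate_sub1_div hq hpq); exact: cross_dyadicP.
have potE x : potential K omega x = kernel_op K sigma w x.
  exact: potential_density.
have potBE x a y : potential K (mrestr omega (measurable_qball hK x a)) y =
    kernel_op K sigma (fun z => (\1_(qball K x a) z)%:E * w z) y.
{ have mB := measurable_qball hK x a.
  apply: potential_density => //.
  - apply: emeasurable_funM => //; apply/measurable_EFinP; exact: measurable_indic.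
  - by move=> z; rewrite mule_ge0// lee_fin.
  - move=> A mA; transitivity (\int[sigma]_(z in A `&` qball K x a) w z); first by [].
    by rewrite integral_mkcondr; apply: eq_integral => z _; rewrite epatch_indic muleC. }
have [f_ge0 f_fin] : {ae sigma, forall x, 0 <= f x} /\ {ae sigma, forall x, f x < +oo}.
  by split; apply: (ae_imp hf) => x /andP[].
have omega_int h : measurable_fun [set: borel X] h -> (forall x, 0 <= h x) ->
    \int[omega]_x h x = \int[sigma]_x (h x * w x).
  exact: ge0_integral_density.
have mop g : measurable_fun [set: borel X] g -> (forall y, 0 <= g y) ->
    measurable_fun [set: borel X] (fun y => kernel_op K sigma g y `^ p).
  move=> mg g0; apply: (measurableT_comp (measurable_poweR p)).
  exact: measurable_kernel_op.
have sol2 : solvable -> cond2.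
{ move=> [eps [eps0 [u [mu u0 sol]]]].
  have wf : {ae sigma, forall y, w y = f y `^ q} by exact: aeW.
  have mu' : measurable_fun [set: borel X] (EFin \o u) by exact/measurable_EFinP.
  have [dc [C C0 norm]] :=
    cross_norm_of_solution hK M1 hM mu' u0 mw w0 wf f_ge0 hq hpq eps0 sol.
  split; first exact/crossE.
  exists C => g g0 /[1!inE] /andP[/[1!inE] mg _].
  have mg' : measurable_fun [set: borel X] (EFin \o g) by exact/measurable_EFinP.
  have g0' y : 0 <= (EFin \o g) y by rewrite lee_fin.
  rewrite omega_int; [|exact: mop|by move=> y; exact: poweR_ge0].
  exact: norm. }
have cond23 : cond2 -> cond3.
{ move=> [cross [C norm]]; split => //.
  have C0 : (0 <= Num.max C 0)%R by rewrite le_max lexx orbT.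
  have norm' g : (forall y, (0 <= g y)%R) -> g \in Lfun sigma p%:E ->
    \int[sigma]_y (kernel_op K sigma (EFin \o g) y `^ p * w y) <=
    (Num.max C 0)%:E * \int[sigma]_y (g y `^ p)%:E.
    move=> g0 gL; have /[1!inE] /andP[/[1!inE] mg _] := gL.
    have mg' : measurable_fun [set: borel X] (EFin \o g) by exact/measurable_EFinP.
    have g0' y : 0 <= (EFin \o g) y by rewrite lee_fin.
    rewrite -omega_int; [|exact: mop|by move=> y; exact: poweR_ge0].
    apply: (le_trans (norm g g0 gL)); rewrite lee_wpmul2r ?lee_fin ?le_max ?lexx//.
    by apply: integral_ge0 => y _; rewrite lee_fin powR_ge0.
  have [C' C'0 test] := testing_of_norm_inequality hK M1 hM mw w0 hq hpq C0 norm'.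
  exists C' => x a a0; under eq_integral do rewrite potBE.
  exact: test. }
have cond34 : cond3 -> cond4.
{ move=> [/crossE[A dc] [C test]].
  have C0 : (0 <= Num.max C 0)%R by rewrite le_max lexx orbT.
  have test' x a : (0 < a)%R ->
    \int[sigma]_(y in qball K x a)
      (kernel_op K sigma (fun z => (\1_(qball K x a) z)%:E * w z) y `^ q) <=
    (Num.max C 0)%:E * mass sigma w (qball K x a).
    move=> a0; under eq_integral do rewrite -potBE.
    by apply: (le_trans (test x a a0)); rewrite lee_wpmul2r ?lee_fin ?le_max ?lexx.
  eexists; apply: (ae_imp (kernel_op_fin_of_testing hK M1 hM mw w0 hq C0 dc test')) => x wx.
  under eq_fun do rewrite potE.
  rewrite potE; split => //; exact: (pointwise_of_testing hK M1 hM mw w0 hq C0 dc test'). }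
have cond4sol : cond4 -> solvable.
{ move=> [C pw].
  (* f is nonnegative only almost everywhere; K does not see the difference
     between f and f'. *)
  pose f' y := maxe (f y) 0.
  have f'0 y : 0 <= f' y by rewrite le_max lexx orbT.
  have ff' : {ae sigma, forall y, f y = f' y}.
    by apply: (ae_imp f_ge0) => y fy; rewrite /f' max_l.
  have mf' : measurable_fun [set: borel X] f' by exact: measurable_maxe.
  have f'fin : {ae sigma, forall y, f' y < +oo}.
    by apply: (ae_imp (ae_conj ff' f_fin)) => y [<-].
  have mw' : measurable_fun [set: borel X] (fun y => f' y `^ q).
    exact: (measurableT_comp (measurable_poweR q) mf').
  have opE x : kernel_op K sigma (fun y => f' y `^ q) x = potential K omega x.
    rewrite potE; apply: eq_kernel_op_ae => //.
      by move=> y; exact: poweR_ge0.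
    by apply: (ae_imp ff') => y; rewrite /w => ->.
  have C0 : (0 <= Num.max C 0)%R by rewrite le_max lexx orbT.
  have pw' : {ae sigma, forall x,
      kernel_op K sigma (fun y => kernel_op K sigma (fun z => f' z `^ q) y `^ q) x <=
      (Num.max C 0)%:E * kernel_op K sigma (fun z => f' z `^ q) x /\
      kernel_op K sigma (fun z => f' z `^ q) x < +oo}.
    apply: (ae_imp pw) => x [h fin]; rewrite opE; split => //.
    under eq_fun do rewrite opE.
    apply: (le_trans h); rewrite lee_wpmul2r ?lee_fin ?le_max ?lexx//.
    by rewrite potE; exact: kernel_op_ge0.
  have [eps e0 [u [mu u0 sol]]] := solution_of_pointwise hK mf' f'0 f'fin hq C0 pw'.
  exists eps; split => //; exists u; split => //.
  by apply: (ae_imp (ae_conj sol ff')) => x [-> ->]. }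
by split; split; tauto.
Qed.
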